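(* Let $\alpha>0$ and let $\beta>(\alpha+3)/2$. Let $\varphi$ be such that $(I-\partial_x^2)^{\beta/2}\varphi\in L^1(\mathbb{R}^2)$. Let $$G(t,x,y)=\mathcal{F}^{-1}_{(\xi,\eta)\to(x,y)}\Big[e^{-i\frac{t}{1+|\xi|^{\alpha}}(\xi+\eta^2/\xi)}\Big]$$ be the fundamental solution of the linear KP-BBM type equation $(u_t+u_x+Lu_t)_x+u_{yy}=0$. Then, for $t\neq 0$, $$u(t,\cdot,\cdot)\equiv S(t)\varphi=G\star\varphi$$ can be written as $$\frac{\partial}{\partial x}\big(A\star(I-\partial_x^2)^{\beta/2}\varphi\big),\qquad\text{where}\qquad A=\partial_x^{-1}(I-\partial_x^2)^{-\beta/2}G$$ and, for $t\ne0$, $$A(t,\cdot,\cdot)\in C(\mathbb{R}^2)\cap L^{\infty}(\mathbb{R}^2)\cap C^1_x(\mathbb{R}^2).$$ Moreover, $(A\star(I-\partial_x^2)^{\beta/2}\varphi)(t,x,y)$ is, for fixed $t\neq 0$, continuous in $x$ and $y$ and satisfies $$\lim_{|x|\to\infty}\big(A\star(I-\partial_x^2)^{\beta/2}\varphi\big)(t,x,y)=0$$ for any $y\in\mathbb{R}$ and $t\neq 0$. Thus $$\int_{-\infty}^{\infty}u(t,x,y)\,dx=0,\qquad\forall y\in\mathbb{R},\ \forall t\neq 0,$$ in the sense of generalized Riemann integrals.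
   Context: The Cauchy problem considered is $(u_t+u_x+Lu_t)_x+u_{yy}=0$, $u(0,x,y)=\varphi(x,y)$, where $L$ acts in the variable $x$ as the Fourier multiplier $\widehat{Lf}(\xi)=|\xi|^{\alpha}\widehat f(\xi)$. $S(t)$ is the Fourier multiplier on $\mathbb{R}^2$ with symbol $e^{-i\frac{t}{1+|\xi|^{\alpha}}(\xi+\eta^2/\xi)}$, i.e. $S(t)=e^{-t(I+L)^{-1}[\partial_x+\partial_x^{-1}\partial_y^2]}$. The inverse Fourier transform is $\mathcal{F}^{-1}[m](x,y)=(2\pi)^{-2}\int_{\mathbb{R}^2}e^{i(x\xi+y\eta)}m(\xi,\eta)\,d\xi\,d\eta$. The operators $(I-\partial_x^2)^{s}$ and $\partial_x^{-1}$ are the Fourier multipliers in $x$ with symbols $(1+\xi^2)^{s}$ and $1/(i\xi)$; thus $A(t,x,y)=(2\pi)^{-2}\int_{\mathbb{R}^2}\frac{1}{i\xi(1+\xi^2)^{\beta/2}}e^{-\frac{it}{1+|\xi|^{\alpha}}(\xi+\eta^2/\xi)}e^{i(x\xi+y\eta)}\,d\xi\,d\eta$, understood as an oscillatory integral (the conditionally convergent integral in $\eta$ is performed first, then the integral in $\xi$). Here $\varphi$ is a tempered distribution on $\mathbb{R}^2$ and $\star$ denotes convolution in $(x,y)\in\mathbb{R}^2$ at fixed $t$. $C^1_x(\mathbb{R}^2)$ denotes the set of continuous functions on $\mathbb{R}^2$ that are differentiable with respect to $x$. ''In the sense of generalized Riemann integrals'' means as an improper integral: $\int_{-\infty}^{\infty}f(x)\,dx=\lim_{R,R'\to+\infty}\int_{-R'}^{R}f(x)\,dx$.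 *)

(* Defs.v *)
From HB Require Import structures.
From mathcomp Require Import all_boot all_order all_algebra.
From mathcomp Require Import all_classical all_reals all_analysis.
From mathcomp Require Import complex.

Set Implicit Arguments.
Unset Strict Implicit.
Unset Printing Implicit Defensive.

Import Order.TTheory GRing.Theory Num.Theory.
Import numFieldNormedType.Exports.

Local Open Scope classical_set_scope.
Local Open Scope ring_scope.
Local Open Scope complex_scope.

(* real-valued modulus of a complex number *)
Notation cmod := ComplexField.Normc.normc (only parsing).

Section ComplexAnalysis.
Context {R : realType}.
Local Notation C := R[i].

(* The library has no topology or integral for R[i]-valued functions: limits,
   derivatives and integrals are taken on real and imaginary parts. *)

Definition expi (a : R) : C := cos a +i* sin a.

Definition re {T : Type} (f : T -> C) (x : T) : R := complex.Re (f x).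
Definition im {T : Type} (f : T -> C) (x : T) : R := complex.Im (f x).

Definition ccontinuous {T : topologicalType} (f : T -> C) : Prop :=
  continuous (re f) /\ continuous (im f).

Definition ccvg {T : Type} (F : set_system T) (f : T -> C) (l : C) : Prop :=
  re f x @[x --> F] --> complex.Re l /\ im f x @[x --> F] --> complex.Im l.

Definition clim {T : Type} (F : set_system T) (f : T -> C) : C :=
  lim (re f x @[x --> F]) +i* lim (im f x @[x --> F]).

Definition cintegrable {d : measure_display} {T : measurableType d}
    (mu : {measure set T -> \bar R}) (D : set T) (f : T -> C) : Prop :=
  mu.-integrable D (EFin \o re f) /\ mu.-integrable D (EFin \o im f).

Definition cint {d : measure_display} {T : measurableType d}
    (mu : {measure set T -> \bar R}) (D : set T) (f : T -> C) : C :=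
  (\int[mu]_(x in D) re f x) +i* (\int[mu]_(x in D) im f x).

Definition leb1 : {measure set (measurableTypeR R) -> \bar R} :=
  lebesgue_measure.

Definition leb2 :
    {measure set (measurableTypeR R * measurableTypeR R) -> \bar R} :=
  (@lebesgue_measure R \x @lebesgue_measure R)%E.

Definition segint (h : R -> C) (r : R * R) : C :=
  cint leb1 `[- r.2, r.1] h.

(* Continuity of the integrand makes the integrals over segments Riemann
   integrals: the Lebesgue integral in segint agrees with them. *)
Definition is_improper_integral (h : R -> C) (l : C) : Prop :=
  ccontinuous h /\ ccvg (filter_prod +oo +oo) (segint h) l.

Definition improper_integral (h : R -> C) : C :=
  clim (filter_prod +oo +oo) (segint h).

Definition cderivable (v : R * R) (f : R * R -> C) (p : R * R) : Prop :=
  derivable (re f) p v /\ derivable (im f) p v.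

Definition cderive (v : R * R) (f : R * R -> C) (p : R * R) : C :=
  'D_v (re f) p +i* 'D_v (im f) p.

Definition e_x : R * R := (1, 0).
Definition e_y : R * R := (0, 1).

Definition convolution (f g : R * R -> C) (p : R * R) : C :=
  cint leb2 setT (fun q => f (p - q) * g q).

Definition Linfty (f : R * R -> C) : Prop :=
  [/\ measurable_fun setT (re f : measurableTypeR R * measurableTypeR R -> _),
      measurable_fun setT (im f : measurableTypeR R * measurableTypeR R -> _) &
      exists M : R, {ae leb2, forall p, cmod (f p) <= M}].

Definition C1x (f : R * R -> C) : Prop :=
  ccontinuous f /\ forall p, cderivable e_x f p.

End ComplexAnalysis.

Section TemperedDistributions.
Context {R : realType}.
Local Notation C := R[i].
Local Notation fn := (R * R -> C).

(* Iterated partial derivative along a word: true stands for d/dy, false for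
   d/dx. *)
Definition pderiv (w : seq bool) (f : fn) : fn :=
  foldr (fun b g => cderive (if b then e_y else e_x) g) f w.

Definition weight (k : nat) (p : R * R) : R := (1 + `|p.1| + `|p.2|) ^+ k.

Definition smooth (f : fn) : Prop :=
  forall w, ccontinuous (pderiv w f) /\
    forall b p, cderivable (if b then e_y else e_x) (pderiv w f) p.

Definition schwartz (f : fn) : Prop :=
  smooth f /\
  forall k w, exists M : R, forall p, weight k p * cmod (pderiv w f p) <= M.

(* Functionals are total on R * R -> C; only their values on Schwartz
   functions matter. *)
Definition dist : Type := fn -> C.

Definition tempered (T : dist) : Prop :=
  (forall (a : C) f g, schwartz f -> schwartz g ->
     T (fun p => a * f p + g p) = a * T f + T g) /\
  exists (N : nat) (M : R), forall f, schwartz f -> forall B : R,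
    (forall w p, (size w <= N)%N -> weight N p * cmod (pderiv w f p) <= B) ->
    cmod (T f) <= M * B.

Definition has_density (T : dist) (g : fn) : Prop :=
  forall psi, schwartz psi ->
    cintegrable leb2 setT (fun p => g p * psi p) /\
    T psi = cint leb2 setT (fun p => g p * psi p).

Definition dist_of (g : fn) : dist :=
  fun psi => cint leb2 setT (fun p => g p * psi p).

Definition fourier (f : fn) (z : R * R) : C :=
  cint leb2 setT (fun p => expi (- (p.1 * z.1 + p.2 * z.2)) * f p).

Definition inv_fourier (f : fn) (p : R * R) : C :=
  (((2 * pi) ^- 2)%:C : C) *
  cint leb2 setT (fun z => expi (p.1 * z.1 + p.2 * z.2) * f z).

Definition dist_fourier (T : dist) : dist := fun psi => T (fourier psi).

Definition dist_inv_fourier (T : dist) : dist := fun psi => T (inv_fourier psi).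

(* U = m(D) T for a smooth symbol m of polynomial growth: the distribution
   F T is multiplied by m by transposition. *)
Definition smooth_multiplier (m : fn) (T U : dist) : Prop :=
  forall psi, schwartz psi ->
    dist_fourier U psi = dist_fourier T (fun z => m z * psi z).

(* U = m(D) T for a bounded measurable symbol m, when F T is a function g:
   F U is the function m g. *)
Definition multiplier (m : fn) (T U : dist) : Prop :=
  exists g : fn, has_density (dist_fourier T) g /\
    has_density (dist_fourier U) (fun z => m z * g z).

(* U = S * T through the exchange formula F U = F S . F T, when F S and F T are
   functions whose product is a tempered distribution. *)
Definition dist_conv (S T U : dist) : Prop :=
  exists g h : fn, [/\ has_density (dist_fourier S) g,
    has_density (dist_fourier T) h &
    has_density (dist_fourier U) (fun z => g z * h z)].

End TemperedDistributions.

Section KPBBM.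
Context {R : realType}.
Local Notation C := R[i].

Definition kp_symbol (alpha t : R) (z : R * R) : C :=
  expi (- (t / (1 + `|z.1| `^ alpha) * (z.1 + z.2 ^+ 2 / z.1))).

Definition bessel_symbol (beta : R) (z : R * R) : C :=
  ((1 + z.1 ^+ 2) `^ (beta / 2))%:C.

Definition dx_symbol (z : R * R) : C := 0 +i* z.1.

Definition is_S (alpha t : R) (phi u : dist) : Prop :=
  multiplier (kp_symbol alpha t) phi u.

Definition G_dist (alpha t : R) : dist :=
  dist_inv_fourier (dist_of (kp_symbol alpha t)).

(* The value at xi = 0 (where x / 0 = 0) is irrelevant. *)
Definition A_integrand (alpha beta t : R) (p : R * R) (xi eta : R) : C :=
  (dx_symbol (xi, eta) * bessel_symbol beta (xi, eta))^-1 *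
  kp_symbol alpha t (xi, eta) * expi (p.1 * xi + p.2 * eta).

Definition A_inner (alpha beta t : R) (p : R * R) (xi : R) : C :=
  improper_integral (A_integrand alpha beta t p xi).

(* Oscillatory integral: improper in eta first, then Lebesgue in xi, where it
   converges absolutely. *)
Definition A_kernel (alpha beta t : R) (p : R * R) : C :=
  (((2 * pi) ^- 2)%:C : C) * cint leb1 setT (A_inner alpha beta t p).

Definition A_converges (alpha beta t : R) : Prop :=
  forall p : R * R,
    (forall xi : R, xi != 0 ->
       is_improper_integral (A_integrand alpha beta t p xi)
         (A_inner alpha beta t p xi)) /\
    cintegrable leb1 setT (A_inner alpha beta t p).

End KPBBM.

(* Main.v *)
(* For xi <> 0 the eta-integral defining A is a Fresnel integral: completing the
   square turns it into a(xi) e^{i (x xi + y^2 b(xi))}, where, up to constants,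
   |a(xi)| = ((1 + |xi|^alpha) |xi| / |t|)^{1/2} / (|xi| (1 + xi^2)^{beta/2}).
   This amplitude is integrable, and so is xi a(xi), because
   beta > (alpha + 3) / 2. Hence A and its x-derivative A' are absolutely
   convergent oscillatory integrals in xi, so A is bounded, continuous and C^1 in
   x, and by the Riemann-Lebesgue lemma it tends to 0 as |x| -> oo. Dominated
   convergence transfers all this to A * f, whose x-derivative is u = A' * f, so
   that the integral of u(., y) over a segment is an increment of A * f.
   The Fourier transforms of A and u are identified by testing against Schwartz
   functions: the truncated eta-integrals are bounded uniformly with respect to
   the truncation, and Fubini reduces each truncated pairing to the Fourier
   inversion formula. *)
Require Import Defs.
From mathcomp Require Import all_boot all_order all_algebra.
From mathcomp Require Import all_classical all_reals all_analysis.
From mathcomp Require Import complex measurable_realfun lebesgue_integral_fubini.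
From mathcomp Require Import ring lra.
Import Order.TTheory GRing.Theory Num.Theory.
Import numFieldNormedType.Exports.
Local Open Scope classical_set_scope.
Local Open Scope ring_scope.
Local Open Scope complex_scope.

Set Implicit Arguments.
Unset Strict Implicit.
Unset Printing Implicit Defensive.

(** Two obstacles shape the proof: the eta-integral converges only conditionally, and the symbol
    1/xi is singular on the axis xi = 0. Both are met by pairing a kernel with [fourier chi], where
    [chi] is a Schwartz function such that the symbol times [chi] decays. For fixed xi <> 0 the
    pairing truncated to |eta| <= n has two limits, one containing the Fresnel constants [Jr] and
    [Ji], the other given by the inversion formula; uniqueness of limits equates them, so the
    constants may stay symbolic. Fourier inversion itself comes from the damping exp(-e|x|), whose
    transform is the Poisson kernel 2e/(e^2 + x^2). For e = 1, products of two such kernels also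
    serve as integrable majorants of Schwartz functions and of their transforms. The threshold on
    beta is exactly the integrability of xi a(xi) at infinity: its size there is |xi|^(1/2 + alpha/2
    - beta), an exponent below -1, while a(xi) is of order |xi|^(-1/2) at 0. *)

Section ComplexArith.
Context {R : realType}.
Local Notation C := R[i].
Implicit Types x y : C.

Lemma ReD x y : complex.Re (x + y) = complex.Re x + complex.Re y.
Proof. by case: x y => [a b] [c d]. Qed.

Lemma ImD x y : complex.Im (x + y) = complex.Im x + complex.Im y.
Proof. by case: x y => [a b] [c d]. Qed.

Lemma ReN x : complex.Re (- x) = - complex.Re x.
Proof. by case: x => [a b]. Qed.

Lemma ImN x : complex.Im (- x) = - complex.Im x.
Proof. by case: x => [a b]. Qed.

Lemma ReM x y : complex.Re (x * y) =
  complex.Re x * complex.Re y - complex.Im x * complex.Im y.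
Proof. by case: x y => [a b] [c d]. Qed.

Lemma ImM x y : complex.Im (x * y) =
  complex.Re x * complex.Im y + complex.Im x * complex.Re y.
Proof. by case: x y => [a b] [c d]. Qed.

Lemma ReZ (a : R) x : complex.Re (a%:C * x) = a * complex.Re x.
Proof. by rewrite ReM /= mul0r subr0. Qed.

Lemma ImZ (a : R) x : complex.Im (a%:C * x) = a * complex.Im x.
Proof. by rewrite ImM /= mul0r addr0. Qed.

Lemma complex_eq x y : complex.Re x = complex.Re y ->
  complex.Im x = complex.Im y -> x = y.
Proof. by case: x y => [a b] [c d] /= -> ->. Qed.

Lemma ler_Re_cmod x : `|complex.Re x| <= cmod x.
Proof.
case: x => [a b] /=; rewrite -sqrtr_sqr ler_wsqrtr// lerDl sqr_ge0 //.
Qed.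

Lemma ler_Im_cmod x : `|complex.Im x| <= cmod x.
Proof.
case: x => [a b] /=; rewrite -sqrtr_sqr ler_wsqrtr// lerDr sqr_ge0 //.
Qed.

Lemma cmod_ge0 x : 0 <= cmod x.
Proof. by case: x => a b; exact: sqrtr_ge0. Qed.

Lemma cmod_le x : cmod x <= `|complex.Re x| + `|complex.Im x|.
Proof.
case: x => [a b] /=.
rewrite -[leRHS]ger0_norm ?addr_ge0// -[leRHS]sqrtr_sqr ler_wsqrtr//.
rewrite sqrrD !real_normK ?num_real// addrAC lerDl.
by rewrite mulrn_wge0 ?mulr_ge0.
Qed.

Lemma cmodM x y : cmod (x * y) = cmod x * cmod y.
Proof. exact: ComplexField.Normc.normcM. Qed.

Lemma cmodV x : cmod x^-1 = (cmod x)^-1.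
Proof. exact: ComplexField.Normc.normcV. Qed.

Lemma cmodR (a : R) : cmod (a%:C : C) = `|a|.
Proof. by rewrite /= expr0n addr0 sqrtr_sqr. Qed.

Lemma cmod0 : cmod (0 : C) = 0.
Proof. exact: ComplexField.Normc.normc0. Qed.

Lemma cmodD x y : cmod (x + y) <= cmod x + cmod y.
Proof. exact: le_normcD. Qed.

Lemma cmodN x : cmod (- x) = cmod x.
Proof. exact: normcN. Qed.

Lemma cmod_expi (a : R) : cmod (expi a) = 1.
Proof. by rewrite /= cos2Dsin2 sqrtr1. Qed.

Lemma expiD (a b : R) : expi (a + b) = expi a * expi b.
Proof. by apply: complex_eq; rewrite /= ?cosD ?sinD// addrC. Qed.

Lemma expi0 : expi (0 : R) = 1.
Proof. by rewrite /expi cos0 sin0. Qed.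

End ComplexArith.

(** * Measurability of complex-valued functions *)

Section ComplexMeasurable.
Context {R : realType} {d : measure_display} {T : measurableType d}.
Local Notation C := R[i].
Implicit Types f g : T -> C.

Definition cmeasurable f : Prop :=
  measurable_fun setT (re f) /\ measurable_fun setT (im f).

Lemma cmeasurable_cst (c : C) : cmeasurable (fun=> c).
Proof. by split; exact: measurable_cst. Qed.

Lemma cmeasurableM f g : cmeasurable f -> cmeasurable g ->
  cmeasurable (fun x => f x * g x).
Proof.
move=> [f1 f2] [g1 g2]; split.
  rewrite (_ : re _ = (re f \* re g) \- (im f \* im g)).
    by apply: measurable_funB; exact: measurable_funM.
  by apply/funext => x; rewrite /re ReM.
rewrite (_ : im _ = (re f \* im g) \+ (im f \* re g)).
  by apply: measurable_funD; exact: measurable_funM.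
by apply/funext => x; rewrite /im ImM.
Qed.

Lemma cmeasurableR (h : T -> R) : measurable_fun setT h ->
  cmeasurable (fun x => (h x)%:C).
Proof. by move=> mh; split => //; exact: measurable_cst. Qed.

Lemma cmeasurable_pair (h k : T -> R) : measurable_fun setT h ->
  measurable_fun setT k -> cmeasurable (fun x => h x +i* k x).
Proof. by []. Qed.

Lemma cmeasurable_expi (h : T -> R) : measurable_fun setT h ->
  cmeasurable (fun x => expi (h x)).
Proof.
move=> mh; split; apply: measurableT_comp mh; apply: continuous_measurable_fun.
  exact: continuous_cos.
exact: continuous_sin.
Qed.

(** The inverse is [h] times the power -1 of [h ^+ 2], and real powers of measurable functions are
    measurable. Where [h] vanishes both sides are 0, because the inverse of 0 is 0. *)
Lemma measurable_funV (h : T -> R) : measurable_fun setT h ->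
  measurable_fun setT (fun x => (h x)^-1).
Proof.
move=> mh.
rewrite (_ : (fun x => _) = (fun x => h x * (h x ^+ 2) `^ (-1))).
  apply: measurable_funM => //.
  have := measurable_funX 2 mh.
  exact: (@measurableT_comp _ _ _ _ _ _ (@powR R ^~ (-1)) _ (fun x => h x ^+ 2)
    (measurable_powR (-1))).
apply/funext => x; have [->|hx0] := eqVneq (h x) 0; first by rewrite invr0 mul0r.
rewrite powR_inv1 ?sqr_ge0// expr2 invfM mulrA mulfV// mul1r //.
Qed.

Lemma cmeasurableV f : cmeasurable f -> cmeasurable (fun x => (f x)^-1).
Proof.
move=> [f1 f2].
have mN : measurable_fun setT (fun x => (re f x ^+ 2 + im f x ^+ 2)^-1).
  by apply: measurable_funV; apply: measurable_funD; exact: measurable_funX.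
split.
  rewrite (_ : re _ = re f \* (fun x => (re f x ^+ 2 + im f x ^+ 2)^-1)).
    exact: measurable_funM.
  by apply/funext => x; rewrite /re /im /=; case: (f x).
rewrite (_ : im _ = (\- im f) \* (fun x => (re f x ^+ 2 + im f x ^+ 2)^-1)).
  by apply: measurable_funM => //; exact: measurable_funN.
by apply/funext => x; rewrite /re /im /=; case: (f x) => a b /=; rewrite mulNr.
Qed.

Lemma measurable_cmod f : cmeasurable f ->
  measurable_fun setT (fun x => cmod (f x)).
Proof.
move=> [f1 f2].
rewrite (_ : (fun x => _) = Num.sqrt \o (fun x => re f x ^+ 2 + im f x ^+ 2)).
  have ms : measurable_fun setT (@Num.sqrt R).
    exact: continuous_measurable_fun (@sqrt_continuous R).
  have := measurable_funD (measurable_funX 2 f1) (measurable_funX 2 f2).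
  exact: (measurableT_comp ms).
by apply/funext => x /=; rewrite /re /im; case: (f x).
Qed.

End ComplexMeasurable.

Lemma cmeasurable_comp {R : realType} {d d' : measure_display}
  {T : measurableType d} {T' : measurableType d'} (f : T' -> R[i]) (h : T -> T') :
  cmeasurable f -> measurable_fun setT h -> cmeasurable (fun x => f (h x)).
Proof. by move=> [f1 f2] mh; split;
  [exact: (measurableT_comp f1 mh)|exact: (measurableT_comp f2 mh)]. Qed.

(** * Integration of complex-valued functions *)

Section DominatedConvergence.
Context {R : realType} {d : measure_display} {T : measurableType d}.
Variable mu : {measure set T -> \bar R}.

(** A countable base is what lets sequential dominated convergence be applied along a filter;
    points, both infinities and [\oo] are treated alike through it. *)
Definition countably_generated {S : Type} (F : set_system S) : Prop :=
  exists U : nat -> set S, (forall n, F (U n)) /\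
    forall A, F A -> exists n, U n `<=` A.

Lemma dct_seq (g : nat -> T -> R) (f G : T -> R) :
  (forall n, measurable_fun setT (g n)) ->
  (forall n x, `|g n x| <= G x) -> mu.-integrable setT (EFin \o G) ->
  (forall x, g n x @[n --> \oo] --> f x) ->
  \int[mu]_x g n x @[n --> \oo] --> \int[mu]_x f x.
Proof.
move=> mg gG iG gf.
have mf : measurable_fun setT f.
  by apply: (measurable_fun_cvg mg) => x _; exact: gf.
have cE x : [set: T] x -> (g n x)%:E @[n --> \oo] --> (f x)%:E.
  by move=> _; apply: cvg_EFin; [exact: nearW|exact: gf].
have [iF _ cv] := @dominated_convergence _ _ _ mu _ measurableT
   (fun n x => (g n x)%:E) (EFin \o f) (EFin \o G)
   (fun n => (measurable_EFinP _ _).2 (mg n))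
   ((measurable_EFinP _ _).2 mf)
   (aeW _ cE) iG (aeW _ (fun x n _ => gG n x)).
apply: fine_cvg; rewrite fineK; first exact: cv.
exact: integrable_fin_num.
Qed.

(** If convergence failed for some [e], every member of a countable base would contain a bad
    parameter; these parameters form a sequence converging to [F], which contradicts the sequential
    theorem. *)
Lemma dct_filter {S : Type} (F : set_system S) {FF : Filter F}
    (g : S -> T -> R) (f G : T -> R) :
  countably_generated F ->
  (forall s, measurable_fun setT (g s)) ->
  (forall s x, `|g s x| <= G x) -> mu.-integrable setT (EFin \o G) ->
  (forall x, g s x @[s --> F] --> f x) ->
  \int[mu]_x g s x @[s --> F] --> \int[mu]_x f x.
Proof.
move=> [U [FU UF]] mg gG iG gf.
apply/cvgrPdist_lt => e e0; apply: contrapT => nF.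
(* [V n] is the intersection of the [U k] with k < n, so that a point chosen in [V n] lies in all
   earlier base sets. *)
pose V n := iteri n (fun k A => U k `&` A) setT.
have FV n : F (V n).
  by elim: n => [|n IHn] /=; [exact: filterT|exact: filterI].
have VU n k s : V n s -> (k < n)%N -> U k s.
  elim: n => // n IHn [Us Vs]; rewrite ltnS leq_eqVlt => /predU1P[->//|].
  exact: IHn.
have : forall n, exists s, V n s /\
    ~ `|\int[mu]_x f x - \int[mu]_x g s x| < e.
  move=> n; apply: contrapT => /forallNP h; apply: nF.
  by apply: filterS (FV n) => s Vs; have /not_andP[//|/contrapT] := h s.
move=> /choice[s sP].
have sF : s n @[n --> \oo] --> F.
  move=> A /UF[N UA]; exists N.+1 => // n /= Nn; apply: UA.
  by have [Vs _] := sP n; exact: VU Vs Nn.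
have := @dct_seq (fun n => g (s n)) f G (fun n => mg _) (fun n => gG _) iG
  (fun x => cvg_comp _ _ sF (gf x)).
move=> /cvgrPdist_lt/(_ _ e0)[N _ /(_ N (leqnn _))] /= h.
by have [_] := sP N.
Qed.

End DominatedConvergence.

Section CountablyGenerated.
Context {R : realType}.

Lemma cg_nbhs {V : pseudoMetricType R} (p : V) : countably_generated (nbhs p).
Proof.
exists (fun n => ball p n.+1%:R^-1); split=> [n|A].
  by apply: nbhsx_ballx; rewrite invr_gt0.
rewrite -nbhs_ballE => -[e /= e0 eA].
have [n ne] : exists n : nat, n.+1%:R^-1 < e.
  have := archi_boundP (ltW (_ : 0 < e^-1)); rewrite invr_gt0 => /(_ e0).
  move=> h; exists (Num.bound e^-1); rewrite invf_plt ?posrE//.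
  by rewrite (lt_le_trans h)// ler_nat.
exists n => q /(le_ball (ltW ne)); exact: eA.
Qed.

Lemma cg_pinfty : countably_generated (pinfty_nbhs R).
Proof.
exists (fun n => [set x | n%:R < x]); split=> [n|A].
  by exists n%:R; split => //; exact: num_real.
move=> [M [Mr MA]].
exists (Num.bound `|M|) => x /= nx; apply: MA.
by rewrite (le_lt_trans (ler_norm _))// (lt_trans (archi_boundP _)).
Qed.

Lemma cg_ninfty : countably_generated (ninfty_nbhs R).
Proof.
exists (fun n => [set x | x < - n%:R]); split=> [n|A].
  by exists (- n%:R); split => //; rewrite num_real.
move=> [M [Mr MA]].
exists (Num.bound `|M|) => x /= nx; apply: MA.
rewrite (lt_le_trans nx)// lerNl (le_trans (ler_norm _))// normrN.
by rewrite ltW// archi_boundP.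
Qed.

Lemma cg_eventually : countably_generated (\oo : set_system nat).
Proof.
exists (fun n => [set k | (n <= k)%N]); split=> [n|A [N _ NA]].
  by exists n.
by exists N.
Qed.

End CountablyGenerated.

Section ComplexIntegral.
Context {R : realType} {d : measure_display} {T : measurableType d}.
Variable mu : {measure set T -> \bar R}.
Local Notation C := R[i].
Implicit Types f g : T -> C.

Lemma integrable_le (h G : T -> R) : measurable_fun setT h ->
  (forall x, `|h x| <= G x) -> mu.-integrable setT (EFin \o G) ->
  mu.-integrable setT (EFin \o h).
Proof.
move=> mh hG; apply: le_integrable => //; first exact/measurable_EFinP.
by move=> x _ /=; rewrite lee_fin (le_trans (hG x))// ler_norm.
Qed.

Lemma cintegrable_le f (G : T -> R) : cmeasurable f ->
  (forall x, cmod (f x) <= G x) -> mu.-integrable setT (EFin \o G) ->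
  cintegrable mu setT f.
Proof.
move=> [f1 f2] fG iG; split; apply: integrable_le iG => // x.
  by rewrite (le_trans _ (fG x))// ler_Re_cmod.
by rewrite (le_trans _ (fG x))// ler_Im_cmod.
Qed.

Lemma cintegrable_meas f : cintegrable mu setT f -> cmeasurable f.
Proof.
by move=> [/integrableP[f1 _] /integrableP[f2 _]]; split;
  exact/measurable_EFinP.
Qed.

Lemma cintegrable_cmod f : cintegrable mu setT f ->
  mu.-integrable setT (EFin \o (fun x => cmod (f x))).
Proof.
move=> fi; have mf := cintegrable_meas fi; case: fi => f1 f2.
have h := integrableD measurableT (integrable_norm f1) (integrable_norm f2).
apply: (@integrable_le _ (fun x => `|re f x| + `|im f x|)).
- exact: measurable_cmod.
- by move=> x; rewrite ger0_norm ?cmod_ge0// cmod_le.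
- exact: h.
Qed.

Lemma eq_cint f g : f =1 g -> cint mu setT f = cint mu setT g.
Proof. by move=> /funext ->. Qed.

Lemma cintD f g : cintegrable mu setT f -> cintegrable mu setT g ->
  cint mu setT (fun x => f x + g x) = cint mu setT f + cint mu setT g.
Proof.
move=> [f1 f2] [g1 g2]; apply: complex_eq => /=.
  rewrite -RintegralD//; apply: eq_Rintegral => x _; rewrite /re; exact: ReD.
rewrite -RintegralD//; apply: eq_Rintegral => x _; rewrite /im; exact: ImD.
Qed.

Lemma cintegrableZ (c : C) f : cintegrable mu setT f ->
  cintegrable mu setT (fun x => c * f x).
Proof.
move=> fi; apply: (@cintegrable_le _ (fun x => cmod c * cmod (f x))).
- by apply: cmeasurableM; [exact: cmeasurable_cst|exact: cintegrable_meas].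
- by move=> x; rewrite cmodM.
- exact: (integrableZl measurableT (cmod c) (cintegrable_cmod fi)).
Qed.

Lemma cintegrableM_bounded f g (M : R) : cintegrable mu setT f ->
  cmeasurable g -> (forall x, cmod (g x) <= M) ->
  cintegrable mu setT (fun x => g x * f x).
Proof.
move=> fi mg gM; apply: (@cintegrable_le _ (fun x => M * cmod (f x))).
- by apply: cmeasurableM => //; exact: cintegrable_meas.
- by move=> x; rewrite cmodM ler_wpM2r ?cmod_ge0.
- exact: (integrableZl measurableT M (cintegrable_cmod fi)).
Qed.

Lemma cintZ (c : C) f : cintegrable mu setT f ->
  cint mu setT (fun x => c * f x) = c * cint mu setT f.
Proof.
move=> [f1 f2]; case: c => a b; apply: complex_eq; rewrite ?ReM ?ImM /=.
  rewrite -!RintegralZl// -RintegralB//; first last.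
  - exact: (integrableZl measurableT b f2).
  - exact: (integrableZl measurableT a f1).
  by apply: eq_Rintegral => x _; rewrite /re ReM.
rewrite -!RintegralZl// -RintegralD//; first last.
- exact: (integrableZl measurableT b f1).
- exact: (integrableZl measurableT a f2).
by apply: eq_Rintegral => x _; rewrite /im ImM.
Qed.

Lemma cint0 : cint mu setT (fun=> 0 : C) = 0.
Proof.
by apply: complex_eq; rewrite /= /re /im /= Rintegral_cst// mul0r.
Qed.

(** Real and imaginary parts are each bounded by the integral of [G], hence the factor 2; it costs
    nothing, since only the existence of bounds matters later. *)
Lemma cmod_cint f (G : T -> R) : cmeasurable f ->
  (forall x, cmod (f x) <= G x) -> mu.-integrable setT (EFin \o G) ->
  cmod (cint mu setT f) <= 2 * \int[mu]_x G x.
Proof.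
move=> mf fG iG; have [f1 f2] := cintegrable_le mf fG iG.
rewrite (le_trans (cmod_le _))//= mulr_natl mulr2n.
apply: lerD.
  rewrite (le_trans (le_normr_Rintegral _ f1))//; apply: le_Rintegral => //.
    exact: (integrable_norm f1).
  by move=> x _; rewrite (le_trans _ (fG x))// ler_Re_cmod.
rewrite (le_trans (le_normr_Rintegral _ f2))//; apply: le_Rintegral => //.
  exact: (integrable_norm f2).
by move=> x _; rewrite (le_trans _ (fG x))// ler_Im_cmod.
Qed.

Lemma cdct {S : Type} (F : set_system S) {FF : Filter F}
    (g : S -> T -> C) (f : T -> C) (G : T -> R) :
  countably_generated F ->
  (forall s, cmeasurable (g s)) ->
  (forall s x, cmod (g s x) <= G x) -> mu.-integrable setT (EFin \o G) ->
  (forall x, ccvg F (g ^~ x) (f x)) ->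
  ccvg F (fun s => cint mu setT (g s)) (cint mu setT f).
Proof.
move=> cF mg gG iG gf; split => /=.
  apply: (dct_filter cF (fun s => (mg s).1) _ iG) => [s x|x]; last first.
    by have [] := gf x.
  by rewrite (le_trans _ (gG s x))// ler_Re_cmod.
apply: (dct_filter cF (fun s => (mg s).2) _ iG) => [s x|x]; last first.
  by have [] := gf x.
by rewrite (le_trans _ (gG s x))// ler_Im_cmod.
Qed.

End ComplexIntegral.

(** * Fubini's theorem under a product majorant *)

Section Fubini.
Context {R : realType} {d1 d2 : measure_display}.
Context {T1 : measurableType d1} {T2 : measurableType d2}.
Variables (m1 : {sigma_finite_measure set T1 -> \bar R})
          (m2 : {sigma_finite_measure set T2 -> \bar R}).
Variables (g : T1 -> R) (h : T2 -> R).
Hypotheses (g0 : forall x, 0 <= g x) (h0 : forall y, 0 <= h y).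
Hypotheses (ig : m1.-integrable setT (EFin \o g))
           (ih : m2.-integrable setT (EFin \o h)).
Local Notation C := R[i].

(** Majorants are taken in the form [g x * h y] so that every section, and not only almost every
    one, is integrable: the iterated integrals then need no exceptional sets. *)
Lemma integrable_prod :
  (m1 \x m2)%E.-integrable setT (EFin \o (fun z : T1 * T2 => g z.1 * h z.2)).
Proof.
have mg : measurable_fun setT g.
  by apply/measurable_EFinP; case/integrableP : ig.
have mh : measurable_fun setT h.
  by apply/measurable_EFinP; case/integrableP : ih.
apply/integrable12ltyP.
  apply/measurable_EFinP; apply: measurable_funM.
    exact: (measurableT_comp mg measurable_fst).
  exact: (measurableT_comp mh measurable_snd).
have hE x : (\int[m2]_y `|(g x * h y)%:E| = (g x)%:E * (\int[m2]_y h y)%:E)%E.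
  under eq_integral do rewrite gee0_abs ?lee_fin ?mulr_ge0// EFinM.
  rewrite integralZl// fineK//; exact: integrable_fin_num.
under eq_integral do rewrite /= hE.
rewrite integralZr// -(fineK (integrable_fin_num _ ig))// -EFinM ltry//.
Qed.
Section real.
Variable F : T1 * T2 -> R.
Hypothesis mF : measurable_fun setT F.
Hypothesis FB : forall x y, `|F (x, y)| <= g x * h y.

Lemma integrable_section1 x : m2.-integrable setT (EFin \o (fun y => F (x, y))).
Proof.
apply: (@integrable_le _ _ _ _ _ (fun y => g x * h y)) => //.
  exact: measurable_fun_pair2.
exact: (integrableZl measurableT (g x) ih).
Qed.

Lemma integrable_section2 y : m1.-integrable setT (EFin \o (fun x => F (x, y))).
Proof.
apply: (@integrable_le _ _ _ _ _ (fun x => h y * g x)) => //.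
- exact: measurable_fun_pair1.
- by move=> x; rewrite mulrC.
- exact: (integrableZl measurableT (h y) ig).
Qed.

Lemma integrable_prod_le : (m1 \x m2)%E.-integrable setT (EFin \o F).
Proof.
by apply: integrable_le integrable_prod => // -[x y]; exact: FB.
Qed.

Lemma Rfubini12 :
  \int[m1]_x (\int[m2]_y F (x, y)) = \int[(m1 \x m2)%E]_z F z.
Proof.
rewrite /Rintegral -(integral12_prod_meas1 integrable_prod_le); congr fine.
apply: eq_integral => x _; rewrite fineK//.
exact: (integrable_fin_num _ (integrable_section1 x)).
Qed.

Lemma Rfubini21 :
  \int[m2]_y (\int[m1]_x F (x, y)) = \int[(m1 \x m2)%E]_z F z.
Proof.
rewrite /Rintegral -(integral21_prod_meas1 integrable_prod_le); congr fine.
apply: eq_integral => x _; rewrite fineK//.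
exact: (integrable_fin_num _ (integrable_section2 x)).
Qed.

Lemma integrable_Rfubini1 :
  m1.-integrable setT (EFin \o (fun x => \int[m2]_y F (x, y))).
Proof.
have := integrable_fubini_F integrable_prod_le.
apply: eq_integrable => // x _ /=; rewrite fineK//.
exact: (integrable_fin_num _ (integrable_section1 x)).
Qed.

End real.

Section complex.
Variable F : T1 * T2 -> C.
Hypothesis mF : cmeasurable F.
Hypothesis FB : forall x y, cmod (F (x, y)) <= g x * h y.

Let FBre x y : `|re F (x, y)| <= g x * h y.
Proof. by rewrite (le_trans _ (FB x y))// ler_Re_cmod. Qed.

Let FBim x y : `|im F (x, y)| <= g x * h y.
Proof. by rewrite (le_trans _ (FB x y))// ler_Im_cmod. Qed.

Lemma cintegrable_section1 x : cintegrable m2 setT (fun y => F (x, y)).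
Proof. by case: mF => a b; split; [exact: integrable_section1 a FBre _|
  exact: integrable_section1 b FBim _]. Qed.

Lemma cintegrable_section2 y : cintegrable m1 setT (fun x => F (x, y)).
Proof. by case: mF => a b; split; [exact: integrable_section2 a FBre _|
  exact: integrable_section2 b FBim _]. Qed.

Lemma cfubini12 : cint m1 setT (fun x => cint m2 setT (fun y => F (x, y))) =
  cint (m1 \x m2)%E setT F.
Proof. by case: mF => a b; apply: complex_eq; [exact: Rfubini12 a FBre|
  exact: Rfubini12 b FBim]. Qed.

Lemma cfubini21 : cint m2 setT (fun y => cint m1 setT (fun x => F (x, y))) =
  cint (m1 \x m2)%E setT F.
Proof. by case: mF => a b; apply: complex_eq; [exact: Rfubini21 a FBre|
  exact: Rfubini21 b FBim]. Qed.

Lemma cfubini : cint m1 setT (fun x => cint m2 setT (fun y => F (x, y))) =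
  cint m2 setT (fun y => cint m1 setT (fun x => F (x, y))).
Proof. by rewrite cfubini12 cfubini21. Qed.

Lemma cintegrable_fubini1 :
  cintegrable m1 setT (fun x => cint m2 setT (fun y => F (x, y))).
Proof. by case: mF => a b; split; [exact: integrable_Rfubini1 a FBre|
  exact: integrable_Rfubini1 b FBim]. Qed.

End complex.
End Fubini.

Lemma cvg_pair_nbhs {T : Type} {U V : topologicalType} {F : set_system T}
    {FF : Filter F} (f : T -> U) (g : T -> V) (a : U) (b : V) :
  f x @[x --> F] --> a -> g x @[x --> F] --> b ->
  (f x, g x) @[x --> F] --> (a, b).
Proof. by move=> fa gb; exact: (@cvg_pair _ _ _ F (nbhs a) (nbhs b)). Qed.

(* The canonical sigma-finite structure of a product measure is not inferred, so
   it is assembled by hand. *)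
Definition prod_sigma_finite {R : realType} {d1 d2 : measure_display}
    {T1 : measurableType d1} {T2 : measurableType d2}
    (m1 : {sigma_finite_measure set T1 -> \bar R})
    (m2 : {sigma_finite_measure set T2 -> \bar R}) :
    {sigma_finite_measure set (T1 * T2)%type -> \bar R} :=
  let m : {measure set (T1 * T2)%type -> \bar R} := (m1 \x m2)%E in
  @SigmaFiniteMeasure.Pack _ _ _ m (SigmaFiniteMeasure.Class
    (Measure.measure_function_Content_isMeasure_mixin (Measure.class m))
    (measure_function_Measure_isSigmaFinite__to__measure_function_isSFinite
       m1 m2)
    (measure_function_Measure_isSigmaFinite__to__measure_function_isSigmaFinite
       m1 m2)).

(** * Lebesgue measure on the plane *)

Section Plane.
Context {R : realType}.
Local Notation C := R[i].
Local Notation mR := (measurableTypeR R).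

Definition sleb1 : {sigma_finite_measure set mR -> \bar R} := lebesgue_measure.

Definition sleb2 := prod_sigma_finite sleb1 sleb1.

Lemma cint_sleb2 (f : R * R -> C) : cint leb2 setT f = cint sleb2 setT f.
Proof. by []. Qed.

Let grid (n : nat) (x : R) : R := (Num.floor (n.+1%:R * x))%:~R / n.+1%:R.

Let grid_cvg (x : R) : grid n x @[n --> \oo] --> x.
Proof.
apply/cvgrPdist_le => e e0; near=> n.
have n0 : 0 < n.+1%:R :> R by [].
have gx : grid n x <= x by rewrite ler_pdivrMr// mulrC floor_le.
have xg : x <= grid n x + n.+1%:R^-1.
  rewrite /grid -[X in _ + X]mul1r -mulrDl ler_pdivlMr// mulrC ltW//.
  by rewrite -[1]/(1%:~R) -intrD floorD1_gt.
rewrite ger0_norm ?subr_ge0// (@le_trans _ _ n.+1%:R^-1) ?lerBlDl//.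
rewrite invf_ple ?posrE//.
have ei0 : 0 <= e^-1 by rewrite invr_ge0 ltW.
rewrite (le_trans (ltW (archi_boundP ei0)))// ler_nat ltnW// ltnS.
by near: n; exists (Num.bound e^-1).
Unshelve. all: by end_near. Qed.

(* Approximating the first coordinate by a grid makes [f] a countable gluing of
   sections, each of which is continuous in the second coordinate. *)
Lemma continuous_measurable_plane (f : R * R -> R) : continuous f ->
  measurable_fun setT (f : (mR * mR)%type -> _).
Proof.
move=> cf.
have cs (x : R) : continuous (fun y : R => f (x, y)).
  move=> y; apply: (@continuous_comp _ _ _ (fun y : R => (x, y)) f); last exact: cf.
  by apply: cvg_pair_nbhs; [exact: cvg_cst|exact: cvg_id].
pose fn n (z : (mR * mR)%type) := f (grid n z.1, z.2).
have mfn n : measurable_fun setT (fn n).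
  move=> _ Y mY; rewrite setTI.
  rewrite (_ : _ @^-1` _ = \bigcup_(k : int)
     ([set x : mR | Num.floor (n.+1%:R * x) = k] `*`
      (fun y : mR => f (k%:~R / n.+1%:R, y)) @^-1` Y)); last first.
    apply/seteqP; split => [[x y] /= h|[x y] [k _ [/= <- h]]//].
    by exists (Num.floor (n.+1%:R * x)).
  apply: countable_bigcupT_measurable; first exact: countableP.
  move=> k; apply: measurableX.
    rewrite (_ : [set x | _] = (fun x : mR => n.+1%:R * x) @^-1`
        [set` `[k%:~R, (k + 1)%:~R[]); last first.
      apply/seteqP; split => x /=; rewrite in_itv /=.
        by move=> <-; rewrite floor_le floorD1_gt.
      by move=> h; apply/eqP; rewrite floor_eq.
    rewrite -[X in measurable X]setTI; apply: mulrl_measurable => //.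
  rewrite -[X in measurable X]setTI.
  exact: (continuous_measurable_fun (cs _)).
apply: (measurable_fun_cvg mfn) => -[x y] _ /=.
apply: (@cvg_comp _ _ _ (fun n => (grid n x, y)) f _ (nbhs (x, y))); last exact: cf.
by apply: cvg_pair_nbhs; [exact: grid_cvg|exact: cvg_cst].
Qed.

Lemma ccontinuous_measurable_plane (f : R * R -> C) : ccontinuous f ->
  cmeasurable (f : (mR * mR)%type -> C).
Proof. by move=> [c1 c2]; split; exact: continuous_measurable_plane. Qed.

End Plane.

(** * Fundamental theorem of calculus and integrability through primitives *)

Section RealIntegrals.
Context {R : realType}.
Local Notation mR := (measurableTypeR R).
Local Notation leb := (@lebesgue_measure R).
Implicit Types (F f g : R -> R).

Lemma is_derive1_continuous F (x l : R) : is_derive x 1 F l ->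
  {for x, continuous F}.
Proof.
move=> dF; apply: differentiable_continuous; apply/derivable1_diffP.
exact: ex_derive.
Qed.

Lemma ftc_itv F f (a b : R) : a <= b ->
  (forall x : R, a <= x <= b -> is_derive x 1 F (f x)) ->
  (forall x, a <= x <= b -> {for x, continuous f}) ->
  (\int[leb]_(x in `[a, b]) (f x)%:E = (F b - F a)%:E)%E.
Proof.
rewrite le_eqVlt => /predU1P[<-|ab] dF cf.
  by rewrite set_itv1 integral_set1 subrr.
have cF x : a <= x <= b -> {for x, continuous F}.
  by move=> xab; exact: (is_derive1_continuous (dF x xab)).
rewrite (continuous_FTC2 ab (F := F)) ?EFinB//.
- apply: continuous_in_subspaceT => x /set_mem /=; rewrite in_itv /=; exact: cf.
- split.
  + move=> x; rewrite in_itv /= => /andP[ax xb].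
    by have := dF x; rewrite !ltW// => /(_ isT) h; exact: ex_derive.
  + by apply: cvg_at_right_filter; apply: cF; rewrite lexx ltW.
  + by apply: cvg_at_left_filter; apply: cF; rewrite lexx ltW.
- move=> x; rewrite in_itv /= => /andP[ax xb]; rewrite derive1E.
  by have := dF x; rewrite !ltW// => /(_ isT) h; rewrite derive_val.
Qed.

Lemma Rftc_itv F f (a b : R) : a <= b ->
  (forall x : R, is_derive x 1 F (f x)) -> continuous f ->
  \int[leb]_(x in `[a, b]) f x = F b - F a.
Proof.
move=> ab dF cf; rewrite /Rintegral (@ftc_itv F f)// => x _; exact: cf.
Qed.

Lemma Rintegral_itv_cvg f (l : nat -> R) (r : nat -> R) :
  leb.-integrable setT (EFin \o f) ->
  l n @[n --> \oo] --> -oo -> r n @[n --> \oo] --> +oo ->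
  \int[leb]_(x in `[l n, r n]) f x @[n --> \oo] --> \int[leb]_x f x.
Proof.
move=> fi lN rP.
under eq_fun do rewrite Rintegral_mkcond.
apply: (@dct_seq _ _ _ leb (fun n => f \_ `[l n, r n]) f (fun x => `|f x|)).
- move=> n; apply/(measurable_restrictT _ _).1 => //.
  apply: measurable_funTS; apply/measurable_EFinP.
  by case/integrableP : fi.
- by move=> n x; rewrite patchE; case: ifP; rewrite ?normr0.
- exact: (integrable_norm fi).
- move=> x; apply: (@cvg_near_cst _ _ _ _ _ _).
  near=> n; rewrite patchE mem_set//= in_itv /=; apply/andP; split.
    near: n; move/cvgrNyPle : lN; exact.
  near: n; move/cvgryPge : rP; exact.
Unshelve. all: by end_near. Qed.

Lemma cvgNn : (- (n%:R : R)) @[n --> \oo] --> -oo.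
Proof.
apply/cvgNry; rewrite (_ : - _ = (fun n => n%:R)); first exact: cvgr_idn.
by apply/funext => n; rewrite !fctE opprK.
Qed.

Lemma integral_derivative_eq0 F f : (forall x : R, is_derive x 1 F (f x)) ->
  continuous f -> leb.-integrable setT (EFin \o f) ->
  F n%:R @[n --> \oo] --> 0 -> F (- n%:R) @[n --> \oo] --> 0 ->
  \int[leb]_x f x = 0.
Proof.
move=> dF cf fi Fy FNy.
have h1 := Rintegral_itv_cvg fi cvgNn (@cvgr_idn R).
have h2 : \int[leb]_(x in `[- (n%:R : R), n%:R]) f x @[n --> \oo] --> (0 - 0 : R).
  rewrite (_ : (fun n => _) = (fun n => F n%:R - F (- n%:R))); last first.
    by apply/funext => n; rewrite (Rftc_itv (F := F))// (@le_trans _ _ 0) ?oppr_le0.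
  exact: cvgB.
rewrite subr0 in h2; exact: (cvg_unique _ h1 h2).
Qed.

(* [Phi] and its reflection are primitives of the even function [g \o normr] on
   the two half-lines; boundedness of [Phi] is all that is needed, whatever
   singularity [g] has at 0. *)
Lemma integrable_bounded_primitive g F (M : R) :
  measurable_fun setT (fun x : mR => g `|x|) ->
  (forall x, 0 <= x -> 0 <= g x) ->
  (forall x : R, 0 < x -> is_derive x 1 F (g x)) ->
  (forall x, 0 < x -> {for x, continuous g}) ->
  (forall x, 0 < x -> `|F x| <= M) ->
  leb.-integrable setT (EFin \o (fun x => g `|x|)).
Proof.
move=> mg g0 dF cg FM.
have g0n (x : R) : 0 <= g `|x| by exact: g0.
apply/integrableP; split; first exact/measurable_EFinP.
under eq_integral do rewrite /= ger0_norm//.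
(* The sets [E n] stay away from 0 and from infinity and exhaust the punctured line; the origin is
   restored at the end as a null set. *)
pose E n := `[(n.+1%:R : R)^-1, n.+1%:R]%classic `|`
            `[- (n.+1%:R : R), - n.+1%:R^-1]%classic.
have n1 n : (n.+1%:R : R)^-1 <= n.+1%:R.
  by rewrite (@le_trans _ _ 1)// ?invf_le1// ler1n.
have mE n : measurable (E n : set mR) by exact: measurableU.
(* Each of the two segments contributes a difference of two values of [F], hence at most [2 * M]. *)
have EB n : (\int[leb]_(x in E n) (g `|x|)%:E <= (4 * M)%:E)%E.
  rewrite ge0_integral_setU//=; last 3 first.
  - apply: measurable_funTS; exact/measurable_EFinP.
  - by move=> x _; rewrite lee_fin.
  - apply/disj_setPS => x [/=]; rewrite !in_itv /= => /andP[h1 _] /andP[_ h2].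
    have : 0 < x by rewrite (lt_le_trans _ h1)// invr_gt0.
    have : x < 0 by rewrite (le_lt_trans h2)// oppr_lt0 invr_gt0.
    by move=> /lt_trans h /h; rewrite ltxx.
  rewrite [X in (X + _)%E](_ : _ = (F n.+1%:R - F n.+1%:R^-1)%:E); last first.
    apply: ftc_itv => // x /andP[nx _];
      have x0 : 0 < x by rewrite (lt_le_trans _ nx)// invr_gt0.
      by rewrite ger0_norm ?ltW//; exact: dF.
    have gE : {near x, (fun x => g `|x|) =1 g}.
      near=> y; rewrite ger0_norm// ltW//; near: y; exact: lt_nbhsr.
    have := cg x x0; rewrite /prop_for /continuous_at ger0_norm ?ltW//.
    by apply: cvg_trans; apply: near_eq_cvg; apply: filterS gE => y.
  rewrite [X in (_ + X)%E](_ : _ =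
      (- F (- - n.+1%:R^-1) - - F (- - n.+1%:R))%:E); last first.
    apply: (@ftc_itv (fun x => - F (- x))); rewrite ?lerN2// => x /andP[_ nx];
      have x0 : x < 0 by rewrite (le_lt_trans nx)// oppr_lt0 invr_gt0.
      have Nx0 : 0 < - x by rewrite oppr_gt0.
      rewrite ler0_norm ?ltW//.
      have dN : is_derive x 1 (-%R : R -> R) (-1) by exact: is_deriveNid.
      have dFN := dF _ Nx0.
      have dc := is_derive1_comp dFN dN.
      have := is_deriveN dc; rewrite mulrN1 opprK; exact.
    have Nx0 : 0 < - x by rewrite oppr_gt0.
    have gE : {near x, (fun x => g `|x|) =1 g \o -%R}.
      near=> y; rewrite ler0_norm//= ltW//; near: y; exact: lt_nbhsl.
    have : {for x, continuous (g \o -%R)}.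
      apply: continuous_comp; [exact: opp_continuous|exact: cg].
    rewrite /prop_for /continuous_at /= [`|x|]ler0_norm ?ltW//.
    by apply: cvg_trans; apply: near_eq_cvg; apply: filterS gE => y.
  rewrite !opprK -EFinD lee_fin.
  have FM' x : 0 < x -> F x <= M /\ - F x <= M.
    by move=> /FM; rewrite ler_norml => /andP[]; rewrite lerNl.
  have [h1 h2] := FM' n.+1%:R (ltr0Sn _ _).
  have [|h3 h4] := FM' n.+1%:R^-1; first by rewrite invr_gt0.
  by lra.
have hE : {homo E : n m / (n <= m)%N >-> (n <= m)%O}.
  move=> m n mn; rewrite subsetEset => x [] /=; rewrite !in_itv /= => /andP[h1 h2].
    left; rewrite /= in_itv /= (le_trans _ h1)/= ?(le_trans h2)// ?ler_nat//.
    by rewrite lef_pV2 ?posrE// ler_nat.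
  right; rewrite /= in_itv /= (le_trans _ h1)/= ?(le_trans h2)// ?lerN2 ?ler_nat//.
  by rewrite lef_pV2 ?posrE// ler_nat.
have cvE := @ge0_nondecreasing_set_cvg_integral _ mR R E (fun x => (g `|x|)%:E)
  leb hE mE (fun n => measurable_funTS ((measurable_EFinP _ _).2 mg))
  (fun n x _ => (g0n x : (0 <= (g `|x|)%:E)%E)).
have UE : \bigcup_n E n = [set~ 0].
  apply/seteqP; split => x /=.
    have p n : 0 < (n.+1%:R : R)^-1 by rewrite invr_gt0.
    move=> [n _ [|]] /=; rewrite in_itv /= => /andP[h1 h2] x0.
      by have := lt_le_trans (p n) h1; rewrite x0 ltxx.
    by have := h2; rewrite x0 lerNr oppr0 leNgt p.
  move=> /eqP x0; have nx0 : 0 < `|x| by rewrite normr_gt0.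
  have [n [h1 h2]] : exists n : nat, n.+1%:R^-1 <= `|x| /\ `|x| <= n.+1%:R.
    exists (maxn (Num.bound `|x|) (Num.bound `|x|^-1)); split.
      rewrite invf_ple ?posrE//.
      have xi0 : 0 <= `|x|^-1 by rewrite invr_ge0.
      have := archi_boundP xi0; move=> /ltW/le_trans; apply.
      by rewrite ler_nat ltnW// ltnS leq_maxr.
    have := archi_boundP (normr_ge0 x); move=> /ltW/le_trans; apply.
    by rewrite ler_nat ltnW// ltnS leq_maxl.
  exists n => //; have [xp|xn] := ltP 0 x.
    by left; rewrite /= in_itv /= -(gtr0_norm xp) h1.
  right; rewrite /= in_itv /= -[x]opprK -(ler0_norm xn) !lerN2.
  by rewrite h1 h2.
rewrite -(@integral_setD1 _ _ 0) ?setTD -?UE; first last.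
- by apply: measurable_funTS; exact/measurable_EFinP.
- by apply: bigcup_measurable => n _; exact: mE.
apply: (@le_lt_trans _ _ (4 * M)%:E); last exact: ltry.
by apply: (cvge_le _ cvE); exact: nearW.
Unshelve. all: by end_near. Qed.

End RealIntegrals.

(** * Differentiation rules for real functions *)

Section PointwiseDerivatives.
Context {R : realType}.
Implicit Types (f g : R -> R) (x a b : R).

(** The rules are stated for explicit lambda-terms and with products instead of scalings, so that
    derivatives are assembled by composing terms and their values are compared by [ring] or
    [field]. *)
Lemma is_dM f g x a b : is_derive x 1 f a -> is_derive x 1 g b ->
  is_derive x 1 (fun y => f y * g y) (a * g x + f x * b).
Proof.
move=> df dg; apply: is_derive_eq (is_deriveM df dg) _.
by rewrite /GRing.scale /= addrC (mulrC (g x)).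
Qed.

Lemma is_dD f g x a b : is_derive x 1 f a -> is_derive x 1 g b ->
  is_derive x 1 (fun y => f y + g y) (a + b).
Proof. by move=> df dg; exact: is_deriveD df dg. Qed.

Lemma is_dN f x a : is_derive x 1 f a -> is_derive x 1 (fun y => - f y) (- a).
Proof. by move=> df; exact: is_deriveN df. Qed.

Lemma is_dcst x a : is_derive x 1 (fun=> a) 0.
Proof. exact: is_derive_cst. Qed.

Lemma is_did x : is_derive x 1 (fun y : R => y) 1.
Proof. exact: is_derive_id. Qed.

Lemma is_dcomp f g x a b : is_derive (g x) 1 f a -> is_derive x 1 g b ->
  is_derive x 1 (fun y => f (g y)) (a * b).
Proof. exact: is_derive1_comp. Qed.

Lemma is_dZ (k : R) f x a : is_derive x 1 f a ->
  is_derive x 1 (fun y => k * f y) (k * a).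
Proof.
by move=> df; apply: is_derive_eq (is_dM (is_dcst x k) df) _; rewrite mul0r add0r.
Qed.

Lemma is_dV f x a : f x != 0 -> is_derive x 1 f a ->
  is_derive x 1 (fun y => (f y)^-1) (- a / f x ^+ 2).
Proof.
move=> fx df; apply: is_derive_eq (is_deriveV fx df) _.
by rewrite /GRing.scale /= !mulNr mulrC.
Qed.

Lemma is_dlin (k : R) x : is_derive x 1 (fun y => k * y) k.
Proof. by apply: is_derive_eq (is_dZ k (is_did x)) _; rewrite mulr1. Qed.

End PointwiseDerivatives.

(** * Poisson kernel and Fourier inversion *)

Section PoissonKernel.
Context {R : realType}.
Local Notation C := R[i].
Local Notation mR := (measurableTypeR R).
Local Notation leb := (@lebesgue_measure R).
Implicit Types (F f g : R -> R).

(** Meant for functions involving [|x|], which have a different formula on each half-line. The two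
    primitives may disagree at 0; each vanishes at its own infinity. *)
Lemma integral_two_primitives f (Fm fm Fp fp : R -> R) :
  leb.-integrable setT (EFin \o f) ->
  (forall x : R, is_derive x 1 Fm (fm x)) -> continuous fm ->
  (forall x : R, is_derive x 1 Fp (fp x)) -> continuous fp ->
  (forall x, x <= 0 -> f x = fm x) -> (forall x, 0 <= x -> f x = fp x) ->
  Fm (- n%:R) @[n --> \oo] --> 0 -> Fp n%:R @[n --> \oo] --> 0 ->
  \int[leb]_x f x = Fm 0 - Fp 0.
Proof.
move=> fi dm cm dp cp fmE fpE FmN Fpy.
have h1 := Rintegral_itv_cvg fi cvgNn (@cvgr_idn R).
suff h2 : \int[leb]_(x in `[- (n%:R : R), n%:R]) f x @[n --> \oo] -->
    ((Fm 0 - 0) + (0 - Fp 0) : R).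
  by rewrite -[RHS]/(Fm 0 + - Fp 0) -[Fm 0]subr0 -[- Fp 0]sub0r; exact: cvg_unique h1 h2.
rewrite (_ : (fun n => _) =
    (fun n => (Fm 0 - Fm (- n%:R)) + (Fp n%:R - Fp 0))); last first.
  apply/funext => n.
  have fin : leb.-integrable `[- (n%:R : R), n%:R] (EFin \o f).
    exact: (integrableS measurableT).
  have n0 : - (n%:R : R) <= 0 by rewrite oppr_le0.
  have e1 : \int[leb]_(x in `[- (n%:R : R), 0]) f x = Fm 0 - Fm (- n%:R).
    rewrite -(@Rftc_itv _ _ _ _ _ n0 dm cm); apply: eq_Rintegral => x.
    by rewrite inE /= in_itv /= => /andP[_ /fmE].
  have e2 : \int[leb]_(x in `[0, n%:R]) f x = Fp n%:R - Fp 0.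
    rewrite -(@Rftc_itv _ _ _ _ _ (ler0n _ n) dp cp); apply: eq_Rintegral => x.
    by rewrite inE /= in_itv /= => /andP[/fpE].
  apply/eqP; rewrite addrC -subr_eq -e1 -e2; apply/eqP.
  rewrite Rintegral_itvB// ?Rintegral_itv_obnd_cbnd//.
  apply: integrableS fin => //; apply: subset_itvr; rewrite bnd_simp.
    exact: n0.
  by rewrite bnd_simp.
by apply: cvgD; apply: cvgB => //; exact: cvg_cst.
Qed.

Lemma cvg_le0 (u w : nat -> R) (K : R) : (forall n, `|u n| <= K * w n) ->
  w n @[n --> \oo] --> 0 -> u n @[n --> \oo] --> 0.
Proof.
move=> uw w0; apply: norm_cvg0.
apply: (@squeeze_cvgr _ _ _ _ (fun=> 0) (fun n => K * w n)).
- by near=> n; rewrite normr_ge0 uw.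
- exact: cvg_cst.
- by rewrite -[X in _ --> X](mulr0 K); apply: cvgMr.
Unshelve. all: by end_near. Qed.

Lemma cvg_expR_Nn (e : R) : 0 < e -> expR (- (e * n%:R)) @[n --> \oo] --> 0.
Proof.
move=> e0; have h : e * n%:R @[n --> \oo] --> +oo.
  apply/cvgryPge => A; near=> n; rewrite -ler_pdivrMl//; near: n.
  exact: nbhs_infty_ger.
exact: (cvg_comp _ _ h (@cvgr_expR R)).
Unshelve. all: by end_near. Qed.

Lemma expR_continuous_lin (k : R) : continuous (fun x : R => expR (k * x)).
Proof.
move=> x.
exact: is_derive1_continuous (is_dcomp (is_derive_expR _) (is_dlin k x)).
Qed.

Lemma integrable_expR_norm (e : R) : 0 < e ->
  leb.-integrable setT (EFin \o (fun x => expR (- (e * `|x|)))).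
Proof.
move=> e0.
apply: (@integrable_bounded_primitive _ (fun x => expR (- (e * x)))
  (fun x => - e^-1 * expR ((- e) * x)) e^-1).
- apply: measurableT_comp => //; apply: measurableT_comp => //.
  apply: measurable_funM => //; exact: measurableT_comp.
- by move=> x _; exact: expR_ge0.
- move=> x _; have := is_dZ (- e^-1) (is_dcomp (is_derive_expR _) (is_dlin (- e) x)).
  move=> h; apply: is_derive_eq h _; rewrite mulrC -mulrA mulrNN mulfV ?gt_eqF//.
  by rewrite mulr1 mulNr.
- move=> x _.
  rewrite (_ : (fun y => _) = (fun y : R => expR (- e * y))); last first.
    by apply/funext => y; rewrite mulNr.
  exact: expR_continuous_lin.
- move=> x x0; rewrite normrM normrN !gtr0_norm ?expR_gt0 ?invr_gt0//.
  rewrite ger_pMr ?invr_gt0// -[1](@expR0 R) ler_expR mulNr oppr_le0.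
  by rewrite mulr_ge0// ltW.
Qed.

Section exp_fourier.
Variables (e a : R).
Hypothesis e0 : 0 < e.
Let D := e ^+ 2 + a ^+ 2.
Let D0 : D != 0.
Proof. by rewrite gt_eqF// ltr_pwDl ?exprn_gt0 ?sqr_ge0. Qed.

(** For fixed [s], these combinations of e^(s e x) cos (a x) and e^(s e x) sin (a x) are closed
    under differentiation; s = 1 is used on the left half-line and s = -1 on the right one. *)
Let E (s : R) (k1 k2 : R) := fun x : R =>
  expR (s * e * x) * (k1 * cos (a * x) + k2 * sin (a * x)).

Let dE s k1 k2 (x : R) :
  is_derive x 1 (E s k1 k2) (E s (s * e * k1 + a * k2) (s * e * k2 - a * k1) x).
Proof.
have d1 := is_dcomp (is_derive_expR _) (is_dlin (s * e) x).
have dc := is_dZ k1 (is_dcomp (is_derive_cos _) (is_dlin a x)).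
have ds := is_dZ k2 (is_dcomp (is_derive_sin _) (is_dlin a x)).
apply: is_derive_eq (is_dM d1 (is_dD dc ds)) _; rewrite /E; ring.
Qed.

Let cE s k1 k2 : continuous (E s k1 k2).
Proof. by move=> x; exact: is_derive1_continuous (dE s k1 k2 x). Qed.

Let EB s k1 k2 x : `|E s k1 k2 x| <= (`|k1| + `|k2|) * expR (s * e * x).
Proof.
rewrite normrM gtr0_norm ?expR_gt0// mulrC ler_wpM2r ?expR_ge0//.
rewrite (le_trans (ler_normD _ _))// lerD// normrM ler_piMr//.
  by rewrite ler_norml cos_geN1 cos_le1.
by rewrite ler_norml sin_geN1 sin_le1.
Qed.

Let half (k1 k2 : R) :
  \int[leb]_x (expR (- (e * `|x|)) * (k1 * cos (a * x) + k2 * sin (a * x))) =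
  2 * k1 * e / D.
Proof.
(* Coefficients of a primitive, obtained by solving s e p1 + a p2 = k1 and s e p2 - a p1 = k2; the
   determinant is [D] because s^2 = 1. *)
pose p1 s := (s * e * k1 - a * k2) / D; pose p2 s := (s * e * k2 + a * k1) / D.
have dp s : s ^+ 2 = 1 -> s * e * p1 s + a * p2 s = k1 /\
    s * e * p2 s - a * p1 s = k2.
  move=> s2; split; rewrite /p1 /p2; apply: (mulIf D0).
    rewrite mulrDl !mulrA !divfK//.
    by rewrite /D; ring: s2.
  rewrite mulrBl !mulrA !divfK//.
  by rewrite /D; ring: s2.
have [m1 m2] := dp 1 (expr1n _ _).
have [|m3 m4] := dp (-1); first by rewrite sqrrN expr1n.
have dm (x : R) : is_derive x 1 (E 1 (p1 1) (p2 1)) (E 1 k1 k2 x).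
  by have := dE 1 (p1 1) (p2 1) x; rewrite m1 m2.
have dpp (x : R) : is_derive x 1 (E (-1) (p1 (-1)) (p2 (-1))) (E (-1) k1 k2 x).
  by have := dE (-1) (p1 (-1)) (p2 (-1)) x; rewrite m3 m4.
apply: etrans (integral_two_primitives _ dm (@cE _ _ _) dpp (@cE _ _ _) _ _ _ _) _.
- apply: (@integrable_le _ _ mR leb _
    (fun x : R => (`|k1| + `|k2|) * expR (- (e * `|x|)))).
  + apply: measurable_funM.
      apply: measurableT_comp => //; apply: measurableT_comp => //.
      by apply: measurable_funM => //; exact: measurableT_comp.
    apply: continuous_measurable_fun => x.
    apply: cvgD; apply: cvgMr.
      by apply: continuous_comp; [exact: mulrl_continuous|exact: continuous_cos].
    by apply: continuous_comp; [exact: mulrl_continuous|exact: continuous_sin].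
  + move=> x; rewrite normrM gtr0_norm ?expR_gt0// mulrC ler_wpM2r ?expR_ge0//.
    rewrite (le_trans (ler_normD _ _))// lerD// normrM ler_piMr//.
      by rewrite ler_norml cos_geN1 cos_le1.
    by rewrite ler_norml sin_geN1 sin_le1.
  + exact: (integrableZl measurableT _ (integrable_expR_norm e0)).
- by move=> x x0; rewrite /E mul1r ler0_norm// mulrN opprK.
- by move=> x x0; rewrite /E mulN1r ger0_norm// mulNr.
- apply: (@cvg_le0 _ (fun n => expR (- (e * n%:R))) (`|p1 1| + `|p2 1|)).
    by move=> n; rewrite (le_trans (EB _ _ _ _))// mul1r mulrN.
  exact: cvg_expR_Nn.
- apply: (@cvg_le0 _ (fun n => expR (- (e * n%:R))) (`|p1 (-1)| + `|p2 (-1)|)).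
    by move=> n; rewrite (le_trans (EB _ _ _ _))// mulN1r mulNr.
  exact: cvg_expR_Nn.
- by rewrite /E !mulr0 expR0 cos0 sin0 /p1; field.
Qed.

Lemma cint_exp_fourier :
  cint leb setT (fun x : mR => expi (a * x) * (expR (- (e * `|x|)))%:C) =
  (2 * e / D)%:C.
Proof.
apply: complex_eq => /=.
  transitivity (2 * 1 * e / D); last by rewrite mulr1.
  rewrite -(half 1 0); apply: eq_Rintegral => x _.
  by rewrite /re ReM /= mul1r mul0r mulr0 addr0 subr0 mulrC.
transitivity (2 * 0 * e / D); last by rewrite mulr0 !mul0r.
rewrite -(half 0 1); apply: eq_Rintegral => x _.
by rewrite /im ImM /= mul1r mul0r mulr0 !add0r mulrC.
Qed.

End exp_fourier.
(** This is 2 pi times the normalized Poisson kernel of the half-plane, so its mass is 2 pi. The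
    case e = 1, that is 2 / (1 + a^2), is the standard majorant of the file. *)
Definition poisson (e a : R) : R := 2 * e / (e ^+ 2 + a ^+ 2).

Lemma poisson_ge0 (e a : R) : 0 <= e -> 0 <= poisson e a.
Proof. by move=> e0; rewrite divr_ge0 ?mulr_ge0 ?addr_ge0 ?sqr_ge0. Qed.

Lemma poissonN (e a : R) : poisson e (- a) = poisson e a.
Proof. by rewrite /poisson sqrrN. Qed.

Lemma poisson_scale (e u : R) : 0 < e -> poisson e (e * u) * e = poisson 1 u.
Proof.
move=> e0; have D1 : 1 + u ^+ 2 != 0 by rewrite gt_eqF// ltr_pwDl ?sqr_ge0.
rewrite /poisson expr1n.
have -> : e ^+ 2 + (e * u) ^+ 2 = e ^+ 2 * (1 + u ^+ 2) by ring.
by field; rewrite D1 gt_eqF.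
Qed.

Lemma continuous_poisson (e : R) : 0 < e -> continuous (poisson e).
Proof.
move=> e0 x; have D0 : e ^+ 2 + x * x != 0.
  by rewrite gt_eqF// ltr_pwDl ?exprn_gt0 ?sqr_ge0.
have d2 := is_dD (is_dcst x (e ^+ 2)) (is_dM (is_did x) (is_did x)).
have h := is_derive1_continuous (is_dZ (2 * e) (@is_dV _ (fun y => e ^+ 2 + y * y) x _ D0 d2)).
exact: h.
Qed.

Lemma is_derive_atan_poisson (e x : R) : 0 < e ->
  is_derive x 1 (fun y => 2 * atan (e^-1 * y)) (poisson e x).
Proof.
move=> e0.
apply: is_derive_eq (is_dZ 2 (is_dcomp (is_derive1_atan _) (is_dlin e^-1 x))) _.
have D1 : e ^+ 2 + x ^+ 2 != 0 by rewrite gt_eqF// ltr_pwDl ?exprn_gt0 ?sqr_ge0.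
have -> : 1 + (e^-1 * x) ^+ 2 = (e ^+ 2 + x ^+ 2) / e ^+ 2.
  by field; rewrite gt_eqF.
by rewrite /poisson; field; rewrite D1 gt_eqF.
Qed.

Lemma integrable_poisson (e : R) : 0 < e ->
  leb.-integrable setT (EFin \o poisson e).
Proof.
move=> e0; rewrite (_ : poisson e = (fun x => poisson e `|x|)); last first.
  by apply/funext => x; rewrite /poisson real_normK// num_real.
apply: (@integrable_bounded_primitive _ _ (fun y => 2 * atan (e^-1 * y)) pi).
- rewrite (_ : (fun x => _) = poisson e).
    exact: continuous_measurable_fun (continuous_poisson e0).
  by apply/funext => x; rewrite /poisson real_normK// num_real.
- by move=> x _; rewrite poisson_ge0// ltW.
- by move=> x _; exact: is_derive_atan_poisson.
- by move=> x _; exact: continuous_poisson.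
- move=> x _; have h1 := atan_ltpi2 (e^-1 * x); have h2 := atan_gtNpi2 (e^-1 * x).
  by rewrite ler_norml; lra.
Qed.

Lemma integral_poisson1 : \int[leb]_x poisson 1 x = 2 * pi.
Proof.
have h1 := Rintegral_itv_cvg (integrable_poisson ltr01) cvgNn (@cvgr_idn R).
suff h2 : \int[leb]_(x in `[- (n%:R : R), n%:R]) poisson 1 x @[n --> \oo] -->
   (4 * (pi / 2) : R).
  have -> : 2 * pi = 4 * (pi / 2) :> R by field.
  exact: cvg_unique h1 h2.
rewrite (_ : (fun n => _) = (fun n => 4 * atan n%:R)).
  by apply: cvgMr; exact: (cvg_comp _ _ (@cvgr_idn R) (@cvgy_atan R)).
apply/funext => n.
have n0 : - (n%:R : R) <= n%:R by rewrite (@le_trans _ _ 0)// oppr_le0.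
rewrite (Rftc_itv n0 (fun x => is_derive_atan_poisson x ltr01)
  (continuous_poisson ltr01)).
by rewrite invr1 !mul1r atanN; ring.
Qed.

End PoissonKernel.

(** * Poisson kernels as an approximate identity *)

Section PoissonLimit.
Context {R : realType}.
Local Notation mR := (measurableTypeR R).
Local Notation leb := (@lebesgue_measure R).
Implicit Types (F f g : R -> R).

Lemma continuous_poisson_shift (e z : R) : 0 < e ->
  continuous (fun w : R => poisson e (w - z)).
Proof.
move=> e0 w; apply: (@continuous_comp _ _ _ (fun w : R => w - z) (poisson e)).
  by apply: cvgB; [exact: cvg_id|exact: cvg_cst].
exact: continuous_poisson.
Qed.

Let cl (z e : R) : continuous (fun u : R => z + e * u).
Proof. by move=> u; apply: cvgD; [exact: cvg_cst|exact: mulrl_continuous]. Qed.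

Let cc (c : R) : continuous (fun _ : R => c).
Proof. by move=> x; exact: cvg_cst. Qed.

Lemma integral_poisson_subst (e z : R) (h : R -> R) : 0 < e ->
  continuous h -> (forall w, 0 <= h w) ->
  (\int[leb]_w (h w * poisson e (w - z))%:E =
   \int[leb]_u (h (z + e * u)%R * poisson 1 u)%:E)%E.
Proof.
move=> e0 ch h0.
have dl (u : R) : is_derive u 1 (fun u : R => z + e * u) e.
  by apply: is_derive_eq (is_dD (is_dcst u z) (is_dlin e u)) _; rewrite add0r.
have dlE : (fun u : R => z + e * u)^`()%classic = fun=> e.
  by apply/funext => u; rewrite derive1E; exact: derive_val.
rewrite (@increasing_ge0_integration_by_substitutionT _ (fun u : R => z + e * u)).
- apply: eq_integral => u _; congr EFin.
  rewrite /= dlE !fctE /=  addrAC subrr add0r.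
  by rewrite -mulrA poisson_scale.
- by move=> x y xy; rewrite ltrD2l ltr_pM2l.
- by rewrite dlE; move=> x; exact: cvg_cst.
- by rewrite dlE; exact: is_cvg_cst.
- by rewrite dlE; exact: is_cvg_cst.
- by move=> x; exact: ex_derive.
- apply/cvgrNyPle => A; exists (e^-1 * (A - z)); split; first exact: num_real.
  by move=> u /ltW ul; rewrite -lerBrDl -ler_pdivlMl.
- apply/cvgryPge => A; exists (e^-1 * (A - z)); split; first exact: num_real.
  by move=> u /ltW ul; rewrite -lerBlDl -ler_pdivrMl.
- by move=> w; apply: cvgM; [exact: ch|exact: continuous_poisson_shift].
- by move=> w; rewrite mulr_ge0// poisson_ge0// ltW.
Qed.

Lemma integrable_poisson_shift (e z : R) : 0 < e ->
  leb.-integrable setT (EFin \o (fun w => poisson e (w - z))).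
Proof.
move=> e0; have intP1 := integrable_poisson (ltr01 : 0 < 1 :> R).
apply/integrableP; split.
  apply/measurable_EFinP; apply: continuous_measurable_fun.
  exact: continuous_poisson_shift.
rewrite [X in (X < _)%E](_ : _ = \int[leb]_u (1 * poisson 1 u)%:E)%E.
  have /integrableP[_] := intP1; congr (_ < _)%E; apply: eq_integral => u _.
  by rewrite /= mul1r ger0_norm// poisson_ge0.
rewrite -(@integral_poisson_subst e z _ e0 (@cc 1) (fun=> ler01)).
apply: eq_integral => w _.
by rewrite /= mul1r ger0_norm// poisson_ge0// ltW.
Qed.

(** The substitution w = z + e u is applied to the nonnegative functions [g + M] and [M], and the
    result follows by subtraction; this is where the bound on [g] enters. *)
Lemma Rintegral_poisson_subst (e z M : R) g : 0 < e -> continuous g ->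
  (forall w, `|g w| <= M) ->
  \int[leb]_w (g w * poisson e (w - z)) =
  \int[leb]_u (g (z + e * u) * poisson 1 u).
Proof.
move=> e0 cg gM.
have cP := @continuous_poisson_shift e z e0.
have key1 := @integral_poisson_subst e z _ e0 (@cc M)
   (fun w => le_trans (normr_ge0 _) (gM w)).
have cgM : continuous (fun w => g w + M).
  by move=> w; apply: cvgD; [exact: cg|exact: cvg_cst].
have gM0 w : 0 <= g w + M.
  by have := gM w; rewrite ler_norml => /andP[+ _]; rewrite -subr_ge0 opprK.
have key2 := @integral_poisson_subst e z _ e0 cgM gM0.
have intP1 := integrable_poisson (ltr01 : 0 < 1 :> R).
have mP1 : measurable_fun setT (poisson 1 : mR -> R).
  exact: continuous_measurable_fun (continuous_poisson ltr01).
have intM : leb.-integrable setT (EFin \o (fun u => M * poisson 1 u)).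
  exact: (integrableZl measurableT M intP1).
have intg : leb.-integrable setT (EFin \o (fun u => g (z + e * u) * poisson 1 u)).
  apply: (@integrable_le _ _ mR leb _ (fun u => M * poisson 1 u)) => //.
    apply: measurable_funM => //; apply: continuous_measurable_fun => u.
    apply: (@continuous_comp _ _ _ (fun u : R => z + e * u) g).
      exact: cl.
    exact: cg.
  by move=> u; rewrite normrM (ger0_norm (poisson_ge0 _ _))// ler_wpM2r// poisson_ge0.
have mPe : measurable_fun setT (fun w : mR => poisson e (w - z)).
  exact: continuous_measurable_fun cP.
have intPe := @integrable_poisson_shift e z e0.
have intMe : leb.-integrable setT (EFin \o (fun w => M * poisson e (w - z))).
  exact: (integrableZl measurableT M intPe).
have intge : leb.-integrable setT (EFin \o (fun w => g w * poisson e (w - z))).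
  apply: (@integrable_le _ _ mR leb _ (fun w => M * poisson e (w - z))) => //.
    by apply: measurable_funM => //; apply: continuous_measurable_fun => u.
  move=> u; rewrite normrM (ger0_norm (poisson_ge0 _ (ltW e0))) ler_wpM2r//.
  by rewrite poisson_ge0// ltW.
apply: (addIr (\int[leb]_u (M * poisson 1 u))).
have k1 : \int[leb]_w (M * poisson e (w - z)) = \int[leb]_u (M * poisson 1 u).
  by rewrite /Rintegral key1.
rewrite -[in LHS]k1 -RintegralD// -RintegralD//.
transitivity (\int[leb]_w ((g w + M) * poisson e (w - z))).
  by apply: eq_Rintegral => w _; rewrite mulrDl.
rewrite /Rintegral key2; congr fine.
by apply: eq_integral => u _; rewrite mulrDl.
Qed.

Lemma continuous_slice1 {U : topologicalType} (f : R * R -> U) (y : R) :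
  continuous f -> continuous (fun x => f (x, y)).
Proof.
move=> cf x; apply: (@continuous_comp _ _ _ (fun x : R => (x, y)) f); last exact: cf.
by apply: cvg_pair_nbhs; [exact: cvg_id|exact: cvg_cst].
Qed.

Lemma continuous_slice2 {U : topologicalType} (f : R * R -> U) (x : R) :
  continuous f -> continuous (fun y => f (x, y)).
Proof.
move=> cf y; apply: (@continuous_comp _ _ _ (fun y : R => (x, y)) f); last exact: cf.
by apply: cvg_pair_nbhs; [exact: cvg_cst|exact: cvg_id].
Qed.

Lemma fst_continuous : continuous (fst : R * R -> R).
Proof. by move=> [x y]; exact: cvg_fst. Qed.

Lemma snd_continuous : continuous (snd : R * R -> R).
Proof. by move=> [x y]; exact: cvg_snd. Qed.

Lemma continuous_pair {T : topologicalType} (f g : T -> R) :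
  continuous f -> continuous g -> continuous (fun x => (f x, g x)).
Proof. by move=> cf cg x; apply: cvg_pair_nbhs; [exact: cf|exact: cg]. Qed.

Let Q := poisson (1 : R).

Let iQ : sleb1.-integrable setT (EFin \o Q).
Proof. exact: integrable_poisson. Qed.

Let Q0 (x : R) : 0 <= Q x.
Proof. exact: poisson_ge0. Qed.

Let mQ : measurable_fun setT (Q : mR -> R).
Proof. exact: continuous_measurable_fun (continuous_poisson ltr01). Qed.

Lemma integrable_poisson1_prod :
  sleb2.-integrable setT (EFin \o (fun w : R * R => Q w.1 * Q w.2)).
Proof. exact: (@integrable_prod _ _ _ _ _ sleb1 sleb1 _ _ Q0 Q0 iQ iQ). Qed.

Lemma integral_poisson1_prod :
  \int[sleb2]_w (Q w.1 * Q w.2) = (2 * pi) ^+ 2.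
Proof.
rewrite -(@Rfubini12 _ _ _ _ _ sleb1 sleb1 Q Q Q0 Q0 iQ iQ (fun w => Q w.1 * Q w.2)).
- transitivity (\int[sleb1]_x (Q x * \int[sleb1]_y Q y)).
    by apply: eq_Rintegral => x _; exact: (RintegralZl (Q x) measurableT iQ).
  by rewrite (RintegralZr _ measurableT iQ) integral_poisson1 expr2.
- by apply: measurable_funM; [exact: (measurableT_comp mQ measurable_fst)|
    exact: (measurableT_comp mQ measurable_snd)].
- by move=> x y; rewrite ger0_norm//; exact: mulr_ge0 (Q0 _) (Q0 _).
Qed.

Section subst.
Variables (chi : R * R -> R) (M : R).
Hypothesis cchi : continuous chi.
Hypothesis chiM : forall w, `|chi w| <= M.

Let M0 : 0 <= M.
Proof. exact: le_trans (normr_ge0 _) (chiM 0). Qed.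

Let cchi_affine (a b c d : R) :
  continuous (fun w : R * R => chi (a + c * w.1, b + d * w.2)).
Proof.
move=> w; apply: (@continuous_comp _ _ _
    (fun w => (a + c * w.1, b + d * w.2)) chi); last exact: cchi.
apply: continuous_pair => {}w.
  apply: (@continuous_comp _ _ _ fst (fun u : R => a + c * u)).
    exact: fst_continuous.
  exact: cl.
apply: (@continuous_comp _ _ _ snd (fun u : R => b + d * u)).
  exact: snd_continuous.
exact: cl.
Qed.

(** The substitution is made one variable at a time, in the second variable first; Fubini then
    brings the first variable inside for the second substitution. *)
Lemma Rintegral_poisson_subst2 (e : R) (z : R * R) : 0 < e ->
  \int[sleb2]_w (chi w * (poisson e (w.1 - z.1) * poisson e (w.2 - z.2))) =
  \int[sleb2]_u (chi (z.1 + e * u.1, z.2 + e * u.2) * (Q u.1 * Q u.2)).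
Proof.
move=> e0.
pose P (y w : R) := poisson e (w - y).
have P0 y w : 0 <= P y w by rewrite poisson_ge0// ltW.
have cP y : continuous (P y) by exact: continuous_poisson_shift.
have mP y : measurable_fun setT (P y : mR -> R).
  exact: continuous_measurable_fun.
have iP y : sleb1.-integrable setT (EFin \o P y).
  exact: integrable_poisson_shift.
have mchi := continuous_measurable_plane cchi.
have m1 := measurable_fst : measurable_fun [set: mR * mR] _.
have m2 := measurable_snd : measurable_fun [set: mR * mR] _.
have MQ0 x : 0 <= M * Q x by exact: mulr_ge0 M0 (Q0 x).
have MP0 y w : 0 <= M * P y w by exact: mulr_ge0 M0 (P0 y w).
have iMQ : sleb1.-integrable setT (EFin \o (fun x => M * Q x)).
  exact: (integrableZl measurableT M iQ).
have iMP y : sleb1.-integrable setT (EFin \o (fun x => M * P y x)).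
  exact: (integrableZl measurableT M (iP y)).
have bound (f a b : R) : 0 <= a -> 0 <= b -> `|f| <= M ->
    `|f * (a * b)| <= M * a * b.
  move=> a0 b0 fM; rewrite normrM (ger0_norm (mulr_ge0 _ _))// -mulrA.
  by rewrite ler_wpM2r// mulr_ge0.
rewrite -(@Rfubini12 _ _ _ _ _ sleb1 sleb1 _ _ (MP0 z.1) (P0 z.2) (iMP z.1)
  (iP z.2) (fun w => chi w * (P z.1 w.1 * P z.2 w.2))); last 2 first.
- apply: measurable_funM => //; apply: measurable_funM.
    exact: (measurableT_comp (mP _) m1).
  exact: (measurableT_comp (mP _) m2).
- by move=> x y; exact: bound.
transitivity (\int[sleb1]_x \int[sleb1]_v
    (chi (x, z.2 + e * v) * (P z.1 x * Q v))).
  apply: eq_Rintegral => x _.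
  have h := @Rintegral_poisson_subst e z.2 (P z.1 x * M)
    (fun v => P z.1 x * chi (x, v)) e0.
  transitivity (\int[leb]_w (P z.1 x * chi (x, w) * P z.2 w)).
    by apply: eq_Rintegral => w _ /=; ring.
  rewrite {}h.
  - by apply: eq_Rintegral => w _ /=; rewrite /Q; ring.
  - by move=> w; apply: cvgMr; exact: continuous_slice2.
  - by move=> w; rewrite normrM ger0_norm// ler_wpM2l.
have caff (f g : R * R -> R) : continuous f -> continuous g ->
    measurable_fun setT ((fun w => chi (f w, g w)) : (mR * mR)%type -> R).
  move=> cf cg; apply: continuous_measurable_plane => w.
  apply: (@continuous_comp _ _ _ (fun w => (f w, g w)) chi).
    exact: continuous_pair.
  exact: cchi.
pose F1 (w : R * R) := chi (w.1, z.2 + e * w.2) * (P z.1 w.1 * Q w.2).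
have mF1 : measurable_fun [set: mR * mR] F1.
  apply: measurable_funM; last first.
    apply: measurable_funM; first exact: (measurableT_comp (mP _) m1).
    exact: (measurableT_comp mQ m2).
  apply: caff; first exact: fst_continuous.
  move=> w; apply: (@continuous_comp _ _ _ snd (fun u : R => z.2 + e * u)).
    exact: snd_continuous.
  exact: cl.
have F1B x y : `|F1 (x, y)| <= M * P z.1 x * Q y.
  exact: bound (P0 _ _) (Q0 _) (chiM _).
rewrite (@Rfubini12 _ _ _ _ _ sleb1 sleb1 _ _ (MP0 z.1) Q0 (iMP z.1) iQ F1 mF1 F1B).
rewrite -(@Rfubini21 _ _ _ _ _ sleb1 sleb1 _ _ (MP0 z.1) Q0 (iMP z.1) iQ F1 mF1 F1B).
pose F2 (w : R * R) := chi (z.1 + e * w.1, z.2 + e * w.2) * (Q w.1 * Q w.2).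
have mF2 : measurable_fun [set: mR * mR] F2.
  apply: measurable_funM; last first.
    apply: measurable_funM; first exact: (measurableT_comp mQ m1).
    exact: (measurableT_comp mQ m2).
  exact: continuous_measurable_plane (@cchi_affine _ _ _ _).
have F2B x y : `|F2 (x, y)| <= M * Q x * Q y.
  exact: bound (Q0 _) (Q0 _) (chiM _).
rewrite -(@Rfubini21 _ _ _ _ _ sleb1 sleb1 _ _ MQ0 Q0 iMQ iQ F2 mF2 F2B).
apply: eq_Rintegral => y _.
have h := @Rintegral_poisson_subst e z.1 (M * Q y)
  (fun x => chi (x, z.2 + e * y) * Q y) e0.
transitivity (\int[leb]_w (chi (w, z.2 + e * y) * Q y * P z.1 w)).
  by apply: eq_Rintegral => w _ /=; rewrite /F1 /=; ring.
rewrite {}h.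
- by apply: eq_Rintegral => w _ /=; rewrite /F2 /= /Q; ring.
- by move=> w; apply: cvgMl; exact: continuous_slice1.
- by move=> w; rewrite normrM (ger0_norm (Q0 y)) ler_wpM2r ?Q0.
Qed.

(** After the substitution the kernel no longer depends on n and only the argument of [chi] moves,
    so that dominated convergence and the continuity of [chi] conclude. *)
Lemma poisson_approximation (z : R * R) :
  \int[sleb2]_w (chi w * (poisson n.+1%:R^-1 (w.1 - z.1) *
    poisson n.+1%:R^-1 (w.2 - z.2))) @[n --> \oo] --> (2 * pi) ^+ 2 * chi z.
Proof.
under eq_fun do rewrite Rintegral_poisson_subst2 ?invr_gt0//.
have -> : (2 * pi) ^+ 2 * chi z = \int[sleb2]_u (chi z * (Q u.1 * Q u.2)).
  by rewrite RintegralZl ?integral_poisson1_prod 1?mulrC//;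
    exact: integrable_poisson1_prod.
apply: (@dct_seq _ _ _ sleb2 _ _ (fun u => M * (Q u.1 * Q u.2))).
- move=> n; apply: measurable_funM; last first.
    by apply: measurable_funM; [exact: (measurableT_comp mQ measurable_fst)|
      exact: (measurableT_comp mQ measurable_snd)].
  exact: continuous_measurable_plane (@cchi_affine _ _ _ _).
- move=> n u; have QQ0 := mulr_ge0 (Q0 u.1) (Q0 u.2).
  by rewrite normrM (ger0_norm QQ0) ler_wpM2r.
- exact: (integrableZl measurableT M integrable_poisson1_prod).
- move=> u; apply: cvgMl.
  apply: (@cvg_comp _ _ _
    (fun n => (z.1 + n.+1%:R^-1 * u.1, z.2 + n.+1%:R^-1 * u.2)) chi _ (nbhs z));
    last exact: cchi.
  rewrite [in nbhs z](surjective_pairing z).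
  have h (a b : R) : a + n.+1%:R^-1 * b @[n --> \oo] --> a.
    rewrite -[X in _ --> X]addr0; apply: cvgD; first exact: cvg_cst.
    by rewrite -(mul0r b); apply: cvgMl; exact: cvg_harmonic.
  by apply: cvg_pair_nbhs; exact: h.
Qed.

End subst.
End PoissonLimit.

(** * Limits of complex-valued functions *)

Section ComplexLimits.
Context {R : realType}.
Local Notation C := R[i].

Section filter.
Context {T : Type} {F : set_system T} {FF : Filter F}.
Implicit Types f g : T -> C.

Lemma ccvg_cst (c : C) : ccvg F (fun=> c) c.
Proof. by split; exact: cvg_cst. Qed.

Lemma ccvgD f g a b : ccvg F f a -> ccvg F g b ->
  ccvg F (fun x => f x + g x) (a + b).
Proof.
move=> [f1 f2] [g1 g2]; split.
  rewrite ReD (_ : re _ = (fun x => re f x + re g x)); first exact: cvgD.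
  by apply/funext => x; exact: ReD.
rewrite ImD (_ : im _ = (fun x => im f x + im g x)); first exact: cvgD.
by apply/funext => x; exact: ImD.
Qed.

Lemma ccvgM f g a b : ccvg F f a -> ccvg F g b ->
  ccvg F (fun x => f x * g x) (a * b).
Proof.
move=> [f1 f2] [g1 g2]; split.
  rewrite ReM (_ : re _ = (fun x => re f x * re g x - im f x * im g x)).
    by apply: cvgB; exact: cvgM.
  by apply/funext => x; exact: ReM.
rewrite ImM (_ : im _ = (fun x => re f x * im g x + im f x * re g x)).
  by apply: cvgD; exact: cvgM.
by apply/funext => x; exact: ImM.
Qed.

Lemma ccvgR (h : T -> R) (a : R) : h x @[x --> F] --> a ->
  ccvg F (fun x => (h x)%:C) a%:C.
Proof. by move=> ha; split => //; exact: cvg_cst. Qed.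

Lemma ccvg_expi (h : T -> R) (a : R) : h x @[x --> F] --> a ->
  ccvg F (fun x => expi (h x)) (expi a).
Proof.
move=> ha; split.
  exact: (cvg_comp _ _ ha (@continuous_cos R a)).
exact: (cvg_comp _ _ ha (@continuous_sin R a)).
Qed.

Lemma ccvg_unique {PF : ProperFilter F} f (a b : C) :
  ccvg F f a -> ccvg F f b -> a = b.
Proof.
move=> [f1 f2] [g1 g2]; apply: complex_eq.
  exact: (cvg_unique _ f1 g1).
exact: (cvg_unique _ f2 g2).
Qed.

End filter.

Lemma ccontinuousP {T : topologicalType} (f : T -> C) :
  ccontinuous f <-> forall x, ccvg (nbhs x) f (f x).
Proof.
split=> [[f1 f2] x|h]; first by split; [exact: f1|exact: f2].
by split => x; have [h1 h2] := h x; [exact: h1|exact: h2].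
Qed.

End ComplexLimits.

(** * Fourier inversion on the plane *)

Section FourierInversion.
Context {R : realType}.
Local Notation C := R[i].
Local Notation mR := (measurableTypeR R).

Definition dot (p z : R * R) : R := p.1 * z.1 + p.2 * z.2.

Lemma dotC (p z : R * R) : dot p z = dot z p.
Proof. by rewrite /dot mulrC (mulrC p.2). Qed.

Lemma measurable_dot {d : measure_display} {T : measurableType d}
    (f g : T -> (mR * mR)%type) : measurable_fun setT f -> measurable_fun setT g ->
  measurable_fun setT (fun x => dot (f x) (g x)).
Proof.
move=> mf mg; have mf1 := measurableT_comp measurable_fst mf.
have mf2 := measurableT_comp measurable_snd mf.
have mg1 := measurableT_comp measurable_fst mg.
have mg2 := measurableT_comp measurable_snd mg.
by apply: measurable_funD; exact: measurable_funM.
Qed.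

Lemma cvg_dot (p : R * R) (z : R * R) : dot p w @[w --> z] --> dot p z.
Proof.
apply: cvgD; apply: cvgMr.
  exact: fst_continuous.
exact: snd_continuous.
Qed.

Lemma fourier_continuous (f : R * R -> C) : cintegrable leb2 setT f ->
  ccontinuous (fourier f).
Proof.
move=> fi; apply/ccontinuousP => z.
apply: (@cdct _ _ _ leb2 _ _ _ (fun z p => expi (- dot p z) * f p) _
  (fun p => cmod (f p))).
- exact: cg_nbhs.
- move=> s; apply: cmeasurableM; last exact: cintegrable_meas fi.
  apply: cmeasurable_expi; apply: measurable_funN.
  by apply: measurable_dot => //; exact: measurable_cst.
- by move=> s p; rewrite cmodM cmod_expi mul1r.
- exact: cintegrable_cmod.
- move=> p; apply: ccvgM; last exact: ccvg_cst.
  by apply: ccvg_expi; apply: cvgN; exact: cvg_dot.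
Qed.

Lemma fourier_measurable (f : R * R -> C) : cintegrable leb2 setT f ->
  cmeasurable (fourier f : (mR * mR)%type -> C).
Proof. by move=> fi; apply/ccontinuous_measurable_plane/fourier_continuous. Qed.

Lemma fourier_bounded (f : R * R -> C) : cintegrable leb2 setT f ->
  exists M : R, forall z, cmod (fourier f z) <= M.
Proof.
move=> fi; exists (2 * \int[leb2]_p cmod (f p)) => z.
apply: cmod_cint; last exact: cintegrable_cmod.
  apply: cmeasurableM; last exact: cintegrable_meas fi.
  apply: cmeasurable_expi; apply: measurable_funN.
  by apply: measurable_dot => //; exact: measurable_cst.
by move=> p; rewrite cmodM cmod_expi mul1r.
Qed.

Let E (e x : R) : R := expR (- (e * `|x|)).

Let mE e : measurable_fun setT (E e : mR -> R).
Proof.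
apply: measurableT_comp => //; apply: measurableT_comp => //.
by apply: measurable_funM => //; exact: measurableT_comp.
Qed.

Let E0 e x : 0 <= E e x. Proof. exact: expR_ge0. Qed.

Let iE e : 0 < e -> sleb1.-integrable setT (EFin \o E e).
Proof. exact: integrable_expR_norm. Qed.

Let cint_E (e : R) (a : R * R) : 0 < e ->
  cint leb2 setT (fun p => expi (dot p a) * (E e p.1 * E e p.2)%:C) =
  (poisson e a.1 * poisson e a.2)%:C.
Proof.
move=> e0; rewrite cint_sleb2.
pose F (p : R * R) := expi (dot p a) * (E e p.1 * E e p.2)%:C.
have mF : cmeasurable (F : (mR * mR)%type -> C).
  apply: cmeasurableM.
    apply: cmeasurable_expi; apply: measurable_dot => //; exact: measurable_cst.
  apply: cmeasurableR; apply: measurable_funM.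
    exact: (measurableT_comp (mE _) measurable_fst).
  exact: (measurableT_comp (mE _) measurable_snd).
have FB x y : cmod (F (x, y)) <= E e x * E e y.
  by rewrite cmodM cmod_expi mul1r cmodR ger0_norm// mulr_ge0.
rewrite -(@cfubini12 _ _ _ _ _ sleb1 sleb1 _ _ (E0 e) (E0 e) (iE e0) (iE e0)
  F mF FB).
pose G (a x : R) := expi (a * x) * (E e x)%:C.
have iG b : cintegrable sleb1 setT (G b).
  apply: (@cintegrable_le _ _ mR sleb1 _ (E e)).
  - apply: cmeasurableM; last by apply: cmeasurableR; exact: mE.
    by apply: cmeasurable_expi; apply: measurable_funM.
  - by move=> x; rewrite cmodM cmod_expi mul1r cmodR ger0_norm.
  - exact: iE.
transitivity (cint sleb1 setT (fun x => (poisson e a.2)%:C * G a.1 x)).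
  apply: eq_cint => x; rewrite -cint_exp_fourier// mulrC.
  rewrite -cintZ; last exact: iG.
  apply: eq_cint => y; rewrite /F /G /= /dot /= expiD rmorphM /=.
  by rewrite (mulrC x) (mulrC y); ring.
rewrite cintZ; last exact: iG.
by rewrite cint_exp_fourier//; apply: complex_eq; rewrite /= /poisson; ring.
Qed.

(** The damped integral [In n] is computed in two ways, and the damping parameter 1/(n+1) tends to 0
    in both. *)
Theorem fourier_inversion (chi : R * R -> C) (M : R) (z : R * R) :
  ccontinuous chi -> (forall w, cmod (chi w) <= M) ->
  cintegrable leb2 setT chi -> cintegrable leb2 setT (fourier chi) ->
  cint leb2 setT (fun p => expi (dot p z) * fourier chi p) =
  ((2 * pi) ^+ 2)%:C * chi z.
Proof.
move=> cchi chiM ichi ifchi.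
pose e n : R := n.+1%:R^-1.
have e0 n : 0 < e n by rewrite invr_gt0.
pose In n := cint leb2 setT (fun p : R * R =>
  expi (dot p z) * fourier chi p * (E (e n) p.1 * E (e n) p.2)%:C).
have mchi := ccontinuous_measurable_plane cchi.
have m1 := measurable_fst : measurable_fun [set: mR * mR] _.
have m2 := measurable_snd : measurable_fun [set: mR * mR] _.
have mexp : cmeasurable ((fun p => expi (dot p z)) : (mR * mR)%type -> C).
  by apply: cmeasurable_expi; apply: measurable_dot => //; exact: measurable_cst.
have mEE n : cmeasurable ((fun p => (E (e n) p.1 * E (e n) p.2)%:C) :
    (mR * mR)%type -> C).
  apply: cmeasurableR; apply: measurable_funM.
    exact: (measurableT_comp (mE _) m1).
  exact: (measurableT_comp (mE _) m2).
have mf := fourier_measurable ichi.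
have E1 n x : E (e n) x <= 1.
  by rewrite -[1](@expR0 R) ler_expR oppr_le0 mulr_ge0// ltW.
(* The damping factors lie between 0 and 1 and tend to 1, so the integrable function [fourier chi]
   dominates. *)
have lim1 : ccvg \oo In (cint leb2 setT (fun p => expi (dot p z) * fourier chi p)).
  apply: (@cdct _ _ _ leb2 _ _ _ _ _ (fun p => cmod (fourier chi p))).
  - exact: cg_eventually.
  - by move=> n; apply: cmeasurableM; [exact: cmeasurableM|exact: mEE].
  - move=> n p; rewrite !cmodM cmod_expi mul1r cmodR ger0_norm ?mulr_ge0//.
    by rewrite ler_piMr ?cmod_ge0// mulr_ile1.
  - exact: cintegrable_cmod.
  - move=> p; rewrite -[X in ccvg _ _ X]mulr1.
    apply: ccvgM; first exact: ccvg_cst.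
    rewrite -[1]/(1%:C); apply: ccvgR; rewrite -[X in _ --> X]mulr1.
    have hE (x : R) : E (e n) x @[n --> \oo] --> (1 : R).
      rewrite -[X in _ --> X](@expR0 R).
      have h : - (e n * `|x|) @[n --> \oo] --> (0 : R).
        rewrite -[X in _ --> X]oppr0; apply: cvgN.
        by rewrite -(mul0r `|x|); apply: cvgMl; exact: cvg_harmonic.
      exact: (cvg_comp _ _ h (@continuous_expR R 0)).
    by apply: cvgM; exact: hE.
apply: (ccvg_unique lim1).
(* With damping Fubini applies to [F], and the transform of the damping factor evaluated at z - w is
   a product of Poisson kernels, that is, an approximate identity centred at [z]. *)
have InE n : In n = cint leb2 setT (fun w =>
    chi w * (poisson (e n) (w.1 - z.1) * poisson (e n) (w.2 - z.2))%:C).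
  pose F (pw : (R * R) * (R * R)) := expi (dot pw.1 (z - pw.2)) *
    (E (e n) pw.1.1 * E (e n) pw.1.2)%:C * chi pw.2.
  transitivity (cint sleb2 setT (fun p => cint sleb2 setT (fun w => F (p, w)))).
    rewrite /In cint_sleb2; apply: eq_cint => p.
    rewrite mulrAC -cintZ; last first.
      apply: (@cintegrableM_bounded _ _ _ leb2 _ _ 1) => //.
        apply: cmeasurable_expi; apply: measurable_funN.
        by apply: measurable_dot => //; exact: measurable_cst.
      by move=> w; rewrite cmod_expi.
    apply: eq_cint => w; rewrite /F /=.
    have -> : dot p (z - w) = dot p z + - (w.1 * p.1 + w.2 * p.2).
      by rewrite /dot /=; ring.
    by rewrite expiD; ring.
  have mF : cmeasurable (F : ((mR * mR) * (mR * mR))%type -> C).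
    have n1 : measurable_fun [set: (mR * mR) * (mR * mR)] fst by exact: measurable_fst.
    have n2 : measurable_fun [set: (mR * mR) * (mR * mR)] snd by exact: measurable_snd.
    apply: cmeasurableM; last exact: (cmeasurable_comp mchi n2).
    apply: cmeasurableM; last exact: (cmeasurable_comp (mEE n) n1).
    apply: cmeasurable_expi; apply: measurable_dot; first exact: n1.
    apply/measurable_fun_pair.
      apply: measurable_funB; first exact: measurable_cst.
      exact: (measurableT_comp m1 n2).
    apply: measurable_funB; first exact: measurable_cst.
    exact: (measurableT_comp m2 n2).
  have FB p w : cmod (F (p, w)) <= (E (e n) p.1 * E (e n) p.2) * cmod (chi w).
    by rewrite !cmodM cmod_expi mul1r cmodR ger0_norm// mulr_ge0.
  have iEE := @integrable_prod _ _ _ _ _ sleb1 sleb1 _ _ (E0 _) (E0 _)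
    (iE (e0 n)) (iE (e0 n)).
  have EE0 (p : R * R) : 0 <= E (e n) p.1 * E (e n) p.2 by exact: mulr_ge0.
  rewrite (@cfubini _ _ _ _ _ sleb2 sleb2 _ _ EE0 (fun w => cmod_ge0 (chi w))
    iEE (cintegrable_cmod ichi) F mF FB).
  apply: eq_cint => w.
  transitivity (cint leb2 setT (fun p => chi w *
     (expi (dot p (z - w)) * (E (e n) p.1 * E (e n) p.2)%:C))).
    by apply: eq_cint => p; rewrite /F /= mulrC.
  rewrite cintZ; last first.
    apply: (@cintegrable_le _ _ _ leb2 _ (fun p => E (e n) p.1 * E (e n) p.2)).
    - apply: cmeasurableM; last exact: mEE.
      apply: cmeasurable_expi; apply: measurable_dot => //; exact: measurable_cst.
    - by move=> p; rewrite cmodM cmod_expi mul1r cmodR ger0_norm// mulr_ge0.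
    - exact: iEE.
  rewrite cint_E//=; congr (_ * (_ * _)%:C).
    by rewrite -poissonN opprB.
  by rewrite -poissonN opprB.
rewrite (funext InE); case: cchi => c1 c2; split.
- rewrite ReZ.
  have h := @poisson_approximation R (re chi) M c1
    (fun w => le_trans (ler_Re_cmod (chi w)) (chiM w)) z.
  apply: cvg_trans h; apply: near_eq_cvg; apply: nearW => n /=.
  apply: eq_Rintegral => w _; by rewrite /re [chi w * _]mulrC ReZ mulrC.
- rewrite ImZ.
  have h := @poisson_approximation R (im chi) M c2
    (fun w => le_trans (ler_Im_cmod (chi w)) (chiM w)) z.
  apply: cvg_trans h; apply: near_eq_cvg; apply: nearW => n /=.
  apply: eq_Rintegral => w _; by rewrite /im [chi w * _]mulrC ImZ mulrC.
Qed.

End FourierInversion.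

(** * Schwartz functions *)

Section ComplexDerivatives.
Context {R : realType}.
Local Notation C := R[i].

Definition cis_derive (h : R -> C) (x : R) (l : C) : Prop :=
  is_derive x 1 (re h) (complex.Re l) /\ is_derive x 1 (im h) (complex.Im l).

Lemma cis_derive_eq h (x : R) (l l' : C) : cis_derive h x l -> l = l' ->
  cis_derive h x l'.
Proof. by move=> ? <-. Qed.

Lemma cis_dcst (x : R) (c : C) : cis_derive (fun=> c) x 0.
Proof. by split; exact: is_dcst. Qed.

Lemma cis_dR (f : R -> R) (x a : R) : is_derive x 1 f a ->
  cis_derive (fun y => (f y)%:C) x a%:C.
Proof. by move=> df; split => //; exact: is_dcst. Qed.

Lemma cis_dD (f g : R -> C) (x : R) (a b : C) :
  cis_derive f x a -> cis_derive g x b ->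
  cis_derive (fun y => f y + g y) x (a + b).
Proof.
move=> [f1 f2] [g1 g2]; split.
  rewrite ReD (_ : re _ = (fun y => re f y + re g y)); first exact: is_dD.
  by apply/funext => y; exact: ReD.
rewrite ImD (_ : im _ = (fun y => im f y + im g y)); first exact: is_dD.
by apply/funext => y; exact: ImD.
Qed.

Lemma cis_dM (f g : R -> C) (x : R) (a b : C) :
  cis_derive f x a -> cis_derive g x b ->
  cis_derive (fun y => f y * g y) x (a * g x + f x * b).
Proof.
move=> [f1 f2] [g1 g2]; split.
  rewrite (_ : re _ = (fun y => re f y * re g y + - (im f y * im g y))).
    have h := is_dD (is_dM f1 g1) (is_dN (is_dM f2 g2)).
    by apply: is_derive_eq h _; rewrite ReD !ReM /re /im; ring.
  by apply/funext => y; exact: ReM.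
rewrite (_ : im _ = (fun y => re f y * im g y + im f y * re g y)).
  have h := is_dD (is_dM f1 g2) (is_dM f2 g1).
  by apply: is_derive_eq h _; rewrite ImD !ImM /re /im; ring.
by apply/funext => y; exact: ImM.
Qed.

Lemma cis_dexpi (th : R -> R) (x a : R) : is_derive x 1 th a ->
  cis_derive (fun y => expi (th y)) x ((0 +i* a) * expi (th x)).
Proof.
move=> dth; split.
  have h := is_dcomp (is_derive_cos _) dth.
  by apply: is_derive_eq h _; rewrite ReM /=; ring.
have h := is_dcomp (is_derive_sin _) dth.
by apply: is_derive_eq h _; rewrite ImM /=; ring.
Qed.

Lemma cis_derive_continuous (f : R -> C) (x : R) (a : C) : cis_derive f x a ->
  ccvg (nbhs x) f (f x).
Proof.
by move=> [f1 f2]; split; [exact: is_derive1_continuous f1|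
  exact: is_derive1_continuous f2].
Qed.

(** Partial derivatives are treated as ordinary derivatives along the coordinate line through [p];
    [b] follows the convention of [pderiv], with [true] for the direction y. *)
Definition slice (b : bool) {U : Type} (f : R * R -> U) (p : R * R) (t : R) : U :=
  f (if b then (p.1, t) else (t, p.2)).

Definition coord (b : bool) (p : R * R) : R := if b then p.2 else p.1.

Local Notation dir b := (if b then e_y else e_x).

Let quotientE (b : bool) (g : R * R -> R) (p : R * R) :
  (fun h => h^-1 *: ((g \o shift p) (h *: (dir b : R * R)) - g p)) =
  (fun h => h^-1 *: ((slice b g p \o shift (coord b p)) (h *: (1 : R)) -
    slice b g p (coord b p))).
Proof.
apply/funext => h; rewrite /slice /coord /shift /=; congr (_ *: (g _ - g _)).
  by case: b p => [] [x y]; apply/pair_equal_spec; split;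
    rewrite /= /GRing.scale /= ?mulr0 ?add0r.
by case: b p => [] [x y].
Qed.

Lemma cderivableP (b : bool) (f : R * R -> C) (p : R * R) :
  cderivable (dir b) f p -> cis_derive (slice b f p) (coord b p)
    (cderive (dir b) f p).
Proof.
move=> [d1 d2]; split.
  apply: DeriveDef.
    by move: d1; rewrite /derivable quotientE.
  by rewrite /derive /cderive /= /derive quotientE.
apply: DeriveDef.
  by move: d2; rewrite /derivable quotientE.
by rewrite /derive /cderive /= /derive quotientE.
Qed.

Lemma cis_derive_partial (b : bool) (f : R * R -> C) (p : R * R) (l : C) :
  cis_derive (slice b f p) (coord b p) l ->
  cderivable (dir b) f p /\ cderive (dir b) f p = l.
Proof.
move=> [[d1 e1] [d2 e2]]; split.
  by split; [move: d1|move: d2]; rewrite /derivable quotientE.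
apply: complex_eq; [rewrite -e1|rewrite -e2].
  by rewrite /cderive /= /derive quotientE.
by rewrite /cderive /= /derive quotientE.
Qed.

End ComplexDerivatives.

Section Schwartz.
Context {R : realType}.
Local Notation C := R[i].
Local Notation dir b := (if b then e_y else e_x).
Implicit Types f : R * R -> C.

Lemma pderiv_cat (w w' : seq bool) f : pderiv (w ++ w') f = pderiv w (pderiv w' f).
Proof. exact: foldr_cat. Qed.

Lemma schwartz_pderiv f (w : seq bool) : schwartz f -> schwartz (pderiv w f).
Proof.
move=> [sf df]; split=> [w'|k w']; rewrite -pderiv_cat; first exact: sf.
exact: df.
Qed.

Lemma schwartz_continuous f : schwartz f -> ccontinuous f.
Proof. by move=> [/(_ [::])[]]. Qed.

Lemma schwartz_derivable f b p : schwartz f -> cderivable (dir b) f p.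
Proof. by move=> [/(_ [::])[_ h] _]; exact: h. Qed.

Lemma weight_ge1 k (p : R * R) : 1 <= weight k p.
Proof. by rewrite /weight exprn_ege1// -addrA lerDl addr_ge0. Qed.

Let Q := poisson (1 : R).

Let QE (x : R) : Q x = 2 / (1 + x ^+ 2).
Proof. by rewrite /Q /poisson mulr1 expr1n. Qed.

Let Q0 (x : R) : 0 <= Q x. Proof. exact: poisson_ge0. Qed.

(** Each of 1 + x^2 and 1 + y^2 is at most (1 + |x| + |y|)^2, so a weight of order 4 gives the decay
    of both variables at once. *)
Lemma weight4_decay (a B : R) (p : R * R) : 0 <= a ->
  weight 4 p * a <= B -> a <= B * (Q p.1 * Q p.2).
Proof.
case: p => x y a0 /= h; rewrite !QE.
have px : 0 < 1 + x ^+ 2 by rewrite ltr_pwDl ?sqr_ge0.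
have py : 0 < 1 + y ^+ 2 by rewrite ltr_pwDl ?sqr_ge0.
have -> : B * (2 / (1 + x ^+ 2) * (2 / (1 + y ^+ 2))) =
    (4 * B) / ((1 + x ^+ 2) * (1 + y ^+ 2)) by field; rewrite !gt_eqF.
rewrite ler_pdivlMr ?mulr_gt0// mulrC.
have w4 : (1 + x ^+ 2) * (1 + y ^+ 2) <= weight 4 (x, y).
  rewrite /weight /= -[4%N]/(2 + 2)%N exprD.
  rewrite -(real_normK (num_real x)) -(real_normK (num_real y)).
  have := normr_ge0 x; have := normr_ge0 y.
  move: `|x| `|y| => u v v0 u0.
  by apply: ler_pM; rewrite ?addr_ge0 ?sqr_ge0//; nra.
have w0 : 0 <= weight 4 (x, y) by rewrite (le_trans ler01)// weight_ge1.
have B0 : 0 <= B by apply: le_trans h; exact: mulr_ge0.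
apply: le_trans (ler_wpM2r a0 w4) _; apply: le_trans h _; lra.
Qed.

Lemma schwartz_decay f : schwartz f ->
  exists2 B : R, 0 <= B & forall p, cmod (f p) <= B * (Q p.1 * Q p.2).
Proof.
move=> [_ /(_ 4%N [::])[B hB]]; exists B.
  have := hB (0, 0); apply: le_trans; apply: mulr_ge0 (cmod_ge0 _).
  by rewrite (le_trans ler01)// weight_ge1.
by move=> p; apply: weight4_decay (hB p); exact: cmod_ge0.
Qed.

Lemma schwartz_integrable f : schwartz f -> cintegrable leb2 setT f.
Proof.
move=> sf; have [B B0 hB] := schwartz_decay sf.
apply: (@cintegrable_le _ _ _ leb2 _ (fun p => B * (Q p.1 * Q p.2))) => //.
  exact: ccontinuous_measurable_plane (schwartz_continuous sf).
exact: (integrableZl measurableT B integrable_poisson1_prod).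
Qed.

Let Q2 (x : R) : Q x <= 2.
Proof. by rewrite QE ler_pdivrMr ?ltr_pwDl ?sqr_ge0//; have := sqr_ge0 x; lra. Qed.

Lemma schwartz_bounded f : schwartz f ->
  exists M : R, forall p, cmod (f p) <= M.
Proof.
move=> sf; have [B B0 hB] := schwartz_decay sf; exists (B * (2 * 2)) => p.
rewrite (le_trans (hB p))// ler_wpM2l//.
exact: ler_pM (Q0 _) (Q0 _) (Q2 _) (Q2 _).
Qed.

Lemma poisson1_cvg0 (s : R) : s ^+ 2 = 1 -> Q (s * n%:R) @[n --> \oo] --> 0.
Proof.
move=> s2; apply: (@cvg_le0 _ _ (fun n => n.+1%:R^-1) 2); last exact: cvg_harmonic.
move=> n; rewrite (ger0_norm (Q0 _)) QE exprMn s2 mul1r ler_pM2l//.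
rewrite lef_pV2 ?posrE ?ltr_pwDl ?sqr_ge0//.
by rewrite -natrX -natr1 addrC lerD2l ler_nat -mulnn; case: n => // n; rewrite leq_pmulr.
Qed.

(** The Poisson bound makes the primitive [h] vanish at both infinities. *)
Lemma cint_derivative_eq0 (h h' : R -> C) (B : R) :
  (forall x, cis_derive h x (h' x)) -> ccontinuous h' ->
  cintegrable leb1 setT h' -> (forall x, cmod (h x) <= B * Q x) ->
  cint leb1 setT h' = 0.
Proof.
move=> dh [c1 c2] [i1 i2] hB.
have lim (k : R -> R) (s : R) : s ^+ 2 = 1 -> (forall x, `|k x| <= cmod (h x)) ->
    k (s * n%:R) @[n --> \oo] --> 0.
  move=> s2 kh; apply: (@cvg_le0 _ _ (fun n => Q (s * n%:R)) B).
    by move=> n; rewrite (le_trans (kh _))// hB.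
  exact: poisson1_cvg0.
have NE (k : R -> R) : (fun n : nat => k (- n%:R)) = (fun n : nat => k (-1 * n%:R)).
  by apply/funext => n; rewrite mulN1r.
have PE (k : R -> R) : (fun n : nat => k n%:R) = (fun n : nat => k (1 * n%:R)).
  by apply/funext => n; rewrite mul1r.
have h1 : (1 : R) ^+ 2 = 1 by rewrite expr1n.
have h2 : (-1 : R) ^+ 2 = 1 by rewrite sqrrN expr1n.
apply: complex_eq => /=.
  apply: (integral_derivative_eq0 (fun x => (dh x).1) c1 i1).
    by rewrite (PE (re h)); apply: lim => // x; exact: ler_Re_cmod.
  by rewrite (NE (re h)); apply: lim => // x; exact: ler_Re_cmod.
apply: (integral_derivative_eq0 (fun x => (dh x).2) c2 i2).
  by rewrite (PE (im h)); apply: lim => // x; exact: ler_Im_cmod.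
by rewrite (NE (im h)); apply: lim => // x; exact: ler_Im_cmod.
Qed.

Lemma fourier_integrand_integrable f (z : R * R) : cintegrable leb2 setT f ->
  cintegrable leb2 setT (fun p => expi (- dot p z) * f p).
Proof.
move=> fi; apply: (@cintegrableM_bounded _ _ _ leb2 _ _ 1) => //.
  apply: cmeasurable_expi; apply: measurable_funN.
  by apply: measurable_dot => //; exact: measurable_cst.
by move=> p; rewrite cmod_expi.
Qed.

Lemma ccontinuous_slice f (b : bool) (p : R * R) : ccontinuous f ->
  ccontinuous (slice b f p).
Proof.
case: b => -[c1 c2]; split.
- have h := @continuous_slice2 R _ (re f) p.1 c1; exact: h.
- have h := @continuous_slice2 R _ (im f) p.1 c2; exact: h.
- have h := @continuous_slice1 R _ (re f) p.2 c1; exact: h.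
- have h := @continuous_slice1 R _ (im f) p.2 c2; exact: h.
Qed.

(** Integration by parts: the difference of the two sides is the integral of [D], which is the
    derivative of [E * f] in the direction [b]. Every line in that direction contributes 0, and
    Fubini integrates these lines first. *)
Lemma fourier_pderiv1 f (b : bool) (z : R * R) : schwartz f ->
  fourier (pderiv [:: b] f) z = (0 +i* coord b z) * fourier f z.
Proof.
move=> sf; have sdf := schwartz_pderiv [:: b] sf.
have fi := schwartz_integrable sf; have dfi := schwartz_integrable sdf.
have [B B0 hB] := schwartz_decay sf; have [B' B'0 hB'] := schwartz_decay sdf.
apply/eqP; rewrite -subr_eq0; apply/eqP.
pose E (p : R * R) := expi (- dot p z).
pose D (p : R * R) := E p * pderiv [:: b] f p + (0 +i* - coord b z) * (E p * f p).
have DE : fourier (pderiv [:: b] f) z - (0 +i* coord b z) * fourier f z =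
    cint leb2 setT D.
  have i1 := fourier_integrand_integrable z dfi.
  have i2 := fourier_integrand_integrable z fi.
  rewrite (cintD i1 (cintegrableZ (0 +i* - coord b z) i2)) (cintZ _ i2).
  congr (_ + _); rewrite -mulNr; congr (_ * _).
  by apply: complex_eq; rewrite /= ?oppr0.
rewrite {}DE.
have cE : ccontinuous E.
  apply/ccontinuousP => p; apply: ccvg_expi; apply: cvgN.
  by under eq_fun do rewrite dotC; rewrite dotC; exact: cvg_dot.
have cf := (ccontinuousP _).1 (schwartz_continuous sf).
have cdf := (ccontinuousP _).1 (schwartz_continuous sdf).
have cD : ccontinuous D.
  have cE' := (ccontinuousP _).1 cE.
  apply/ccontinuousP => p; apply: ccvgD; first exact: ccvgM.
  by apply: ccvgM; [exact: ccvg_cst|exact: ccvgM].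
have mD := ccontinuous_measurable_plane cD.
pose M := B' + `|coord b z| * B.
have M0 : 0 <= M by rewrite addr_ge0// mulr_ge0.
have DB x y : cmod (D (x, y)) <= M * Q x * Q y.
  have cC : cmod (0 +i* - coord b z) = `|coord b z|.
    by rewrite /= expr0n add0r sqrrN sqrtr_sqr.
  rewrite (le_trans (cmodD _ _))// !cmodM cmod_expi !mul1r cC.
  have -> : M * Q x * Q y = B' * (Q x * Q y) + `|coord b z| * (B * (Q x * Q y)).
    by rewrite /M; ring.
  apply: lerD; first exact: hB' (x, y).
  apply: ler_wpM2l => //; exact: hB (x, y).
have iQ : sleb1.-integrable setT (EFin \o Q) by exact: integrable_poisson.
have iMQ : sleb1.-integrable setT (EFin \o (fun x => M * Q x)).
  exact: (integrableZl measurableT M iQ).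
have MQ0 x : 0 <= M * Q x by exact: mulr_ge0 M0 (Q0 x).
have key (p : R * R) : cint leb1 setT (slice b D p) = 0.
  (* The coordinate that stays fixed is [p.1] or [p.2] according to [b]; the sum of the two kernel
     values provides a bound valid in both cases. *)
  apply: (@cint_derivative_eq0 (slice b (fun q => E q * f q) p) _
     (B * (Q p.1 + Q p.2))).
  - move=> t.
    pose q := if b then (p.1, t) else (t, p.2).
    have sE U (g : R * R -> U) : slice b g q = slice b g p.
      by rewrite /q /slice; case: (b).
    have cq : coord b q = t by rewrite /q /coord; case: (b).
    have dfq := cderivableP (schwartz_derivable b q sf); rewrite sE cq in dfq.
    have dE : cis_derive (slice b E p) t ((0 +i* - coord b z) * slice b E p t).
      rewrite /slice /E; apply: cis_dexpi; rewrite /dot /coord; case: (b) => /=.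
        have h := is_dN (is_dD (is_dcst t (p.1 * z.1)) (is_dM (is_did t) (is_dcst t z.2))).
        by apply: is_derive_eq h _; ring.
      have h := is_dN (is_dD (is_dM (is_did t) (is_dcst t z.1)) (is_dcst t (p.2 * z.2))).
      by apply: is_derive_eq h _; ring.
    apply: cis_derive_eq (cis_dM dE dfq) _.
    by rewrite /slice /D addrC -mulrA.
  - exact: ccontinuous_slice.
  - rewrite /slice; case: (b).
      exact: (@cintegrable_section1 _ _ _ _ _ sleb1 _ _ iQ D mD DB p.1).
    exact: (@cintegrable_section2 _ _ _ _ _ sleb1 _ _ iMQ D mD DB p.2).
  - move=> t; rewrite /slice cmodM cmod_expi mul1r (le_trans (hB _))//.
    rewrite -mulrA ler_wpM2l// mulrDl.
    case: (b) => /=; first by rewrite lerDl mulr_ge0 ?Q0.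
    by rewrite mulrC lerDr mulr_ge0 ?Q0.
rewrite cint_sleb2; move: key; rewrite /slice; case: (b) => key.
  rewrite -(@cfubini12 _ _ _ _ _ sleb1 sleb1 _ _ MQ0 Q0 iMQ iQ D mD DB).
  transitivity (cint sleb1 setT (fun=> 0 : C)); last exact: cint0.
  by apply: eq_cint => x; exact: key (x, 0).
rewrite -(@cfubini21 _ _ _ _ _ sleb1 sleb1 _ _ MQ0 Q0 iMQ iQ D mD DB).
transitivity (cint sleb1 setT (fun=> 0 : C)); last exact: cint0.
by apply: eq_cint => y; exact: key (0, y).
Qed.

(** The transforms of f, f_xx, f_yy and f_xxyy are bounded, so (1 + xi^2)(1 + eta^2) times the
    transform of f is bounded, and a product of Poisson kernels dominates. *)
Lemma schwartz_fourier_integrable f : schwartz f ->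
  cintegrable leb2 setT (fourier f).
Proof.
move=> sf; have bnd w := fourier_bounded (schwartz_integrable (schwartz_pderiv w sf)).
have [M0 h0] := bnd [::]; have [M1 h1] := bnd [:: false; false].
have [M2 h2] := bnd [:: true; true].
have [M3 h3] := bnd [:: false; false; true; true].
have two (g : R * R -> C) b z : schwartz g -> cmod (fourier (pderiv [:: b; b] g) z) =
    coord b z ^+ 2 * cmod (fourier g z).
  move=> sg; rewrite (fourier_pderiv1 b z (schwartz_pderiv [:: b] sg)).
  rewrite (fourier_pderiv1 b z sg) !cmodM mulrA; congr (_ * _).
  by rewrite /= expr0n add0r sqrtr_sqr -expr2 real_normK// num_real.
apply: (@cintegrable_le _ _ _ leb2 _
    (fun z => (M0 + M1 + M2 + M3) * (Q z.1 * Q z.2))).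
- exact: fourier_measurable (schwartz_integrable sf).
- move=> z; have H0 := h0 z.
  have H1 : z.1 ^+ 2 * cmod (fourier f z) <= M1.
    by rewrite -(two f false z sf); exact: h1.
  have H2 : z.2 ^+ 2 * cmod (fourier f z) <= M2.
    by rewrite -(two f true z sf); exact: h2.
  have H3 : z.1 ^+ 2 * (z.2 ^+ 2 * cmod (fourier f z)) <= M3.
    rewrite -(two f true z sf) -(two _ false z (schwartz_pderiv [:: true; true] sf)).
    exact: h3.
  move: (cmod_ge0 (fourier f z)) H0 H1 H2 H3; rewrite !QE.
  rewrite -[fourier (pderiv [::] f) z]/(fourier f z).
  move: (cmod (fourier f z)) => c c0 H0 H1 H2 H3.
  have px : 0 < 1 + z.1 ^+ 2 by rewrite ltr_pwDl ?sqr_ge0.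
  have py : 0 < 1 + z.2 ^+ 2 by rewrite ltr_pwDl ?sqr_ge0.
  set S := M0 + M1 + M2 + M3.
  have -> : S * (2 / (1 + z.1 ^+ 2) * (2 / (1 + z.2 ^+ 2))) =
    (4 * S) / ((1 + z.1 ^+ 2) * (1 + z.2 ^+ 2)) by field; rewrite !gt_eqF.
  rewrite ler_pdivlMr ?mulr_gt0//.
  have e : c * ((1 + z.1 ^+ 2) * (1 + z.2 ^+ 2)) <= S.
    rewrite (_ : _ * _ = c + z.1 ^+ 2 * c + z.2 ^+ 2 * c +
      z.1 ^+ 2 * (z.2 ^+ 2 * c)); last by ring.
    by rewrite !lerD.
  have : 0 <= S by apply: le_trans e; rewrite !mulr_ge0// ltW.
  by lra.
- exact: (integrableZl measurableT _ integrable_poisson1_prod).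
Qed.

Lemma schwartz_inversion f (z : R * R) : schwartz f ->
  cint leb2 setT (fun p => expi (dot p z) * fourier f p) =
  ((2 * pi) ^+ 2)%:C * f z.
Proof.
move=> sf; have [M hM] := schwartz_bounded sf.
exact: fourier_inversion (schwartz_continuous sf) hM (schwartz_integrable sf)
  (schwartz_fourier_integrable sf).
Qed.

End Schwartz.

(** * Stability of Schwartz functions under Bessel symbols *)

Section SchwartzMultipliers.
Context {R : realType}.
Local Notation C := R[i].
Local Notation dir b := (if b then e_y else e_x).

(** The span of this family is closed under differentiation. Up to a factor i it contains both
    symbols by which test functions are multiplied later: the inverse Bessel symbol (s = -beta/2, j
    = 0) and the symbol of d_x (I - d_x^2)^(beta/2) (s = beta/2, j = 1). *)
Definition bessel_monomial (s : R) (j : nat) (x : R) : R :=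
  (1 + x ^+ 2) `^ s * x ^+ j.

Lemma oneDsqr_gt0 (x : R) : 0 < 1 + x ^+ 2.
Proof. by rewrite ltr_pwDl ?sqr_ge0. Qed.

Lemma is_derive_bessel_monomial (s : R) (j : nat) (x : R) :
  is_derive x 1 (bessel_monomial s j)
    (2 * s * bessel_monomial (s - 1) j.+1 x + j%:R * bessel_monomial s j.-1 x).
Proof.
have dq : is_derive x 1 (fun y : R => 1 + y ^+ 2) (2 * x).
  have h := is_dD (is_dcst x 1) (is_dM (is_did x) (is_did x)).
  by apply: is_derive_eq h _; ring.
have dp := @is_dcomp _ (@powR R ^~ s) (fun y => 1 + y ^+ 2) x _ _
  (is_derive1_powR s (oneDsqr_gt0 x)) dq.
have dX : is_derive x 1 (fun y : R => y ^+ j) (j%:R * x ^+ j.-1).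
  elim: j => [|j IH]; first by rewrite mul0r; exact: is_dcst.
  rewrite (_ : (fun y : R => y ^+ j.+1) = (fun y => y * y ^+ j)); last first.
    by apply/funext => y; rewrite exprS.
  apply: is_derive_eq (is_dM (is_did x) IH) _.
  by case: j {IH} => [|j]; rewrite /= ?exprS -?natr1; ring.
apply: is_derive_eq (is_dM dp dX) _.
by rewrite /bessel_monomial [x ^+ j.+1]exprS; ring.
Qed.

Lemma powR_oneDsqr_le (s x : R) :
  (1 + x ^+ 2) `^ s <= (1 + `|x|) ^+ (2 * Num.bound `|s|).
Proof.
have h1 : 1 <= 1 + x ^+ 2 by rewrite lerDl sqr_ge0.
have sb : s <= (Num.bound `|s|)%:R.
  by rewrite (le_trans (ler_norm s))// ltW// archi_boundP.
rewrite (le_trans (ler_powR h1 sb))// powR_mulrn; last exact: ltW (oneDsqr_gt0 x).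
rewrite exprM lerXn2r ?nnegrE ?exprn_ge0 ?addr_ge0 ?sqr_ge0//.
rewrite -(real_normK (num_real x)); have := normr_ge0 x; nra.
Qed.

Lemma weight_bessel_monomial (s : R) (j k : nat) (p : R * R) :
  weight k p * `|bessel_monomial s j p.1| <= weight (k + (2 * Num.bound `|s| + j)) p.
Proof.
rewrite /weight exprD ler_wpM2l ?exprn_ge0 ?addr_ge0// exprD normrM.
have x0 := normr_ge0 p.1; have y0 := normr_ge0 p.2.
apply: ler_pM => //.
  rewrite ger0_norm ?powR_ge0// (le_trans (powR_oneDsqr_le _ _))//.
  by rewrite lerXn2r ?nnegrE ?addr_ge0// lerDl.
by rewrite normrX lerXn2r ?nnegrE ?addr_ge0//; lra.
Qed.

Variable psi : R * R -> C.
Hypothesis spsi : schwartz psi.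

(* The derivatives of a product [bessel_monomial s j * psi] stay in the span of
   such products with derivatives of [psi]. *)
Inductive bessel_span : (R * R -> C) -> Prop :=
| bessel_span_term (c : C) (s : R) (j : nat) (w : seq bool) :
    bessel_span (fun p => (c * (bessel_monomial s j p.1)%:C) * pderiv w psi p)
| bessel_spanD f g : bessel_span f -> bessel_span g ->
    bessel_span (fun p => f p + g p).

Lemma bessel_span_continuous f : bessel_span f -> ccontinuous f.
Proof.
elim => [c s j w|{}f g _ /ccontinuousP cf _ /ccontinuousP cg].
  apply/ccontinuousP => p; apply: ccvgM; last first.
    exact: (ccontinuousP _).1 (schwartz_continuous (schwartz_pderiv w spsi)) p.
  apply: ccvgM; [exact: ccvg_cst|apply: ccvgR].
  apply: (cvg_comp fst (bessel_monomial s j)); first exact: fst_continuous.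
  exact: is_derive1_continuous (is_derive_bessel_monomial s j p.1).
by apply/ccontinuousP => p; apply: ccvgD.
Qed.

Lemma bessel_span_bounded f k : bessel_span f ->
  exists M : R, forall p, weight k p * cmod (f p) <= M.
Proof.
elim => [c s j w|{}f g _ [M hM] _ [N hN]]; last first.
  exists (M + N) => p; rewrite (le_trans _ (lerD (hM p) (hN p)))//.
  rewrite -mulrDr ler_wpM2l ?cmodD// (le_trans ler01)// weight_ge1 //.
have [M hM] := (schwartz_pderiv w spsi).2 (k + (2 * Num.bound `|s| + j))%N [::].
exists (cmod c * M) => p; rewrite !cmodM cmodR -mulrA mulrCA.
rewrite ler_wpM2l ?cmod_ge0// mulrA (le_trans _ (hM p))//.
by rewrite ler_wpM2r ?cmod_ge0// weight_bessel_monomial.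
Qed.

Lemma bessel_span_derivable f b : bessel_span f ->
  (forall p, cderivable (dir b) f p) /\ bessel_span (cderive (dir b) f).
Proof.
elim => [c s j w|{}f g _ [df bf] _ [dg bg]]; last first.
  have h p : cderivable (dir b) (fun p => f p + g p) p /\
      cderive (dir b) (fun p => f p + g p) p =
      cderive (dir b) f p + cderive (dir b) g p.
    apply: cis_derive_partial.
    exact: cis_dD (cderivableP (df p)) (cderivableP (dg p)).
  split=> [p|]; first by have [] := h p.
  rewrite (_ : cderive _ _ =
    (fun p => cderive (dir b) f p + cderive (dir b) g p)).
    exact: bessel_spanD.
  by apply/funext => p; have [] := h p.
have sw := schwartz_pderiv w spsi.
have dw p := cderivableP (schwartz_derivable b p sw).
pose mu := bessel_monomial.
pose D (p : R * R) : R := (if b then 0 else 2 * s * mu (s - 1) j.+1 p.1 + j%:R * mu s j.-1 p.1).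
have dmu p : cis_derive (slice b (fun p : R * R => c * (mu s j p.1)%:C) p)
    (coord b p) (c * (D p)%:C).
  rewrite /slice /D /coord; case: (b) => /=.
    by rewrite mulr0; exact: cis_dcst.
  apply: cis_derive_eq (cis_dM (cis_dcst _ c)
    (cis_dR (is_derive_bessel_monomial s j p.1))) _.
  by rewrite mul0r add0r.
have h p := @cis_derive_partial _ b
  (fun p => c * (mu s j p.1)%:C * pderiv w psi p) p _ (cis_dM (dmu p) (dw p)).
split=> [p|]; first by have [] := h p.
rewrite (_ : cderive _ _ = (fun p => c * (D p)%:C * pderiv w psi p +
    c * (mu s j p.1)%:C * pderiv (b :: w) psi p)); last first.
  apply/funext => p; have [_ ->] := h p.
  by rewrite /slice /coord; case: (b) => /=; rewrite -surjective_pairing.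
apply: bessel_spanD; last exact: bessel_span_term.
rewrite /D; case: (b).
  (* In the direction y the coefficient is constant; the resulting zero term is given the shape of a
     generator with coefficient 0. *)
  rewrite (_ : (fun p => _) = (fun p => 0 * (mu 0 0%N p.1)%:C * pderiv w psi p)).
    exact: bessel_span_term.
  by apply/funext => p; rewrite mulr0 !mul0r.
rewrite (_ : (fun p => _) = (fun p =>
    c * (2 * s)%:C * (mu (s - 1) j.+1 p.1)%:C * pderiv w psi p +
    c * (j%:R)%:C * (mu s j.-1 p.1)%:C * pderiv w psi p)).
  by apply: bessel_spanD; exact: bessel_span_term.
apply/funext => p; rewrite rmorphD !rmorphM /=; ring.
Qed.

Lemma bessel_span_schwartz f : bessel_span f -> schwartz f.
Proof.
move=> sf; have spw w : bessel_span (pderiv w f).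
  by elim: w => //= b w IH; have [_] := bessel_span_derivable b IH.
split=> [w|k w]; last exact: bessel_span_bounded.
split=> [|b p]; first exact: bessel_span_continuous.
by have [] := bessel_span_derivable b (spw w).
Qed.

Lemma schwartz_bessel_monomial (c : C) (s : R) (j : nat) :
  schwartz (fun p => c * (bessel_monomial s j p.1)%:C * psi p).
Proof. exact: bessel_span_schwartz (bessel_span_term c s j [::]). Qed.

End SchwartzMultipliers.

(** * Fresnel integrals *)

Section Fresnel.
Context {R : realType}.
Local Notation leb := (@lebesgue_measure R).

Lemma integrable_segment (f : R -> R) (a b : R) : continuous f ->
  leb.-integrable `[a, b] (EFin \o f).
Proof.
move=> cf; apply: continuous_compact_integrable; first exact: segment_compact.
exact: continuous_subspaceT.
Qed.

(** Two segment integrals are used because one of them is empty on each side of 0, which yields the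
    oriented integral. Near [x] it differs by a constant from the integral started at -N, a point
    below both 0 and [x]. *)
Lemma continuous_primitive (f : R -> R) : continuous f ->
  exists F : R -> R, forall x : R, is_derive x 1 F (f x).
Proof.
move=> cf.
pose F (x : R) := \int[leb]_(u in `[0, x]) f u - \int[leb]_(u in `[x, 0]) f u.
exists F => x; pose N := `|x| + 1.
have N0 : - N <= 0 by rewrite oppr_le0 addr_ge0.
have xN : - N < x.
  by rewrite ltrNl ltr_pwDr// -normrN ler_norm.
have FE y : - N < y -> F y = \int[leb]_(u in `[- N, y]) f u - \int[leb]_(u in `[- N, 0]) f u.
  move=> Ny; rewrite /F; have [y0|y0] := leP 0 y.
    have h1 : (BLeft (- N) <= BRight 0)%O by rewrite bnd_simp.
    have h2 : (BRight 0 <= BRight y)%O by rewrite bnd_simp.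
    rewrite (Rintegral_itvB (integrable_segment (- N) y cf) h1 h2).
    rewrite Rintegral_itv_obnd_cbnd; last first.
      apply: integrableS (integrable_segment 0 y cf) => //.
      by apply: subset_itvr; rewrite bnd_simp.
    rewrite (_ : \int[leb]_(u in `[y, 0]) f u = 0) ?subr0//.
    move: y0; rewrite le_eqVlt => /predU1P[<-|y0].
      by rewrite set_itv1 Rintegral_set1.
    by rewrite set_itv_ge ?Rintegral_set0// bnd_simp -ltNge.
  have h1 : (BLeft (- N) <= BRight y)%O by rewrite bnd_simp ltW.
  have h2 : (BRight y <= BRight 0)%O by rewrite bnd_simp ltW.
  rewrite -[RHS]opprB (Rintegral_itvB (integrable_segment (- N) 0 cf) h1 h2).
  rewrite Rintegral_itv_obnd_cbnd; last first.
    apply: integrableS (integrable_segment y 0 cf) => //.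
    by apply: subset_itvr; rewrite bnd_simp.
  by rewrite set_itv_ge ?Rintegral_set0 ?sub0r// bnd_simp -ltNge.
have xx1 : x < x + 1 by rewrite ltrDl.
have [d dE] := continuous_FTC1_closed xx1 (integrable_segment (- N) (x + 1) cf)
  xN (cf x).
pose G (y : R) := \int[leb]_(u in `[- N, y]) f u + - \int[leb]_(u in `[- N, 0]) f u.
have dG : is_derive x 1 G (f x).
  have h := is_dD (DeriveDef d (esym (etrans (esym dE) (derive1E _ _))))
    (is_dcst x (- \int[leb]_(u in `[- N, 0]) f u)).
  by apply: is_derive_eq h _; rewrite addr0.
apply: (near_eq_is_derive _ dG).
by near=> y; rewrite FE//; near: y; exact: lt_nbhsr.
Unshelve. all: by end_near. Qed.

Section limit.
Variables (c : R) (F : R -> R).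
Hypothesis dF : forall x : R, is_derive x 1 F (cos (x ^+ 2 + c)).

Let D (x : R) := (2 * x)^-1.

(** Integration by parts as monotonicity. Subtracting sin (x^2 + c) / (2x) from [F] leaves the
    derivative sin (x^2 + c) / (2x^2); the correction s / (2x) turns it into (sin (x^2 + c) - s) /
    (2x^2), of constant sign for s = 1 and for s = -1. So [H (-1)] increases and [H 1] decreases on
    [1, +oo[, while they differ by 1/x. *)
Let H (s x : R) := F x - sin (x ^+ 2 + c) * D x + s * D x.

Let dD' (x : R) : 0 < x -> is_derive x 1 D (- (2 * x ^+ 2)^-1).
Proof.
move=> x0; have x20 : 2 * x != 0 by rewrite mulf_neq0// gt_eqF.
by apply: is_derive_eq (is_dV x20 (is_dlin 2 x)) _; field; rewrite gt_eqF.
Qed.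

Let dphase (x : R) : is_derive x 1 (fun y : R => y ^+ 2 + c) (2 * x).
Proof.
have h := is_dD (is_dM (is_did x) (is_did x)) (is_dcst x c).
by apply: is_derive_eq h _; ring.
Qed.

Let dH (s x : R) : 0 < x ->
  is_derive x 1 (H s) ((sin (x ^+ 2 + c) - s) * (2 * x ^+ 2)^-1).
Proof.
move=> x0.
have ds := @is_dcomp _ sin (fun y => y ^+ 2 + c) x _ _ (is_derive_sin _) (dphase x).
have h := is_dD (is_dD (dF x) (is_dN (is_dM ds (dD' x0)))) (is_dZ s (dD' x0)).
apply: is_derive_eq h _; rewrite /D.
by field; rewrite gt_eqF.
Qed.

Let Hmono (s : R) (e : R) : (forall x, 0 <= e * (sin x - s)) ->
  forall x y, 1 <= x -> x <= y -> e * H s x <= e * H s y.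
Proof.
move=> es; have dd (x : R) : x \in `]1, +oo[ ->
    is_derive x 1 (fun y => e * H s y)
      (e * ((sin (x ^+ 2 + c) - s) * (2 * x ^+ 2)^-1)).
  rewrite in_itv /= andbT => x1; apply: is_dZ; apply: dH; exact: lt_trans x1.
apply: (@ger0_derive1_ndecry _ (fun y => e * H s y)).
- by move=> x /dd h; exact: ex_derive.
- move=> x /dd h; rewrite derive1E derive_val mulrA mulr_ge0//.
  by rewrite invr_ge0 mulr_ge0// sqr_ge0.
- apply: continuous_in_subspaceT => x /set_mem /=; rewrite in_itv /= andbT => x1.
  exact: is_derive1_continuous (is_dZ e (dH s (lt_le_trans ltr01 x1))).
Qed.

Let Hup (x y : R) : 1 <= x -> x <= y -> H (-1) x <= H (-1) y.
Proof.
move=> x1 xy; rewrite -[leLHS]mul1r -[leRHS]mul1r; apply: Hmono x1 xy => u.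
by rewrite mul1r opprK -lerBlDr sub0r sin_geN1.
Qed.

Let Hdown (x y : R) : 1 <= x -> x <= y -> H 1 y <= H 1 x.
Proof.
move=> x1 xy; rewrite -lerN2 -mulN1r -[leRHS]mulN1r; apply: Hmono x1 xy => u.
by rewrite mulN1r opprB subr_ge0 sin_le1.
Qed.

Let D0 x : 1 <= x -> 0 < D x.
Proof. by move=> x1; rewrite invr_gt0 mulr_gt0// (lt_le_trans ltr01). Qed.

Let FD (x y : R) : 1 <= x -> x <= y -> `|F y - F x| <= 4 * D x.
Proof.
move=> x1 xy; have y1 := le_trans x1 xy.
have h1 := Hup x1 xy; have h2 := Hdown x1 xy; rewrite /H in h1 h2.
have Dxy : D y <= D x.
  by rewrite lef_pV2 ?posrE ?mulr_gt0 ?ler_pM2l// (lt_le_trans ltr01).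
have Dx := D0 x1; have Dy := D0 y1.
have sx : `|sin (x ^+ 2 + c) * D x| <= D x.
  by rewrite normrM (gtr0_norm Dx) (ler_piMl (ltW Dx))// ler_norml sin_geN1 sin_le1.
have sy : `|sin (y ^+ 2 + c) * D y| <= D y.
  by rewrite normrM (gtr0_norm Dy) (ler_piMl (ltW Dy))// ler_norml sin_geN1 sin_le1.
move: sx sy h1 h2; rewrite !ler_norml => /andP[a1 a2] /andP[b1 b2] h1 h2.
by apply/andP; split; lra.
Qed.

(** [H (-1)] converges along the integers, being increasing and bounded by [H 1 1], and [F] has the
    same limit since [D] tends to 0. The tail estimate [4 * D x] then extends this limit to real
    arguments. *)
Lemma fresnel_limit : exists l : R,
  F x @[x --> +oo] --> l /\ exists M : R, forall x, 0 <= x -> `|F x| <= M.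
Proof.
have hn (n m : nat) : (n <= m)%N -> 1 <= n.+1%:R :> R /\ n.+1%:R <= m.+1%:R :> R.
  by move=> nm; rewrite ler1n ler_nat.
have cu : cvgn (fun n => H (-1) n.+1%:R).
  apply: nondecreasing_is_cvgn.
    by move=> n m /hn[h1 h2]; exact: Hup.
  exists (H 1 1) => _ [n _ <-].
  have [h1 _] := hn n n (leqnn _).
  apply: le_trans (Hdown (lexx 1) h1); rewrite /H lerD2l; have := D0 h1; lra.
have D_cvg0 : D n.+1%:R @[n --> \oo] --> 0.
  rewrite (_ : (fun n => _) = (fun n => 2^-1 * n.+1%:R^-1)); last first.
    by apply/funext => n; rewrite /D invfM.
  by rewrite -(mulr0 2^-1); apply: cvgMr; exact: cvg_harmonic.
pose l := limn (fun n => H (-1) n.+1%:R).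
have Fl : F n.+1%:R @[n --> \oo] --> l.
  rewrite (_ : (fun n => _) = (fun n => H (-1) n.+1%:R +
    (sin (n.+1%:R ^+ 2 + c) + 1) * D n.+1%:R)); last first.
    by apply/funext => n; rewrite /H; ring.
  rewrite -[l]addr0; apply: cvgD; first exact: cu.
  apply: (@cvg_le0 _ _ (fun n => D n.+1%:R) 2) D_cvg0 => n.
  have [h1 _] := hn n n (leqnn _); have Dn := D0 h1.
  rewrite normrM (gtr0_norm Dn) (ler_wpM2r (ltW Dn))//.
  have := sin_geN1 (n.+1%:R ^+ 2 + c); have := sin_le1 (n.+1%:R ^+ 2 + c).
  by move=> a1 a2; rewrite ler_norml; apply/andP; split; lra.
have bnd x : 1 <= x -> `|l - F x| <= 4 * D x.
  move=> x1; have h : `|F n.+1%:R - F x| @[n --> \oo] --> `|l - F x|.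
    by apply: cvg_norm; apply: cvgB => //; exact: cvg_cst.
  apply: (closed_cvg (fun u => u <= 4 * D x) (@closed_le _ _) _ _ h).
  near=> n; apply: FD => //.
  rewrite (@le_trans _ _ (n%:R)) ?ler_nat//; near: n.
  exact: nbhs_infty_ger.
exists l; split.
  apply/cvgrPdist_le => e e0; near=> x.
  have x1 : 1 <= x by near: x; exact: nbhs_pinfty_ge.
  have xe : 2 / e <= x by near: x; exact: nbhs_pinfty_ge (num_real _).
  have x0 : 0 < x by exact: lt_le_trans x1.
  rewrite (le_trans (bnd x x1))// /D (_ : 4 * _ = 2 / x); last first.
    by field; rewrite gt_eqF.
  by rewrite ler_pdivrMr// mulrC -ler_pdivrMr.
(* On [1, +oo[ the distance from [F] to [l] is at most 4 D(1) = 2; on [0, 1] the mean value theorem,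
   with a derivative bounded by 1, keeps [F] within 1 of [F 0]. The constant covers both. *)
exists (`|F 0| + `|l| + 3) => x x0; have [x1|x1] := leP 1 x.
  have Dx1 : D x <= 2^-1.
    by rewrite lef_pV2 ?posrE ?mulr_gt0// ?ler_peMr// (lt_le_trans ltr01).
  have := bnd x x1; have := ler_normB l (l - F x); rewrite subKr => a b.
  rewrite (le_trans a)// -addrA [leRHS]addrC -addrA lerD2l.
  by rewrite (le_trans b)//; have := normr_ge0 (F 0); lra.
have cF : {within `[0, x], continuous F}.
  by apply: continuous_subspaceT => u; exact: is_derive1_continuous (dF u).
have [u _ e] := MVT_segment x0 (fun u _ => dF u) cF.
have := ler_normD (F x - F 0) (F 0); rewrite subrK e => h.
rewrite (le_trans h)// addrC -addrA lerD2l subr0 normrM.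
have hc : `|cos (u ^+ 2 + c)| <= 1 by rewrite ler_norml cos_geN1 cos_le1.
have hx : `|x| <= 1 by rewrite ger0_norm// ltW.
have := mulr_ile1 (normr_ge0 _) (normr_ge0 _) hc hx; have := normr_ge0 l; lra.
Unshelve. all: by end_near. Qed.

End limit.

End Fresnel.

Section FresnelKernel.
Context {R : realType}.
Local Notation C := R[i].

(** The integrand is even, so [fun y => - F (- y)] is another primitive of it, whose behaviour at
    +oo is, up to sign, that of [F] at -oo. *)
Lemma fresnel_two_sided (c : R) (F : R -> R) :
  (forall x : R, is_derive x 1 F (cos (x ^+ 2 + c))) ->
  exists lp lm M : R, [/\ F x @[x --> +oo] --> lp, F x @[x --> -oo] --> lm &
    forall x, `|F x| <= M].
Proof.
move=> dF; have [lp [Flp [M hM]]] := fresnel_limit dF.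
have dG (x : R) : is_derive x 1 (fun y => - F (- y)) (cos (x ^+ 2 + c)).
  have dN : is_derive x 1 (fun y : R => - y) (-1) by exact: is_dN (is_did x).
  have h := is_dN (is_dcomp (dF (- x)) dN).
  by apply: is_derive_eq h _; rewrite sqrrN mulrN1 opprK.
have [lm [Glm [N hN]]] := fresnel_limit dG.
exists lp, (- lm), (Num.max M N); split => //.
  apply/cvgNy_compNP; rewrite (_ : _ \o _ = (fun x => - - F (- x))).
    exact: cvgN.
  by apply/funext => x /=; rewrite opprK.
move=> x; rewrite le_max; have [x0|x0] := leP 0 x; first by rewrite hM.
apply/orP; right; have := hN (- x); rewrite opprK normrN; apply.
by rewrite oppr_ge0 ltW.
Qed.

Definition sgn (k : R) : R := k / `|k|.

Lemma sgnP (k : R) : k != 0 -> (sgn k = 1 /\ `|k| = k) \/ (sgn k = -1 /\ `|k| = - k).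
Proof.
move=> k0; rewrite /sgn; have [kp|kn] := leP 0 k.
  by left; rewrite ger0_norm// divff.
by right; rewrite ltr0_norm// invrN mulrN divff.
Qed.

Lemma cint_ftc (F f : R -> C) (a b : R) : a <= b ->
  (forall x, cis_derive F x (f x)) -> ccontinuous f ->
  cint leb1 `[a, b] f = F b - F a.
Proof.
move=> ab dF [c1 c2]; apply: complex_eq.
  rewrite ReD ReN -[RHS]/(re F b - re F a).
  by rewrite -(Rftc_itv ab (fun x => (dF x).1) c1).
rewrite ImD ImN -[RHS]/(im F b - im F a).
by rewrite -(Rftc_itv ab (fun x => (dF x).2) c2).
Qed.

Lemma ccvg_near_eq {T : Type} (F : set_system T) {FF : Filter F} (f g : T -> C)
    (l : C) : (\forall x \near F, f x = g x) -> ccvg F g l -> ccvg F f l.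
Proof.
move=> fg [h1 h2]; split.
  by apply: cvg_trans h1; apply: near_eq_cvg; apply: filterS fg => x; rewrite /re => ->.
by apply: cvg_trans h2; apply: near_eq_cvg; apply: filterS fg => x; rewrite /im => ->.
Qed.

Lemma derivative_is_improper_integral (F f : R -> C) (l l' : C) :
  (forall x, cis_derive F x (f x)) -> ccontinuous f ->
  ccvg +oo F l -> ccvg -oo F l' -> is_improper_integral f (l - l').
Proof.
move=> dF cf [l1 l2] [l1' l2']; split=> //.
apply: (@ccvg_near_eq _ _ _ _ (fun r : R * R => F r.1 + (-1) * F (- r.2))).
  exists ([set x | 0 <= x], [set x | 0 <= x]) => /=.
    by split; exact: nbhs_pinfty_ge (num_real _).
  move=> [r s] /= [r0 s0]; rewrite /segint /= mulN1r; apply: cint_ftc => //.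
  by rewrite (le_trans _ r0)// oppr_le0.
have h1 : ccvg (filter_prod +oo +oo) (fun r : R * R => F r.1) l.
  by split; [exact: cvg_comp cvg_fst l1|exact: cvg_comp cvg_fst l2].
have hN : - r.2 @[r --> filter_prod (+oo : set_system R) (+oo : set_system R)] --> (-oo : set_system R).
  by apply: cvg_comp cvg_snd _; exact/cvgNrNy.
have h2 : ccvg (filter_prod +oo +oo) (fun r : R * R => F (- r.2)) l'.
  by split; [exact: cvg_comp hN l1'|exact: cvg_comp hN l2'].
rewrite (_ : l - l' = l + (-1) * l'); last by rewrite mulN1r.
have FF : Filter (filter_prod (+oo : set_system R) (+oo : set_system R)).
  exact: filter_prod_filter.
exact: ccvgD h1 (ccvgM (ccvg_cst (-1)) h2).
Qed.

(* [Jr +i* Ji] and its conjugate are the Fresnel integrals over the line of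
   [expi (- u ^+ 2)] and [expi (u ^+ 2)]; their value is irrelevant. *)
Definition fresnel_profile (Jr Ji M : R) : Prop :=
  forall (c : C) (k h : R), k != 0 ->
  let s := Num.sqrt `|k| in
  let f := (fun eta : R => c * expi (- (k * (eta - h) ^+ 2))) in
  (forall a b, a <= b -> cmod (cint leb1 `[a, b] f) <= M * (cmod c * s^-1)) /\
  ccvg (filter_prod +oo +oo) (segint f) (c * (s^-1)%:C * (Jr +i* (sgn k * Ji))).

(** The substitution u = s (eta - h) with s = sqrt |k| reduces every phase to -(sgn k) u^2, hence to
    primitives of cos (u^2) and of sin (u^2) = cos (u^2 - pi/2): this is why the preceding analysis
    carries a phase shift. The factor 2 in the bound reflects that a segment integral is a
    difference of two values of a primitive. *)
Lemma fresnel_constants : exists Jr Ji M : R, fresnel_profile Jr Ji M.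
Proof.
have cq (d : R) : continuous (fun x : R => cos (x ^+ 2 + d)).
  have dphase (x : R) : is_derive x 1 (fun y : R => y ^+ 2 + d) (2 * x).
    have h := is_dD (is_dM (is_did x) (is_did x)) (is_dcst x d).
    by apply: is_derive_eq h _; ring.
  move=> x; exact: is_derive1_continuous (@is_dcomp _ cos (fun y => y ^+ 2 + d)
    x _ _ (is_derive_cos _) (dphase x)).
have [Fc dFc] := continuous_primitive (cq 0).
have [Fs dFs] := continuous_primitive (cq (- (pi / 2))).
have [cp [cm [Mc [hcp hcm hMc]]]] := fresnel_two_sided dFc.
have [sp [sm [Ms [hsp hsm hMs]]]] := fresnel_two_sided dFs.
exists (cp - cm), (- (sp - sm)), (2 * (Mc + Ms)) => c k h k0 s f.
have s0 : 0 < s by rewrite sqrtr_gt0 normr_gt0.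
have s2 : s ^+ 2 = `|k| by rewrite sqr_sqrtr.
(* A primitive of expi (- sgn k u^2): changing the sign of [k] conjugates the integrand and so
   affects only the sine part. *)
pose W (u : R) : C := Fc u +i* (- sgn k * Fs u).
have dW (u : R) : cis_derive W u (expi (- (sgn k * u ^+ 2))).
  split.
    apply: is_derive_eq (dFc u) _; rewrite addr0 /= cosN.
    by have [[-> _]|[-> _]] := sgnP k0; rewrite ?mul1r ?mulN1r ?cosN.
  apply: is_derive_eq (is_dZ (- sgn k) (dFs u)) _; rewrite cosBpihalf /= sinN.
  by have [[-> _]|[-> _]] := sgnP k0; rewrite ?mul1r ?mulN1r ?sinN ?opprK ?mul1r.
pose V (eta : R) := c * (s^-1)%:C * W (s * (eta - h)).
have dl (eta : R) : is_derive eta 1 (fun y : R => s * (y - h)) s.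
  have e := is_dZ s (is_dD (is_did eta) (is_dcst eta (- h))).
  by apply: is_derive_eq e _; rewrite addr0 mulr1.
have dV (eta : R) : cis_derive V eta (f eta).
  have dW' : cis_derive (fun y => W (s * (y - h))) eta
      (s%:C * expi (- (k * (eta - h) ^+ 2))).
    have [d1 d2] := dW (s * (eta - h)).
    have e : sgn k * (s * (eta - h)) ^+ 2 = k * (eta - h) ^+ 2.
      rewrite exprMn s2 mulrA; congr (_ * _).
      by have [[-> ->]|[-> ->]] := sgnP k0; rewrite ?mul1r ?mulN1r ?opprK.
    rewrite e in d1 d2; split.
      have h1 := @is_dcomp _ (re W) (fun y => s * (y - h)) eta _ _ d1 (dl eta).
      by apply: (is_derive_eq h1); rewrite ReZ mulrC.
    have h2 := @is_dcomp _ (im W) (fun y => s * (y - h)) eta _ _ d2 (dl eta).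
    by apply: (is_derive_eq h2); rewrite ImZ mulrC.
  apply: cis_derive_eq (cis_dM (cis_dcst eta (c * (s^-1)%:C)) dW') _.
  rewrite mul0r add0r /f mulrA; congr (_ * _); rewrite -mulrA -rmorphM /=.
  by rewrite mulVf ?mulr1// gt_eqF.
have cf : ccontinuous f.
  have dq (x : R) : is_derive x 1 (fun y : R => - (k * (y - h) ^+ 2))
      (- (k * (2 * (x - h)))).
    have d := is_dD (is_did x) (is_dcst x (- h)).
    by apply: is_derive_eq (is_dN (is_dZ k (is_dM d d))) _; ring.
  apply/ccontinuousP => x.
  exact: cis_derive_continuous (cis_dM (cis_dcst x c) (cis_dexpi (dq x))).
have WM u : cmod (W u) <= Mc + Ms.
  rewrite (le_trans (cmod_le _))//= lerD// normrM normrN.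
  by have [[-> _]|[-> _]] := sgnP k0; rewrite ?normrN normr1 mul1r.
have VM eta : cmod (V eta) <= cmod c * s^-1 * (Mc + Ms).
  rewrite !cmodM cmodR gtr0_norm ?invr_gt0//.
  by rewrite ler_wpM2l// mulr_ge0 ?cmod_ge0// invr_ge0 ltW.
split=> [a b ab|].
  rewrite (cint_ftc ab dV cf) (le_trans (cmodD _ _))// cmodN.
  by have := VM a; have := VM b; lra.
have l1 : s * (x - h) @[x --> +oo] --> +oo.
  apply/cvgryPge => A; exists (A / s + h); split; first exact: num_real.
  by move=> x /ltW; rewrite -lerBrDr ler_pdivrMr// mulrC.
have l2 : s * (x - h) @[x --> -oo] --> -oo.
  apply/cvgrNyPle => A; exists (A / s + h); split; first exact: num_real.
  by move=> x /ltW; rewrite -lerBlDr ler_pdivlMr// mulrC.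
have Vp : ccvg +oo V (c * (s^-1)%:C * (cp +i* (- sgn k * sp))).
  apply: ccvgM; first exact: ccvg_cst.
  by split; [exact: cvg_comp l1 hcp|exact: cvg_comp l1 (cvgMr hsp)].
have Vm : ccvg -oo V (c * (s^-1)%:C * (cm +i* (- sgn k * sm))).
  apply: ccvgM; first exact: ccvg_cst.
  by split; [exact: cvg_comp l2 hcm|exact: cvg_comp l2 (cvgMr hsm)].
have [_] := derivative_is_improper_integral dV cf Vp Vm.
rewrite -mulrBr; congr (ccvg _ _ (_ * _)); apply: complex_eq => /=; ring.
Qed.

End FresnelKernel.

(** * Oscillatory kernels *)

Section OscillatoryKernel.
Context {R : realType}.
Local Notation C := R[i].
Local Notation mR := (measurableTypeR R).

Lemma cint_indic {d : measure_display} {T : measurableType d}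
    (mu : {measure set T -> \bar R}) (D : set T) (f : T -> C) :
  cint mu D f = cint mu setT (fun x => (\1_D x)%:C * f x).
Proof.
rewrite /cint Rintegral_mkcond [X in _ +i* X]Rintegral_mkcond.
apply: complex_eq => /=; apply: eq_Rintegral => x _.
  by rewrite patchE /re ReZ indicE; case: ifP; rewrite ?mul1r ?mul0r.
by rewrite patchE /im ImZ indicE; case: ifP; rewrite ?mul1r ?mul0r.
Qed.

Variables (alpha t : R).
Hypothesis t0 : t != 0.

(** The phase of [kp_symbol] is -(speed xi * xi + curvature xi * eta^2). Thus [curvature] is the
    Fresnel parameter, and [dual_phase] is the function b(xi) multiplying y^2 once the square is
    completed. *)
Definition speed (xi : R) : R := t / (1 + `|xi| `^ alpha).
Definition curvature (xi : R) : R := speed xi / xi.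
Definition dual_phase (xi : R) : R := (4 * curvature xi)^-1.

Lemma speed_neq0 xi : speed xi != 0.
Proof. by rewrite mulf_neq0// invr_eq0 gt_eqF// ltr_pwDl// powR_ge0. Qed.

Lemma curvature_neq0 xi : xi != 0 -> curvature xi != 0.
Proof. by move=> x0; rewrite mulf_neq0 ?speed_neq0// invr_eq0. Qed.

Lemma measurable_speed : measurable_fun setT (speed : mR -> R).
Proof.
apply: measurable_funM => //; apply: measurable_funV.
apply: measurable_funD => //.
exact: (measurableT_comp (measurable_powR alpha) (@normr_measurable R setT)).
Qed.

Lemma measurable_curvature : measurable_fun setT (curvature : mR -> R).
Proof.
by apply: measurable_funM; [exact: measurable_speed|exact: measurable_funV].
Qed.

Lemma measurable_dual_phase : measurable_fun setT (dual_phase : mR -> R).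
Proof.
by apply: measurable_funV; apply: measurable_funM => //; exact: measurable_curvature.
Qed.

Lemma measurable_kp_symbol :
  cmeasurable (kp_symbol alpha t : (mR * mR)%type -> C).
Proof.
have m1 := measurable_fst : measurable_fun [set: mR * mR] _.
have m2 := measurable_snd : measurable_fun [set: mR * mR] _.
apply: cmeasurable_expi; apply: measurable_funN; apply: measurable_funM.
  exact: (measurableT_comp measurable_speed m1).
apply: measurable_funD => //; apply: measurable_funM.
  exact: measurable_funX.
exact: measurable_funV.
Qed.

Definition osc_kernel (a : R -> C) (b : R -> R) (p : R * R) : C :=
  cint leb1 setT (fun xi => a xi * expi (p.1 * xi + p.2 ^+ 2 * b xi)).

Variables (Jr Ji M : R).
Hypothesis HJ : fresnel_profile Jr Ji M.

(** What the eta-integration yields apart from the unimodular factor depending on the point: the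
    Fresnel integral contributes the scale |curvature|^(-1/2) and the constant [Jr +i* Ji], or its
    conjugate when the curvature is negative. *)
Definition amplitude (m : R -> C) (xi : R) : C :=
  m xi * expi (- (speed xi * xi)) * ((Num.sqrt `|curvature xi|)^-1)%:C *
  (Jr +i* (sgn (curvature xi) * Ji)).

Lemma cmod_amplitude (m : R -> C) (xi : R) : cmod (amplitude m xi) <=
  cmod (m xi) * (Num.sqrt `|curvature xi|)^-1 * (`|Jr| + `|Ji|).
Proof.
rewrite !cmodM cmod_expi mulr1 cmodR ger0_norm ?invr_ge0 ?sqrtr_ge0//.
rewrite ler_wpM2l ?mulr_ge0 ?cmod_ge0 ?invr_ge0 ?sqrtr_ge0//.
rewrite (le_trans (cmod_le _))//= lerD2l normrM.
rewrite ler_piMl// /sgn normrM normfV normr_id.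
by have [->|k0] := eqVneq (curvature xi) 0; rewrite ?normr0 ?mul0r// divff// normr_eq0.
Qed.

Lemma measurable_amplitude (m : R -> C) : cmeasurable (m : mR -> C) ->
  cmeasurable (amplitude m : mR -> C).
Proof.
move=> mm; have mk := measurable_curvature.
have mnk : measurable_fun [set: mR] (fun xi : mR => `|curvature xi|).
  exact: (measurableT_comp (@normr_measurable R setT) mk).
have ms : measurable_fun setT (@Num.sqrt R).
  exact: continuous_measurable_fun (@sqrt_continuous R).
apply: cmeasurableM; last first.
  apply: cmeasurable_pair; first exact: measurable_cst.
  apply: measurable_funM => //; apply: measurable_funM => //.
  exact: measurable_funV.
apply: cmeasurableM; last first.
  by apply: cmeasurableR; apply: measurable_funV; exact: (measurableT_comp ms mnk).
apply: cmeasurableM => //; apply: cmeasurable_expi; apply: measurable_funN.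
by apply: measurable_funM => //; exact: measurable_speed.
Qed.

(* Completing the square in [eta]. *)
Lemma osc_integrandE (m : R -> C) (p : R * R) (xi eta : R) : xi != 0 ->
  m xi * kp_symbol alpha t (xi, eta) * expi (p.1 * xi + p.2 * eta) =
  m xi * expi (- (speed xi * xi) + (p.1 * xi + p.2 ^+ 2 * dual_phase xi)) *
  expi (- (curvature xi * (eta - p.2 / (2 * curvature xi)) ^+ 2)).
Proof.
move=> x0; rewrite -[LHS]mulrA -[RHS]mulrA; congr (_ * _).
rewrite /kp_symbol /= -!expiD.
congr expi; have k0 := curvature_neq0 x0.
rewrite -/(speed xi) /dual_phase; have -> : speed xi = curvature xi * xi.
  by rewrite /curvature divfK.
move: (curvature xi) k0 => k k0.
by field; rewrite x0 k0.
Qed.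

(** The bound depends neither on [p] nor on the segment; it is what later dominates the truncated
    integrals as functions of [p]. *)
Lemma osc_inner (m : R -> C) (p : R * R) (xi : R) : xi != 0 ->
  let f := (fun eta => m xi * kp_symbol alpha t (xi, eta) *
    expi (p.1 * xi + p.2 * eta)) in
  (forall a b, a <= b -> cmod (cint leb1 `[a, b] f) <=
    M * (cmod (m xi) * (Num.sqrt `|curvature xi|)^-1)) /\
  ccvg (filter_prod +oo +oo) (segint f)
    (amplitude m xi * expi (p.1 * xi + p.2 ^+ 2 * dual_phase xi)).
Proof.
move=> x0 f.
have fE : f = (fun eta =>
    m xi * expi (- (speed xi * xi) + (p.1 * xi + p.2 ^+ 2 * dual_phase xi)) *
    expi (- (curvature xi * (eta - p.2 / (2 * curvature xi)) ^+ 2))).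
  by apply/funext => eta; exact: osc_integrandE.
have [h1 h2] := HJ (m xi * expi (- (speed xi * xi) + (p.1 * xi + p.2 ^+ 2 * dual_phase xi)))
  (p.2 / (2 * curvature xi)) (curvature_neq0 x0).
rewrite fE; split=> [a b ab|].
  by have := h1 a b ab; rewrite cmodM cmod_expi mulr1.
have -> : amplitude m xi * expi (p.1 * xi + p.2 ^+ 2 * dual_phase xi) =
   m xi * expi (- (speed xi * xi) + (p.1 * xi + p.2 ^+ 2 * dual_phase xi)) *
   ((Num.sqrt `|curvature xi|)^-1)%:C * (Jr +i* (sgn (curvature xi) * Ji)).
  by rewrite /amplitude (expiD (- (speed xi * xi))); ring.
exact: h2.
Qed.

Let Q := poisson (1 : R).
Let Q0 (x : R) : 0 <= Q x. Proof. exact: poisson_ge0. Qed.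
Let iQ : sleb1.-integrable setT (EFin \o Q). Proof. exact: integrable_poisson. Qed.

Section core.
Variables (m : R -> C) (chi : R * R -> C) (B : R) (q : R * R).
Hypothesis mm : cmeasurable (m : mR -> C).
Hypothesis m00 : m 0 = 0.
Hypothesis ia : cintegrable leb1 setT (amplitude m).
Hypothesis schi : schwartz chi.
Hypothesis mchiB : forall z, cmod (m z.1 * chi z) <= B * (Q z.1 * Q z.2).

(** The factor with [q] is the Fourier side of a translation of the kernel. Decay is assumed for the
    product of [m] and [chi], since [m] itself may behave like 1/xi near the axis; [m 0 = 0] makes
    the slice xi = 0, outside the reach of Fresnel integrals, trivial. *)
Let G (z : R * R) : C :=
  m z.1 * kp_symbol alpha t z * expi (- dot q z) * chi z.

Let mchi := ccontinuous_measurable_plane (schwartz_continuous schi).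
Let ifc := schwartz_fourier_integrable schi.
Let mfc := cintegrable_meas ifc.

Let mG : cmeasurable (G : (mR * mR)%type -> C).
Proof.
have m1 := measurable_fst : measurable_fun [set: mR * mR] _.
apply: cmeasurableM => //; apply: cmeasurableM; last first.
  apply: cmeasurable_expi; apply: measurable_funN; apply: measurable_dot.
    exact: measurable_cst.
  exact: measurable_id.
by apply: cmeasurableM; [exact: (cmeasurable_comp mm m1)|exact: measurable_kp_symbol].
Qed.

Let GB z : cmod (G z) <= B * (Q z.1 * Q z.2).
Proof.
have := mchiB z; rewrite /G !cmodM !cmod_expi !mulr1; exact.
Qed.

Let B0 : 0 <= B.
Proof.
have := mchiB (0, 0); rewrite m00 mul0r cmod0 pmulr_lge0//.
by rewrite /Q /poisson expr0n addr0 expr1n divr1 mulr1 mulr_gt0.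
Qed.

(** Both sides are limits of the pairings [In n] in which eta is restricted to [-n, n], up to the
    common normalization. The Fresnel constants, hidden in [amplitude], are matched in this way with
    an expression free of them. *)
Let core_slice (xi : R) :
  amplitude m xi * cint leb2 setT (fun p =>
    expi ((p - q).1 * xi + (p - q).2 ^+ 2 * dual_phase xi) * fourier chi p) =
  ((2 * pi) ^+ 2)%:C * cint leb1 setT (fun eta => G (xi, eta)).
Proof.
have mph : cmeasurable ((fun p => expi ((p - q).1 * xi +
    (p - q).2 ^+ 2 * dual_phase xi)) : (mR * mR)%type -> C).
  have m1 := measurable_fst : measurable_fun [set: mR * mR] _.
  have m2 := measurable_snd : measurable_fun [set: mR * mR] _.
  apply: cmeasurable_expi; apply: measurable_funD; apply: measurable_funM => //.
    by apply: measurable_funB.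
  by apply: measurable_funX; apply: measurable_funB.
rewrite -cintZ; last first.
  apply: (@cintegrableM_bounded _ _ _ leb2 _ _ 1) => // p.
  by rewrite cmod_expi.
have [->|x0] := eqVneq xi 0.
  rewrite (_ : cint leb2 _ _ = 0); last first.
    rewrite -[RHS](@cint0 _ _ _ leb2); apply: eq_cint => p.
    by rewrite /amplitude m00 !mul0r.
  rewrite (_ : cint leb1 _ _ = 0) ?mulr0//.
  rewrite -[RHS](@cint0 _ _ _ leb1); apply: eq_cint => p.
  by rewrite /G /= m00 !mul0r.
pose ind (n : nat) (eta : R) : R := \1_(`[- n%:R, n%:R] : set R) eta.
have ind1 n eta : 0 <= ind n eta <= 1.
  by rewrite /ind indicE; case: (_ \in _); rewrite lexx ler01.
have mind n : measurable_fun setT (ind n : mR -> R).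
  by apply: measurable_indic; exact: measurable_itv.
have iind n : leb1.-integrable setT (EFin \o ind n).
  exact: integrable_indic_itv.
pose f (p : R * R) (eta : R) := m xi * kp_symbol alpha t (xi, eta) *
  expi (p.1 * xi + p.2 * eta).
pose F (n : nat) (w : (R * R) * R) : C :=
  fourier chi w.1 * ((ind n w.2)%:C * f (w.1 - q) w.2).
have segE n p : cint leb1 setT (fun eta => F n (p, eta)) =
    fourier chi p * segint (f (p - q)) (n%:R, n%:R).
  rewrite /segint [in RHS]cint_indic -cintZ//.
  apply: (@cintegrable_le _ _ _ leb1 _ (fun eta => cmod (m xi) * ind n eta)).
  - apply: cmeasurableM; first by apply: cmeasurableR; exact: mind.
    apply: cmeasurableM.
      apply: cmeasurableM; first exact: cmeasurable_cst.
      exact: (cmeasurable_comp measurable_kp_symbol (pair1_measurable xi)).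
    apply: cmeasurable_expi; apply: measurable_funD; first exact: measurable_cst.
    by apply: measurable_funM => //; exact: measurable_cst.
  - move=> eta; rewrite !cmodM !cmod_expi !mulr1 cmodR mulrC ger0_norm//.
  - exact: (integrableZl measurableT (cmod (m xi)) (iind n)).
have mF n : cmeasurable (F n : ((mR * mR) * mR)%type -> C).
  have n1 : measurable_fun [set: (mR * mR) * mR] fst by exact: measurable_fst.
  have n2 : measurable_fun [set: (mR * mR) * mR] snd by exact: measurable_snd.
  have n11 := measurableT_comp measurable_fst n1.
  have n12 := measurableT_comp measurable_snd n1.
  apply: cmeasurableM; first exact: (cmeasurable_comp mfc n1).
  apply: cmeasurableM; first by apply: cmeasurableR; exact: (measurableT_comp (mind n) n2).
  apply: cmeasurableM.
    apply: cmeasurableM; first exact: cmeasurable_cst.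
    apply: (cmeasurable_comp measurable_kp_symbol).
    by apply/measurable_fun_pair => //; exact: measurable_cst.
  apply: cmeasurable_expi; apply: measurable_funD; apply: measurable_funM => //.
    exact: measurable_funB.
  exact: measurable_funB.
have FB n p eta : cmod (F n (p, eta)) <=
    cmod (fourier chi p) * (cmod (m xi) * ind n eta).
  rewrite !cmodM !cmod_expi !mulr1 cmodR ler_wpM2l ?cmod_ge0// mulrC ger0_norm//.
have h0 n eta : 0 <= cmod (m xi) * ind n eta.
  by rewrite mulr_ge0 ?cmod_ge0//; case/andP : (ind1 n eta).
have ih n : sleb1.-integrable setT (EFin \o (fun eta => cmod (m xi) * ind n eta)).
  exact: (integrableZl measurableT (cmod (m xi)) (iind n)).
have fc0 p := cmod_ge0 (fourier chi p).
have ifc' := cintegrable_cmod ifc.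
pose In n := cint leb2 setT (fun p => fourier chi p * segint (f (p - q)) (n%:R, n%:R)).
have InE n : In n = cint leb1 setT (fun eta =>
    (ind n eta)%:C * (((2 * pi) ^+ 2)%:C * G (xi, eta))).
  transitivity (cint sleb2 setT (fun p => cint sleb1 setT (fun eta => F n (p, eta)))).
    by apply: eq_cint => p; rewrite segE.
  rewrite (@cfubini _ _ _ _ _ sleb2 sleb1 _ _ fc0 (h0 n) ifc' (ih n) _ (mF n) (FB n)).
  apply: eq_cint => eta; pose z := (xi, eta).
  transitivity (cint leb2 setT (fun p => ((ind n eta)%:C *
     (m xi * kp_symbol alpha t z * expi (- dot q z))) *
     (expi (dot p z) * fourier chi p))).
    apply: eq_cint => p; rewrite /F /f /=.
    have -> : (p.1 - q.1) * xi + (p.2 - q.2) * eta = - dot q z + dot p z.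
      by rewrite /dot /=; ring.
    by rewrite expiD; ring.
  rewrite cintZ; last first.
    apply: (@cintegrableM_bounded _ _ _ leb2 _ _ 1) => //.
      apply: cmeasurable_expi; apply: measurable_dot => //; exact: measurable_cst.
    by move=> p; rewrite cmod_expi.
  by rewrite schwartz_inversion// /G /=; ring.
(* With the eta-integral kept inside, it converges for each [p] to its Fresnel value, and the
   uniform bound times [fourier chi] dominates. *)
have lim1 : ccvg \oo In (cint leb2 setT (fun p => amplitude m xi *
    (expi ((p - q).1 * xi + (p - q).2 ^+ 2 * dual_phase xi) * fourier chi p))).
  apply: (@cdct _ _ _ leb2 _ _ _ _ _ (fun p => cmod (fourier chi p) *
     (M * (cmod (m xi) * (Num.sqrt `|curvature xi|)^-1)))).
  - exact: cg_eventually.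
  - move=> n; have := cintegrable_meas (@cintegrable_fubini1 _ _ _ _ _ sleb2 sleb1 _ _
      fc0 (h0 n) ifc' (ih n) _ (mF n) (FB n)).
    by rewrite (_ : (fun p => _) = (fun p => fourier chi p * segint (f (p - q)) (n%:R, n%:R)));
      last by apply/funext => p; exact: segE.
  - move=> n p; rewrite cmodM ler_wpM2l ?cmod_ge0//.
    by apply: (osc_inner m (p - q) x0).1; rewrite (@le_trans _ _ 0)// oppr_le0.
  - exact: (integrableZr measurableT _ ifc').
  - move=> p; rewrite mulrA mulrC; apply: ccvgM; first exact: ccvg_cst.
    have [_ [g1 g2]] := osc_inner m (p - q) x0.
    have nn : (n%:R, n%:R) @[n --> \oo] --> filter_prod (+oo : set_system R) (+oo : set_system R).
      move=> A [[P1 P2] [/= h1 h2] PA].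
      have k1 : \forall n \near \oo, P1 (n%:R : R) by exact: (@cvgr_idn R _ h1).
      have k2 : \forall n \near \oo, P2 (n%:R : R) by exact: (@cvgr_idn R _ h2).
      have [N1 _ k1'] := k1; have [N2 _ k2'] := k2.
      exists (maxn N1 N2) => // n; rewrite /= geq_max => /andP[n1 n2].
      by apply: PA; split; [exact: k1'|exact: k2'].
    by split; [exact: (cvg_comp _ _ nn g1)|exact: (cvg_comp _ _ nn g2)].
have iG : cintegrable leb1 setT (fun eta => G (xi, eta)).
  apply: (@cintegrable_le _ _ _ leb1 _ (fun eta => B * Q xi * Q eta)).
  - exact: (cmeasurable_comp mG (pair1_measurable xi)).
  - by move=> eta; rewrite (le_trans (GB _))// mulrA.
  - exact: (integrableZl measurableT (B * Q xi) iQ).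
(* With the eta-integral outside, inversion has replaced the transform by [chi], so that the
   integrand decays in eta and the cutoff is removed by dominated convergence. *)
have lim2 : ccvg \oo In (cint leb1 setT (fun eta => ((2 * pi) ^+ 2)%:C * G (xi, eta))).
  rewrite (funext InE).
  have iG' := cintegrableZ ((2 * pi) ^+ 2)%:C iG.
  apply: (@cdct _ _ _ leb1 _ _ _ _ _ (fun eta => cmod (((2 * pi) ^+ 2)%:C * G (xi, eta)))).
  - exact: cg_eventually.
  - move=> n; apply: cmeasurableM; last exact: cintegrable_meas iG'.
    by apply: cmeasurableR; exact: mind.
  - move=> n eta; case/andP : (ind1 n eta) => i0 i1.
    by rewrite [leLHS]cmodM cmodR ger0_norm// ler_piMl ?cmod_ge0.
  - exact: cintegrable_cmod iG'.
  - move=> eta; rewrite -[X in ccvg _ _ X]mul1r; apply: ccvgM; last exact: ccvg_cst.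
    rewrite -[1]/(1%:C); apply: ccvgR; apply: (@cvg_near_cst _ _ _ _ _ _).
    near=> n; rewrite /ind indicE mem_set//= in_itv /= -ler_norml.
    by near: n; exact: nbhs_infty_ger.
by rewrite (ccvg_unique lim1 lim2) cintZ.
Unshelve. all: by end_near. Qed.

(** The slice identity is integrated over xi. Fubini is justified on the kernel side by the
    integrability of the amplitude and of [fourier chi], and on the symbol side by the decay of
    [G]. *)
Lemma osc_kernel_fourier :
  cint leb2 setT (fun p => osc_kernel (amplitude m) dual_phase (p - q) * fourier chi p) =
  ((2 * pi) ^+ 2)%:C * cint leb2 setT G.
Proof.
pose F (w : (R * R) * R) : C := fourier chi w.1 * (amplitude m w.2 *
  expi ((w.1 - q).1 * w.2 + (w.1 - q).2 ^+ 2 * dual_phase w.2)).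
have mF : cmeasurable (F : ((mR * mR) * mR)%type -> C).
  have n1 : measurable_fun [set: (mR * mR) * mR] fst by exact: measurable_fst.
  have n2 : measurable_fun [set: (mR * mR) * mR] snd by exact: measurable_snd.
  have n11 := measurableT_comp measurable_fst n1.
  have n12 := measurableT_comp measurable_snd n1.
  apply: cmeasurableM; first exact: (cmeasurable_comp mfc n1).
  apply: cmeasurableM; first exact: (cmeasurable_comp (measurable_amplitude mm) n2).
  apply: cmeasurable_expi; apply: measurable_funD; apply: measurable_funM => //.
  - exact: measurable_funB.
  - by apply: measurable_funX; exact: measurable_funB.
  - exact: (measurableT_comp measurable_dual_phase n2).
have FB p xi : cmod (F (p, xi)) <= cmod (fourier chi p) * cmod (amplitude m xi).
  by rewrite (cmodM (fourier chi p)) (cmodM (amplitude m xi)) cmod_expi mulr1.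
have fc0 p := cmod_ge0 (fourier chi p).
have a0 xi := cmod_ge0 (amplitude m xi).
transitivity (cint sleb2 setT (fun p => cint sleb1 setT (fun xi => F (p, xi)))).
  apply: eq_cint => p; rewrite mulrC /osc_kernel -cintZ//.
  apply: (@cintegrable_le _ _ _ leb1 _ (fun xi => cmod (amplitude m xi))).
  - apply: cmeasurableM; first exact: measurable_amplitude.
    apply: cmeasurable_expi; apply: measurable_funD; apply: measurable_funM => //.
    exact: measurable_dual_phase.
  - by move=> xi; rewrite (cmodM (amplitude m xi)) cmod_expi mulr1.
  - exact: cintegrable_cmod.
rewrite (@cfubini _ _ _ _ _ sleb2 sleb1 _ _ fc0 a0 (cintegrable_cmod ifc)
  (cintegrable_cmod ia) _ mF FB).
have BQ0 x : 0 <= B * Q x by exact: mulr_ge0 B0 (Q0 x).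
have iBQ : sleb1.-integrable setT (EFin \o (fun x => B * Q x)).
  exact: (integrableZl measurableT B iQ).
have GB' x y : cmod (G (x, y)) <= B * Q x * Q y.
  by rewrite (le_trans (GB _))// mulrA.
have iG := @cintegrable_fubini1 _ _ _ _ _ sleb1 sleb1 _ _ BQ0 Q0 iBQ iQ G mG GB'.
transitivity (((2 * pi) ^+ 2)%:C *
    cint sleb1 setT (fun xi => cint sleb1 setT (fun eta => G (xi, eta)))).
  rewrite -cintZ//; apply: eq_cint => xi; rewrite -core_slice -cintZ; last first.
    apply: (@cintegrableM_bounded _ _ _ leb2 _ _ 1) => //.
      have m1 := measurable_fst : measurable_fun [set: mR * mR] _.
      have m2 := measurable_snd : measurable_fun [set: mR * mR] _.
      apply: cmeasurable_expi; apply: measurable_funD; apply: measurable_funM => //.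
        by apply: measurable_funB.
      by apply: measurable_funX; apply: measurable_funB.
    by move=> p; rewrite cmod_expi.
  by apply: eq_cint => p; rewrite /F /=; ring.
by rewrite (@cfubini12 _ _ _ _ _ sleb1 sleb1 _ _ BQ0 Q0 iBQ iQ G mG GB').
Qed.

End core.

End OscillatoryKernel.

(** * The Riemann-Lebesgue lemma *)

Section RiemannLebesgue.
Context {R : realType}.
Local Notation mR := (measurableTypeR R).
Local Notation leb := (@lebesgue_measure R).

Variables (F : set_system R) (FF : Filter F) (c : R).
Hypothesis Foo : `|x| @[x --> F] --> +oo.

(** The phase [c] covers cosine and sine together, as sin u = cos (u - pi/2), and the filter covers
    both infinities. *)
Definition oscillation (g : R -> R) (x : R) : R :=
  \int[leb]_xi (g xi * cos (x * xi + c)).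

Let mcos (x : R) : measurable_fun setT (fun xi : mR => cos (x * xi + c)).
Proof.
apply: (measurableT_comp (continuous_measurable_fun (@continuous_cos R))).
apply: measurable_funD => //; exact: measurable_funM.
Qed.

Let cos1 (u : R) : `|cos u| <= 1.
Proof. by rewrite ler_norml cos_geN1 cos_le1. Qed.

Let integrable_cos (g : R -> R) (x : R) : leb.-integrable setT (EFin \o g) ->
  leb.-integrable setT (EFin \o (fun xi => g xi * cos (x * xi + c))).
Proof.
move=> ig; apply: (@integrable_le _ _ mR leb _ (fun xi => `|g xi|)).
- apply: measurable_funM => //.
  by apply/measurable_EFinP; case/integrableP : ig.
- by move=> xi; rewrite normrM ler_piMr.
- exact: (integrable_norm ig).
Qed.

(** Since |cos| <= 1, an L^1-small change of [g] changes all its oscillations by at most the same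
    amount: the functions with vanishing oscillation are L^1-closed. Every later extension of the
    class of [g] rests on this. *)
Lemma oscillation_closure (g : R -> R) : leb.-integrable setT (EFin \o g) ->
  (forall e, 0 < e -> exists k : R -> R,
    [/\ leb.-integrable setT (EFin \o k), oscillation k x @[x --> F] --> 0 &
        \int[leb]_xi `|g xi - k xi| <= e]) ->
  oscillation g x @[x --> F] --> 0.
Proof.
move=> ig H; apply/cvgrPdist_le => e e0.
have [|k [ik Ok gk]] := H (e / 2); first exact: divr_gt0.
near=> x; rewrite sub0r normrN.
have -> : oscillation g x = oscillation k x + oscillation (fun xi => g xi - k xi) x.
  have ik' := integrable_cos x ik.
  have igk := integrableB measurableT ig ik.
  rewrite /oscillation -RintegralD//; last exact: (integrable_cos x igk).
  by apply: eq_Rintegral => xi _; ring.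
have igk : leb.-integrable setT (EFin \o (fun xi => g xi - k xi)).
  exact: (integrableB measurableT ig ik).
have h1 : `|oscillation (fun xi => g xi - k xi) x| <= e / 2.
  apply: le_trans gk; apply: le_trans (le_normr_Rintegral _ (integrable_cos x igk)) _ => //.
  apply: le_Rintegral => //.
  - exact: (integrable_norm (integrable_cos x igk)).
  - exact: (integrable_norm igk).
  - by move=> xi _; rewrite normrM ler_piMr.
have h2 : `|oscillation k x| <= e / 2.
  rewrite -normrN -sub0r; near: x.
  by move/cvgrPdist_le : Ok; apply; exact: divr_gt0.
rewrite (le_trans (ler_normD _ _))//; lra.
Unshelve. all: by end_near. Qed.

Section segment.
Variable N : R.
Hypothesis N0 : 0 <= N.
Local Notation E := `[- N, N]%classic.

Let NN : - N <= N. Proof. by rewrite (le_trans _ N0)// oppr_le0. Qed.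

Let cutE (g : R -> R) (x : R) : oscillation (g \_ E) x =
  \int[leb]_(xi in E) (g xi * cos (x * xi + c)).
Proof.
rewrite /oscillation [RHS]Rintegral_mkcond; apply: eq_Rintegral => xi _.
by rewrite !patchE; case: ifP; rewrite ?mul0r.
Qed.

Let integrable_cut (g : R -> R) : leb.-integrable E (EFin \o g) ->
  leb.-integrable setT (EFin \o (g \_ E)).
Proof.
by move=> ig; rewrite -restrict_EFin; apply: (integrable_mkcond _ _).1 ig.
Qed.

Let cut_dist (g k : R -> R) : \int[leb]_xi `|(g \_ E) xi - (k \_ E) xi| =
  \int[leb]_(xi in E) `|g xi - k xi|.
Proof.
rewrite [RHS]Rintegral_mkcond; apply: eq_Rintegral => xi _.
by rewrite !patchE; case: ifP; rewrite ?subrr ?normr0.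
Qed.

(** Integration by parts on the segment: the primitive sin (x xi + c) / x of the cosine supplies a
    factor 1/|x|, in front of the two boundary values of [u] and the integral of |u'|. *)
Lemma oscillation_C1 (u u' : R -> R) : (forall x : R, is_derive x 1 u (u' x)) ->
  continuous u' -> oscillation (u \_ E) x @[x --> F] --> 0.
Proof.
move=> du cu'.
have cu : continuous u by move=> x; exact: is_derive1_continuous (du x).
pose K := `|u N| + `|u (- N)| + \int[leb]_(xi in E) `|u' xi|.
have bound x : x != 0 -> `|oscillation (u \_ E) x| <= K / `|x|.
  move=> x0; rewrite cutE.
  pose V xi := u xi * (sin (x * xi + c) / x).
  have dphase (xi : R) : is_derive xi 1 (fun y : R => x * y + c) x.
    have h := is_dD (is_dlin x xi) (is_dcst xi c).
    by apply: is_derive_eq h _; rewrite addr0.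
  have ds (xi : R) : is_derive xi 1 (fun y : R => sin (x * y + c) / x) (cos (x * xi + c)).
    have h := is_dM (@is_dcomp _ sin (fun y => x * y + c) xi _ _ (is_derive_sin _) (dphase xi)) (is_dcst xi x^-1).
    by apply: is_derive_eq h _; rewrite mulr0 addr0 mulfK.
  have dV (xi : R) : is_derive xi 1 V (u' xi * (sin (x * xi + c) / x) + u xi * cos (x * xi + c)).
    exact: is_dM (du xi) (ds xi).
  have cs : continuous (fun xi => sin (x * xi + c) / x).
    by move=> xi; exact: is_derive1_continuous (ds xi).
  have cc : continuous (fun xi => cos (x * xi + c)).
    move=> xi; exact: is_derive1_continuous (@is_dcomp _ cos (fun y => x * y + c) xi _ _ (is_derive_cos _) (dphase xi)).
  have c1 : continuous (fun xi => u' xi * (sin (x * xi + c) / x)).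
    by move=> xi; apply: cvgM; [exact: cu'|exact: cs].
  have c2 : continuous (fun xi => u xi * cos (x * xi + c)).
    by move=> xi; apply: cvgM; [exact: cu|exact: cc].
  have i1 := integrable_segment (- N) N c1; have i2 := integrable_segment (- N) N c2.
  have e := Rftc_itv NN dV (fun xi => cvgD (c1 xi) (c2 xi)).
  rewrite RintegralD// in e.
  have -> : \int[leb]_(xi in E) (u xi * cos (x * xi + c)) = V N - V (- N) -
      \int[leb]_(xi in E) (u' xi * (sin (x * xi + c) / x)).
    by rewrite -e addrAC subrr add0r.
  have sx y : `|sin y / x| <= `|x|^-1.
    by rewrite normrM normfV ler_piMl ?invr_ge0// ler_norml sin_geN1 sin_le1.
  rewrite (le_trans (ler_normB _ _))// /K mulrDl lerD//.
    rewrite (le_trans (ler_normB _ _))// mulrDl /V (normrM (u N)) (normrM (u (- N))).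
    by apply: lerD; apply: ler_wpM2l => //; exact: sx.
  rewrite (le_trans (le_normr_Rintegral _ i1))//.
  have iu' : leb.-integrable E (EFin \o (fun xi => `|u' xi|)).
    exact: (integrable_norm (integrable_segment (- N) N cu')).
  rewrite -RintegralZr//; apply: le_Rintegral => //.
  - exact: (integrable_norm i1).
  - by apply: integrable_segment => y; apply: cvgMl; apply: cvg_norm; exact: cu'.
  - by move=> xi _; rewrite normrM ler_wpM2l.
apply/cvgrPdist_le => e e0; near=> x; rewrite sub0r normrN.
(* The summand 1 ensures that [x] is nonzero, the other one that K / |x| is at most [e]. *)
have xK : 1 + K / e <= `|x| by near: x; move/cvgryPge : Foo; exact.
have K0 : 0 <= K.
  by rewrite !addr_ge0// Rintegral_ge0.
have x0 : 0 < `|x| by rewrite (lt_le_trans _ xK)// ltr_pwDl// divr_ge0// ltW.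
rewrite (le_trans (bound _ _)) -?normr_gt0// ler_pdivrMr// mulrC -ler_pdivrMr//.
by rewrite (le_trans _ xK)// lerDr.
Unshelve. all: by end_near. Qed.

(** The approximants [u n] are the averages of [h] over [xi, xi + 1/(n+1)], written with a primitive
    [P]: they are C^1 and tend to [h] boundedly on the segment, hence in L^1. *)
Lemma oscillation_continuous (h : R -> R) : continuous h ->
  oscillation (h \_ E) x @[x --> F] --> 0.
Proof.
move=> ch; have [P dP] := continuous_primitive ch.
have ih := integrable_segment (- N) N ch.
pose d n : R := n.+1%:R^-1.
pose u n (xi : R) := n.+1%:R * (P (xi + d n) - P xi).
have dshift n (xi : R) : is_derive xi 1 (fun y => P (y + d n)) (h (xi + d n)).
  have e := @is_dcomp _ P (fun y => y + d n) xi _ _ (dP _)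
    (is_dD (is_did xi) (is_dcst xi (d n))).
  by apply: is_derive_eq e _; rewrite addr0 mulr1.
have du n (xi : R) : is_derive xi 1 (u n) (n.+1%:R * (h (xi + d n) - h xi)).
  exact: is_dZ _ (is_dD (dshift n xi) (is_dN (dP xi))).
have cshift n : continuous (fun xi => h (xi + d n)).
  move=> xi; apply: (@continuous_comp _ _ _ (fun y : R => y + d n) h); last exact: ch.
  by apply: cvgD; [exact: cvg_id|exact: cvg_cst].
have cu' n : continuous (fun xi => n.+1%:R * (h (xi + d n) - h xi)).
  by move=> xi; apply: cvgMr; apply: cvgB; [exact: cshift|exact: ch].
have cu n : continuous (u n) by move=> xi; exact: is_derive1_continuous (du n xi).
(* The averages look to the right by at most 1, hence the enlarged segment [-N, N + 1]. *)
have [H hH] : exists H : R, forall y, - N <= y <= N + 1 -> `|h y| <= H.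
  have NN1 : - N <= N + 1 by rewrite (le_trans NN)// lerDl.
  have cw : {within `[- N, N + 1], continuous h} by exact: continuous_subspaceT.
  have [y1 _ h1] := EVT_max NN1 cw; have [y2 _ h2] := EVT_min NN1 cw.
  exists (`|h y1| + `|h y2|) => y yN; have yI : y \in `[- N, N + 1] by rewrite in_itv.
  have := h1 y yI; have := h2 y yI; have := ler_norm (h y1); have := ler_norm (- h y2).
  rewrite normrN ler_norml; have := normr_ge0 (h y1); have := normr_ge0 (h y2).
  by move=> *; apply/andP; split; lra.
have uH n xi : xi \in `[- N, N] -> `|u n xi| <= H.
  rewrite in_itv /= => /andP[x1 x2]; have d0 : 0 < d n by rewrite invr_gt0.
  have xd : xi <= xi + d n by rewrite lerDl ltW.
  have cP : {within `[xi, xi + d n], continuous P}.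
    by apply: continuous_subspaceT => y; exact: is_derive1_continuous (dP y).
  have [y + e] := MVT_segment xd (fun y _ => dP y) cP.
  rewrite in_itv /= => /andP[y1 y2].
  rewrite /u e [xi + _]addrC addrK mulrCA mulfV ?mulr1; last by rewrite pnatr_eq0.
  apply: hH; rewrite (le_trans x1 y1)/= (le_trans y2)// lerD// invf_le1//.
  by rewrite ler1n.
have lim : \int[leb]_(xi in E) `|h xi - u n xi| @[n --> \oo] --> 0.
  have -> : 0 = \int[leb]_xi (0 : R) :> R by rewrite Rintegral_cst// mul0r.
  under eq_fun do rewrite Rintegral_mkcond.
  apply: (@dct_seq _ _ mR leb _ _ ((fun=> 2 * H) \_ E)).
  - move=> n; apply/(measurable_restrictT _ _).1 => //.
    apply: measurable_funTS; apply: continuous_measurable_fun => y.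
    by apply: cvg_norm; apply: cvgB; [exact: ch|exact: cu].
  - move=> n xi; rewrite !patchE; case: ifPn => [/set_mem xE|_]; last by rewrite normr0.
    rewrite normr_id (le_trans (ler_normB _ _))// mulr_natl mulr2n lerD//.
      apply: hH; move: xE; rewrite /= in_itv /= => /andP[-> x2]/=.
      by rewrite (le_trans x2)// lerDl.
    exact: uH.
  - apply: integrable_cut; apply: integrable_segment => y; exact: cvg_cst.
  - move=> xi; have [xE|xE] := boolP (xi \in E); last first.
      under eq_fun do rewrite patchE (negbTE xE).
      exact: cvg_cst.
    under eq_fun do rewrite patchE xE.
    rewrite -(normr0 R) -(subrr (h xi)); apply: cvg_norm; apply: cvgB; first exact: cvg_cst.
    (* The averages are difference quotients of [P] with step [d n], so their convergence to [h] is
       the differentiability of [P]. *)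
    have [/cvg_ex[l hl] e] := dP xi.
    have {}hl : (fun t => t^-1 *: (P (t *: (1 : R) + xi) - P xi)) @ 0^' --> h xi.
      rewrite -e /derive; have -> // : lim ((fun t => t^-1 *: (P (t *: (1:R) + xi) - P xi)) @ 0^') = l.
      exact: cvg_lim hl.
    move/cvgr_dnbhsP : hl => /(_ d).
    rewrite (_ : (fun n => u n xi) = (fun n => (d n)^-1 *: (P (d n *: (1 : R) + xi) - P xi))).
      apply; split; first by move=> n; rewrite invr_eq0 pnatr_eq0.
      exact: cvg_harmonic.
    apply/funext => n; rewrite /u /d invrK /GRing.scale /= mulr1.
    by rewrite [xi + _]addrC.
apply: oscillation_closure; first exact: integrable_cut.
move=> e e0; have /cvgrPdist_le/(_ _ e0)[n _ hn] := lim.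
exists (u n \_ E); split.
- apply: integrable_cut; exact: integrable_segment.
- exact: oscillation_C1 (du n) (cu' n).
- rewrite cut_dist; have := hn n (leqnn n); rewrite /= sub0r normrN.
  by apply: le_trans; rewrite ler_norm.
Qed.

(** Continuous functions are dense in L^1 of a segment. *)
Lemma oscillation_cut (g : R -> R) : leb.-integrable setT (EFin \o g) ->
  oscillation (g \_ E) x @[x --> F] --> 0.
Proof.
move=> ig; have igE : leb.-integrable E (EFin \o g).
  exact: (integrableS measurableT).
have mE : measurable (E : set mR) by exact: measurable_itv.
have Eoo : (leb E < +oo)%E.
  by rewrite lebesgue_measure_itv; case: ifP => // _; rewrite -EFinB ltry.
have [h_ [ch ih lim]] := approximation_continuous_integrable mE Eoo igE.
have {}lim : \int[leb]_(xi in E) `|g xi - h_ n xi| @[n --> \oo] --> 0.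
  exact: (fine_cvg lim).
apply: oscillation_closure; first exact: integrable_cut.
move=> e e0; have /cvgrPdist_le/(_ _ e0)[n _ hn] := lim.
exists (h_ n \_ E); split.
- apply: integrable_cut; exact: ih.
- exact: oscillation_continuous.
- rewrite cut_dist; have := hn n (leqnn n); rewrite /= sub0r normrN.
  by apply: le_trans; rewrite ler_norm.
Qed.

End segment.

Lemma oscillation_cvg0 (g : R -> R) : leb.-integrable setT (EFin \o g) ->
  oscillation g x @[x --> F] --> 0.
Proof.
move=> ig; apply: oscillation_closure => // e e0.
pose k n := g \_ `[- n%:R, n%:R]%classic.
have mg : measurable_fun setT (g : mR -> R).
  by apply/measurable_EFinP; case/integrableP : ig.
have mk n : measurable_fun setT (k n : mR -> R).
  by apply/(measurable_restrictT _ _).1 => //; exact: measurable_funTS.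
have kg n xi : `|k n xi| <= `|g xi|.
  by rewrite /k patchE; case: ifP; rewrite ?normr0.
have lim : \int[leb]_xi `|g xi - k n xi| @[n --> \oo] --> 0.
  have -> : 0 = \int[leb]_xi (0 : R) :> R by rewrite Rintegral_cst// mul0r.
  apply: (@dct_seq _ _ mR leb _ _ (fun xi => 2 * `|g xi|)).
  - by move=> n; apply: measurableT_comp => //; exact: measurable_funB.
  - move=> n xi; rewrite normr_id (le_trans (ler_normB _ _))// mulr_natl mulr2n.
    by rewrite lerD.
  - exact: (integrableZl measurableT 2 (integrable_norm ig)).
  - move=> xi; apply: (@cvg_near_cst _ _ _ _ _ _); near=> n.
    rewrite /k patchE mem_set ?subrr ?normr0//= in_itv /= -ler_norml.
    by near: n; exact: nbhs_infty_ger.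
have /cvgrPdist_le/(_ _ e0)[n _ hn] := lim.
exists (k n); split.
- exact: (@integrable_le _ _ mR leb _ (fun xi => `|g xi|)) (mk n) (kg n) (integrable_norm ig).
- exact: oscillation_cut.
- have := hn n (leqnn n); rewrite /= sub0r normrN.
  by apply: le_trans; rewrite ler_norm.
Unshelve. all: by end_near. Qed.

End RiemannLebesgue.

(** * Oscillatory integrals and convolutions depending on a parameter *)

Section ParametricIntegrals.
Context {R : realType}.
Local Notation C := R[i].
Local Notation mR := (measurableTypeR R).
Local Notation leb := (@lebesgue_measure R).

Lemma is_derive_under_integral {d : measure_display} {T : measurableType d}
    (mu : {measure set T -> \bar R}) (g g' : R -> T -> R) (G : T -> R) (x : R) :
  (forall x, mu.-integrable setT (EFin \o g x)) ->
  (forall (x : R) y, is_derive x 1 (g ^~ y) (g' x y)) ->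
  (forall x y, `|g' x y| <= G y) -> mu.-integrable setT (EFin \o G) ->
  is_derive x 1 (fun x => \int[mu]_y g x y) (\int[mu]_y g' x y).
Proof.
move=> ig dg gG iG.
(* The majorant is uniform in the parameter, so any open interval around [x] would serve. *)
have xI : `]x - 1, x + 1[%classic x.
  by rewrite /= in_itv /= ltrBlDr ltrDl ltr01.
have ig' z : `]x - 1, x + 1[%classic z -> mu.-integrable setT (EFin \o g z).
  by move=> _; exact: ig.
have dg' z y : `]x - 1, x + 1[%classic z -> [set: T] y -> derivable (g ^~ y) z 1.
  by move=> _ _; have h := dg z y; exact: ex_derive.
have G0 y : 0 <= G y by exact: le_trans (normr_ge0 _) (gG x y).
have pE z y : partial1of2 g z y = g' z y.
  by rewrite partial1of2E; have h := dg z y; exact: derive_val.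
have gG' z y : `]x - 1, x + 1[%classic z -> [set: T] y -> `|partial1of2 g z y| <= G y.
  by move=> _ _; rewrite pE.
have h1 := derivable_under_integral measurableT xI ig' dg' G0 iG gG'.
have h2 := differentiation_under_integral measurableT xI ig' dg' G0 iG gG'.
apply: DeriveDef => //; rewrite -derive1E h2.
by apply: eq_Rintegral => y _; exact: pE.
Qed.

Lemma cis_derive_under_integral {d : measure_display} {T : measurableType d}
    (mu : {measure set T -> \bar R}) (g g' : R -> T -> C) (G : T -> R) (x : R) :
  (forall x, cintegrable mu setT (g x)) ->
  (forall (x : R) y, cis_derive (g ^~ y) x (g' x y)) ->
  (forall x y, cmod (g' x y) <= G y) -> mu.-integrable setT (EFin \o G) ->
  cis_derive (fun x => cint mu setT (g x)) x (cint mu setT (g' x)).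
Proof.
move=> ig dg gG iG; split.
  have h := @is_derive_under_integral _ _ mu (fun x => re (g x)) (fun x => re (g' x)) G x
    (fun x => (ig x).1) (fun x y => (dg x y).1)
    (fun x y => le_trans (ler_Re_cmod _) (gG x y)) iG.
  exact: h.
have h := @is_derive_under_integral _ _ mu (fun x => im (g x)) (fun x => im (g' x)) G x
  (fun x => (ig x).2) (fun x y => (dg x y).2)
  (fun x y => le_trans (ler_Im_cmod _) (gG x y)) iG.
exact: h.
Qed.

Section osc.
Variables (a : R -> C) (b : R -> R).
Hypothesis ia : cintegrable leb1 setT a.
Hypothesis mb : measurable_fun setT (b : mR -> R).

Let ma := cintegrable_meas ia.

Let mosc (p : R * R) :
  cmeasurable ((fun xi => a xi * expi (p.1 * xi + p.2 ^+ 2 * b xi)) : mR -> C).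
Proof.
apply: cmeasurableM => //; apply: cmeasurable_expi.
by apply: measurable_funD; apply: measurable_funM => //; exact: measurable_cst.
Qed.

Let oscB (p : R * R) (xi : R) :
  cmod (a xi * expi (p.1 * xi + p.2 ^+ 2 * b xi)) <= cmod (a xi).
Proof. by rewrite cmodM cmod_expi mulr1. Qed.

Lemma osc_continuous : ccontinuous (osc_kernel a b).
Proof.
apply/ccontinuousP => p.
apply: (@cdct _ _ _ leb1 _ _ _
  (fun (p : R * R) xi => a xi * expi (p.1 * xi + p.2 ^+ 2 * b xi)) _
  (fun xi => cmod (a xi))) => //.
- exact: cg_nbhs.
- exact: cintegrable_cmod.
- move=> xi; apply: ccvgM; first exact: ccvg_cst.
  apply: ccvg_expi; apply: cvgD; apply: cvgMl; first exact: fst_continuous.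
  by apply: cvgM; exact: snd_continuous.
Qed.

Lemma osc_bounded : exists M : R, forall p, cmod (osc_kernel a b p) <= M.
Proof.
exists (2 * \int[leb]_xi cmod (a xi)) => p.
by apply: cmod_cint => //; exact: cintegrable_cmod.
Qed.

Lemma osc_derive : cintegrable leb1 setT (fun xi => (0 +i* xi) * a xi) ->
  forall p, cis_derive (slice false (osc_kernel a b) p) p.1
    (osc_kernel (fun xi => (0 +i* xi) * a xi) b p).
Proof.
move=> ia' [x y].
apply: (@cis_derive_under_integral _ _ leb1
  (fun x xi => a xi * expi (x * xi + y ^+ 2 * b xi))
  (fun x xi => (0 +i* xi) * a xi * expi (x * xi + y ^+ 2 * b xi))
  (fun xi => cmod ((0 +i* xi) * a xi))).
- move=> z; apply: (@cintegrable_le _ _ mR leb1 _ (fun xi => cmod (a xi))).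
  + exact: mosc (z, y).
  + exact: oscB (z, y).
  + exact: cintegrable_cmod.
- move=> z xi.
  have dth : is_derive z 1 (fun x : R => x * xi + y ^+ 2 * b xi) xi.
    have h := is_dD (is_dM (is_did z) (is_dcst z xi)) (is_dcst z (y ^+ 2 * b xi)).
    by apply: is_derive_eq h _; rewrite mul1r mulr0 !addr0.
  apply: cis_derive_eq (cis_dM (cis_dcst z (a xi)) (cis_dexpi dth)) _.
  by rewrite mul0r add0r; ring.
- by move=> z xi; rewrite [leLHS]cmodM cmod_expi mulr1.
- exact: cintegrable_cmod ia'.
Qed.

(** For fixed [y] the factor e^(i y^2 b) is absorbed into the amplitude without losing
    integrability; what remains is a Fourier integral in xi, whose real and imaginary parts are
    combinations of four oscillations. *)
Lemma osc_cvg0 (F : set_system R) (FF : Filter F) (y : R) :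
  `|x| @[x --> F] --> +oo -> ccvg F (fun x => osc_kernel a b (x, y)) 0.
Proof.
move=> Foo.
pose a' xi := a xi * expi (y ^+ 2 * b xi).
have ia' : cintegrable leb1 setT a'.
  apply: (@cintegrable_le _ _ mR leb1 _ (fun xi => cmod (a xi))).
  - apply: cmeasurableM => //; apply: cmeasurable_expi.
    by apply: measurable_funM => //; exact: measurable_cst.
  - by move=> xi; rewrite cmodM cmod_expi mulr1.
  - exact: cintegrable_cmod.
have [r1 r2] := ia'.
have E x : osc_kernel a b (x, y) = cint leb1 setT (fun xi => a' xi * expi (x * xi)).
  by apply: eq_cint => xi; rewrite /a' /= expiD; ring.
pose O g c x := @oscillation R c g x.
have intc g c x : leb.-integrable setT (EFin \o g) ->
    leb.-integrable setT (EFin \o (fun xi => g xi * cos (x * xi + c))).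
  move=> ig; apply: (@integrable_le _ _ mR leb _ (fun xi => `|g xi|)).
  - apply: measurable_funM; first by apply/measurable_EFinP; case/integrableP : ig.
    apply: (measurableT_comp (continuous_measurable_fun (@continuous_cos R))).
    by apply: measurable_funD => //; exact: measurable_funM.
  - by move=> xi; rewrite normrM ler_piMr// ler_norml cos_geN1 cos_le1.
  - exact: (integrable_norm ig).
have sinE (u : R) : sin u = cos (u + - (pi / 2)) by rewrite cosBpihalf.
have ReE x : complex.Re (osc_kernel a b (x, y)) =
    O (re a') 0 x - O (im a') (- (pi / 2)) x.
  rewrite E /O /oscillation -RintegralB//; [|exact: intc|exact: intc].
  by apply: eq_Rintegral => xi _; rewrite /re ReM /= addr0 sinE.
have ImE x : complex.Im (osc_kernel a b (x, y)) =
    O (re a') (- (pi / 2)) x + O (im a') 0 x.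
  rewrite E /O /oscillation -RintegralD//; [|exact: intc|exact: intc].
  by apply: eq_Rintegral => xi _; rewrite /im ImM /= addr0 sinE.
split.
  rewrite (_ : re _ = (fun x => O (re a') 0 x - O (im a') (- (pi / 2)) x)); last first.
    by apply/funext => x; exact: ReE.
  by rewrite -[X in _ --> X](subrr 0); apply: cvgB; exact: oscillation_cvg0.
rewrite (_ : im _ = (fun x => O (re a') (- (pi / 2)) x + O (im a') 0 x)); last first.
  by apply/funext => x; exact: ImE.
by rewrite -[X in _ --> X](addr0 0); apply: cvgD; exact: oscillation_cvg0.
Qed.

End osc.

Lemma cis_dshift (h : R -> C) (x c : R) (l : C) : cis_derive h (x - c) l ->
  cis_derive (fun y => h (y - c)) x l.
Proof.
have ds : is_derive x 1 (fun y : R => y - c) 1.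
  by apply: is_derive_eq (is_dD (is_did x) (is_dcst x (- c))) _; rewrite addr0.
move=> [h1 h2]; split.
  have e := @is_dcomp _ (re h) (fun y => y - c) x _ _ h1 ds.
  by apply: (is_derive_eq e); rewrite mulr1.
have e := @is_dcomp _ (im h) (fun y => y - c) x _ _ h2 ds.
by apply: (is_derive_eq e); rewrite mulr1.
Qed.

Section convolution.
Variable f : R * R -> C.
Hypothesis fi : cintegrable leb2 setT f.

Section kernel.
Variables (K : R * R -> C) (M : R).
Hypothesis cK : ccontinuous K.
Hypothesis KM : forall p, cmod (K p) <= M.

Let mKs (p : R * R) : cmeasurable ((fun q => K (p - q)) : (mR * mR)%type -> C).
Proof.
have mK := ccontinuous_measurable_plane cK.
apply: (cmeasurable_comp mK); apply/measurable_fun_pair.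
  by apply: measurable_funB; [exact: measurable_cst|exact: measurable_fst].
by apply: measurable_funB; [exact: measurable_cst|exact: measurable_snd].
Qed.

Let mKf (p : R * R) : cmeasurable ((fun q => K (p - q) * f q) : (mR * mR)%type -> C).
Proof.
by apply: cmeasurableM; [exact: mKs|exact: (cintegrable_meas fi)].
Qed.

Let KfB p q : cmod (K (p - q) * f q) <= M * cmod (f q).
Proof. by rewrite cmodM ler_wpM2r ?cmod_ge0. Qed.

Let iMf : leb2.-integrable setT (EFin \o (fun q => M * cmod (f q))).
Proof. exact: (integrableZl measurableT M (cintegrable_cmod fi)). Qed.

Lemma conv_integrable p : cintegrable leb2 setT (fun q => K (p - q) * f q).
Proof. exact: cintegrable_le (mKf p) (KfB p) iMf. Qed.

Lemma conv_bounded : exists N : R, forall p, cmod (convolution K f p) <= N.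
Proof.
exists (2 * \int[leb2]_q (M * cmod (f q))) => p.
exact: cmod_cint (mKf p) (KfB p) iMf.
Qed.

(** Common source of continuity and decay: the bound on [K] makes a multiple of |f| dominate,
    whatever the filter along which the point moves. *)
Lemma conv_limit (S : Type) (F : set_system S) (FF : Filter F) (p : S -> R * R)
    (L : R * R -> C) : countably_generated F ->
  (forall q, ccvg F (fun s => K (p s - q)) (L q)) ->
  ccvg F (fun s => convolution K f (p s)) (cint leb2 setT (fun q => L q * f q)).
Proof.
move=> cF KL.
apply: (@cdct _ _ _ leb2 _ _ _ (fun s q => K (p s - q) * f q) _
  (fun q => M * cmod (f q))) => // q.
by apply: ccvgM; [exact: KL|exact: ccvg_cst].
Qed.

Lemma conv_continuous : ccontinuous (convolution K f).
Proof.
apply/ccontinuousP => p; apply: (@conv_limit _ _ _ id (fun q => K (p - q))).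
  exact: cg_nbhs.
move=> q; have h : s - q @[s --> p] --> p - q.
  have [p1 p2] : (s.1 - q.1 @[s --> p] --> p.1 - q.1) /\ (s.2 - q.2 @[s --> p] --> p.2 - q.2).
    split; apply: cvgB; try exact: cvg_cst.
      exact: fst_continuous.
    exact: snd_continuous.
  exact: (cvg_pair_nbhs p1 p2).
by case: cK => c1 c2; split; [exact: (cvg_comp _ _ h (c1 _))|
  exact: (cvg_comp _ _ h (c2 _))].
Qed.

(** Translation invariance of the filter makes every translate of [K] tend to 0, and dominated
    convergence carries this through the integral in [q]. *)
Lemma conv_cvg0 (F : set_system R) (FF : Filter F) (y : R) :
  countably_generated F -> (forall x0, x - x0 @[x --> F] --> F) ->
  (forall y, ccvg F (fun x => K (x, y)) 0) ->
  ccvg F (fun x => convolution K f (x, y)) 0.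
Proof.
move=> cF shiftF K0.
have := @conv_limit _ F FF (fun x => (x, y)) (fun=> 0) cF.
rewrite (_ : cint _ _ _ = 0); last first.
  by rewrite -[RHS](@cint0 _ _ _ leb2); apply: eq_cint => q; rewrite mul0r.
apply => q; have [k1 k2] := K0 (y - q.2).
by split; [exact: (cvg_comp _ _ (shiftF q.1) k1)|exact: (cvg_comp _ _ (shiftF q.1) k2)].
Qed.

End kernel.

Lemma conv_derive (K K' : R * R -> C) (M M' : R) :
  ccontinuous K -> (forall p, cmod (K p) <= M) -> (forall p, cmod (K' p) <= M') ->
  (forall p, cis_derive (slice false K p) p.1 (K' p)) ->
  forall p, cderivable e_x (convolution K f) p /\
    cderive e_x (convolution K f) p = convolution K' f p.
Proof.
move=> cK KM KM' dK p.
apply: (@cis_derive_partial _ false).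
apply: (@cis_derive_under_integral _ _ leb2
  (fun x q => K ((x, p.2) - q) * f q) (fun x q => K' ((x, p.2) - q) * f q)
  (fun q => M' * cmod (f q)) p.1).
- by move=> x; exact: (conv_integrable cK KM (x, p.2)).
- move=> x q; have h := cis_dshift (dK ((x, p.2) - q)).
  apply: cis_derive_eq (cis_dM h (cis_dcst x (f q))) _.
  by rewrite mulr0 addr0.
- by move=> x q; rewrite cmodM ler_wpM2r ?cmod_ge0.
- exact: (integrableZl measurableT M' (cintegrable_cmod fi)).
Qed.

End convolution.

End ParametricIntegrals.

(** * The kernel A *)

Section AmplitudeEstimates.
Context {R : realType}.
Local Notation C := R[i].
Local Notation mR := (measurableTypeR R).
Local Notation leb := (@lebesgue_measure R).
Variables (alpha beta t : R).
Hypotheses (halpha : 0 < alpha) (hbeta : (alpha + 3) / 2 < beta) (t0 : t != 0).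
Variables (Jr Ji : R).

Local Notation amp := (amplitude alpha t Jr Ji).

(** The symbol of the inverse of d_x (I - d_x^2)^(beta/2). At xi = 0 the convention on inverses
    gives the value 0 on which the pairing of oscillatory kernels relies. *)
Definition inv_symbol (xi : R) : C :=
  (dx_symbol (xi, 0) * bessel_symbol beta (xi, 0))^-1.

Lemma inv_symbol0 : inv_symbol 0 = 0.
Proof.
rewrite /inv_symbol (_ : dx_symbol (0, 0) = 0) ?mul0r ?invr0//.
Qed.

Lemma cmod_imag (x : R) : cmod (0 +i* x : C) = `|x|.
Proof. by rewrite /= expr0n add0r sqrtr_sqr. Qed.

Lemma cmod_inv_symbol (xi : R) :
  cmod (inv_symbol xi) = `|xi|^-1 * ((1 + xi ^+ 2) `^ (beta / 2))^-1.
Proof.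
rewrite /inv_symbol cmodV cmodM invfM [cmod (dx_symbol _)]cmod_imag cmodR.
by congr (_ / _); exact: ger0_norm (powR_ge0 _ _).
Qed.

Lemma measurable_imag : cmeasurable ((fun xi : R => 0 +i* xi : C) : mR -> C).
Proof. by apply: cmeasurable_pair => //; exact: measurable_cst. Qed.

Lemma measurable_inv_symbol : cmeasurable (inv_symbol : mR -> C).
Proof.
apply: cmeasurableV; apply: cmeasurableM; first exact: measurable_imag.
apply: cmeasurableR; have mq : measurable_fun setT (fun x : mR => 1 + x ^+ 2).
  by apply: measurable_funD => //; exact: measurable_funX.
exact: (measurableT_comp (measurable_powR (beta / 2)) mq).
Qed.

(** Exponent in the majorant |xi|^(-1/2) (1 + xi^2)^e of the amplitude: alpha/4 comes from the
    curvature, -beta/2 from the Bessel symbol. The hypothesis on beta says exactly that e < -3/4. *)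
Let e := alpha / 4 - beta / 2.

Let bracket_ge1 (x : R) : 1 <= 1 + x ^+ 2.
Proof. by rewrite lerDl sqr_ge0. Qed.

Let bracket_gt0 (x : R) : 0 < 1 + x ^+ 2.
Proof. exact: lt_le_trans ltr01 (bracket_ge1 x). Qed.

(** The left side is the square root of (1 + |xi|^alpha) |xi| / |t|, and 1 + |xi|^alpha is at most 2
    (1 + xi^2)^(alpha/2); hence the 2 under the root and the exponent alpha/4. *)
Lemma inv_sqrt_curvature_le (xi : R) : xi != 0 ->
  (Num.sqrt `|curvature alpha t xi|)^-1 <=
  Num.sqrt (2 / `|t|) * Num.sqrt `|xi| * (1 + xi ^+ 2) `^ (alpha / 4).
Proof.
move=> x0; have nx0 : 0 < `|xi| by rewrite normr_gt0.
have nt0 : 0 < `|t| by rewrite normr_gt0.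
have pa : 0 <= `|xi| `^ alpha by exact: powR_ge0.
have kE : `|curvature alpha t xi| = `|t| / ((1 + `|xi| `^ alpha) * `|xi|).
  rewrite /curvature /speed !normrM !normfV [`|1 + _|]ger0_norm ?addr_ge0//.
  by rewrite invfM mulrA.
have k0 : 0 <= `|t| / ((1 + `|xi| `^ alpha) * `|xi|) by rewrite -kE.
rewrite kE -sqrtrV// invf_div.
have P0 : 0 <= (1 + xi ^+ 2) `^ (alpha / 4) by exact: powR_ge0.
have hA : (1 + xi ^+ 2) `^ (alpha / 4) = Num.sqrt (((1 + xi ^+ 2) `^ (alpha / 4)) ^+ 2).
  by rewrite sqrtr_sqr ger0_norm.
have q1 : 0 <= 2 / `|t| by rewrite divr_ge0.
have q2 : 0 <= 2 / `|t| * `|xi| by rewrite mulr_ge0.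
rewrite hA -(sqrtrM _ q1) -(sqrtrM _ q2).
apply: ler_wsqrtr.
have -> : ((1 + xi ^+ 2) `^ (alpha / 4)) ^+ 2 = (1 + xi ^+ 2) `^ (alpha / 2).
  rewrite expr2 -powRD; first by congr (_ `^ _); field.
  by apply/implyP => _; rewrite gt_eqF.
rewrite ler_pdivrMr// (_ : _ * _ * _ * `|t| =
    (2 * (1 + xi ^+ 2) `^ (alpha / 2)) * `|xi|); last by field; rewrite gt_eqF.
rewrite ler_wpM2r//.
have a1 : 1 <= (1 + xi ^+ 2) `^ (alpha / 2).
  rewrite -[leLHS](powRr0 (1 + xi ^+ 2)); apply: ler_powR => //.
  by rewrite divr_ge0// ltW.
have a2 : `|xi| `^ alpha <= (1 + xi ^+ 2) `^ (alpha / 2).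
  have -> : `|xi| `^ alpha = (xi ^+ 2) `^ (alpha / 2).
    rewrite -(real_normK (num_real xi)) -powR_mulrn// -powRrM.
    by congr (_ `^ _); field.
  have r0 : 0 <= alpha / 2 by rewrite divr_ge0// ltW.
  have y0 := ltW (bracket_gt0 xi).
  by apply: ge0_ler_powR; rewrite ?nnegrE ?sqr_ge0// lerDr.
by lra.
Qed.

Let J := `|Jr| + `|Ji|.
Let c0 := Num.sqrt (2 / `|t|) * J.

Let c00 : 0 <= c0.
Proof. by rewrite mulr_ge0 ?sqrtr_ge0// addr_ge0. Qed.

Lemma amplitude_le (xi : R) : cmod (amp inv_symbol xi) <=
  c0 * ((Num.sqrt `|xi|)^-1 * (1 + xi ^+ 2) `^ e).
Proof.
have [->|x0] := eqVneq xi 0.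
  rewrite /amplitude inv_symbol0 !mul0r cmod0.
  by rewrite mulr_ge0// mulr_ge0 ?powR_ge0// invr_ge0 sqrtr_ge0.
rewrite (le_trans (cmod_amplitude _ _ _ _ _ _))// cmod_inv_symbol.
have nx0 : 0 < `|xi| by rewrite normr_gt0.
have s0 : 0 < Num.sqrt `|xi| by rewrite sqrtr_gt0.
have b0 : 0 < (1 + xi ^+ 2) `^ (beta / 2) by exact: powR_gt0.
have eE : (1 + xi ^+ 2) `^ e = (1 + xi ^+ 2) `^ (alpha / 4) / (1 + xi ^+ 2) `^ (beta / 2).
  rewrite /e powRD ?powRN//.
  by apply/implyP => _; rewrite gt_eqF.
rewrite eE; set A := (_ `^ (alpha / 4)); set B := (_ `^ (beta / 2)).
have J0 : 0 <= J by exact: addr_ge0.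
have -> : c0 * ((Num.sqrt `|xi|)^-1 * (A / B)) =
   (`|xi|^-1 * B^-1) * (Num.sqrt (2 / `|t|) * Num.sqrt `|xi| * A) * J.
  have -> : `|xi|^-1 = (Num.sqrt `|xi|)^-1 * (Num.sqrt `|xi|)^-1.
    by rewrite -invfM -expr2 sqr_sqrtr.
  rewrite /c0; field.
  by rewrite !gt_eqF.
rewrite ler_wpM2r// ler_wpM2l ?inv_sqrt_curvature_le//.
by rewrite mulr_ge0 ?invr_ge0// ltW.
Qed.

(** The singularity |xi|^(-1/2) suggests the majorant 1 / (2 sqrt x (1 + x)), the derivative of atan
    (sqrt x), which is bounded by pi/2. At infinity e <= -1/2 suffices, by (1 + |x|)^2 <= 4 (1 +
    x^2). *)
Lemma amplitude_integrable : cintegrable leb1 setT (amp inv_symbol).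
Proof.
pose g (x : R) : R := (1 + x)^-1 * (2 * Num.sqrt x)^-1.
have ig : leb.-integrable setT (EFin \o (fun x => g `|x|)).
  have s0 (x : R) : 0 < x -> 0 < Num.sqrt x by rewrite sqrtr_gt0.
  apply: (@integrable_bounded_primitive _ g (fun x => atan (Num.sqrt x)) (pi / 2)).
  - apply: measurable_funM.
      by apply: measurable_funV; apply: measurable_funD => //; exact: measurableT_comp.
    apply: measurable_funV; apply: measurable_funM => //.
    exact: (measurableT_comp (continuous_measurable_fun (@sqrt_continuous R))
      (@normr_measurable R setT)).
  - by move=> x x0; rewrite mulr_ge0// invr_ge0 ?addr_ge0// mulr_ge0// sqrtr_ge0.
  - move=> x x0; have h := is_dcomp (is_derive1_atan (Num.sqrt x)) (is_derive1_sqrt x0).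
    by apply: is_derive_eq h _; rewrite sqr_sqrtr// ltW.
  - move=> x x0; apply: cvgM.
      apply: cvgV; first by rewrite gt_eqF// ltr_pwDl ?ltW.
      by apply: cvgD; [exact: cvg_cst|exact: cvg_id].
    apply: cvgV; first by rewrite gt_eqF// mulr_gt0// s0.
    by apply: cvgMr; exact: sqrt_continuous.
  - move=> x x0; have := atan_ltpi2 (Num.sqrt x); have := atan_gtNpi2 (Num.sqrt x).
    by rewrite ler_norml => a b; apply/andP; split; exact: ltW.
apply: (@cintegrable_le _ _ mR leb1 _ (fun x => (4 * c0) * g `|x|)).
- by apply: measurable_amplitude; exact: measurable_inv_symbol.
- move=> x; apply: (le_trans (amplitude_le x)).
  rewrite (_ : 4 * c0 * _ = c0 * (4 * g `|x|)); last by ring.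
  apply: (ler_wpM2l c00); have nx := normr_ge0 x.
  have e2 : (1 + x ^+ 2) `^ e <= 2 / (1 + `|x|).
    have h1 : (1 + x ^+ 2) `^ e <= (1 + x ^+ 2) `^ (- 2^-1).
      by apply: (ler_powR (bracket_ge1 x)); rewrite /e; move: hbeta; lra.
    rewrite (le_trans h1)// powRN powR12_sqrt ?(ltW (bracket_gt0 x))//.
    rewrite ler_pdivlMr ?ltr_pwDl// mulrC ler_pdivrMr ?sqrtr_gt0//.
    rewrite -[leLHS]ger0_norm ?addr_ge0// -sqrtr_sqr -[2]ger0_norm// -[`|2|]sqrtr_sqr -sqrtrM ?sqr_ge0//.
    apply: ler_wsqrtr; rewrite -(real_normK (num_real x)); nra.
  rewrite /g invfM (_ : 4 * _ = (Num.sqrt `|x|)^-1 * (2 / (1 + `|x|))); last first.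
    move: (Num.sqrt `|x|)^-1 => w; field; rewrite gt_eqF// ltr_pwDl//.
  by rewrite ler_wpM2l// invr_ge0 sqrtr_ge0.
- exact: (integrableZl measurableT (4 * c0) ig).
Qed.

Lemma amplitudeM (c m : R -> C) (xi : R) :
  amp (fun xi => c xi * m xi) xi = c xi * amp m xi.
Proof. by rewrite /amplitude; ring. Qed.

(** Since sqrt |xi| <= (1 + xi^2)^(1/4), the majorant is (1 + xi^2)^(-gam) with gam = -(e + 1/4),
    comparable with (1 + |xi|)^(-2 gam). Its integrability requires 2 gam > 1, which is the
    hypothesis on beta in full strength. *)
Lemma dx_amplitude_integrable :
  cintegrable leb1 setT (fun xi => (0 +i* xi) * amp inv_symbol xi).
Proof.
pose gam := - (e + 4^-1).
have gam2 : 1 < 2 * gam by rewrite /gam /e; move: hbeta; lra.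
pose g (x : R) : R := (1 + x) `^ (- (2 * gam)).
have ig : leb.-integrable setT (EFin \o (fun x => g `|x|)).
  have d (x : R) : 0 < x -> is_derive x 1 g (- (2 * gam) * (1 + x) `^ (- (2 * gam) - 1) * (0 + 1)).
    move=> x0; have x1 : 0 < 1 + x by rewrite addr_gt0.
    exact: (@is_dcomp _ (@powR R ^~ (- (2 * gam))) (fun y => 1 + y) x _ _
      (is_derive1_powR _ x1) (is_dD (is_dcst x 1) (is_did x))).
  apply: (@integrable_bounded_primitive _ g
    (fun x => (1 - 2 * gam)^-1 * (1 + x) `^ (1 - 2 * gam)) `|(1 - 2 * gam)^-1|).
  - have mq : measurable_fun setT (fun x : mR => 1 + `|x|).
      by apply: measurable_funD => //; exact: measurableT_comp.
    exact: (measurableT_comp (measurable_powR (- (2 * gam))) mq).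
  - by move=> x _; exact: powR_ge0.
  - move=> x x0; have x1 : 0 < 1 + x by rewrite addr_gt0.
    have h := is_dZ (1 - 2 * gam)^-1 (@is_dcomp _ (@powR R ^~ (1 - 2 * gam))
      (fun y => 1 + y) x _ _ (is_derive1_powR _ x1) (is_dD (is_dcst x 1) (is_did x))).
    apply: is_derive_eq h _; rewrite add0r mulr1 mulrA mulVf ?mul1r; last first.
      by rewrite lt_eqF// subr_lt0.
    by congr (_ `^ _); rewrite addrAC subrr add0r.
  - by move=> x x0; exact: is_derive1_continuous (d x x0).
  - move=> x x0; rewrite normrM ler_piMr// ger0_norm ?powR_ge0//.
    rewrite -[leRHS](powRr0 (1 + x)); apply: ler_powR; first by rewrite lerDl ltW.
    by rewrite subr_le0 ltW.
apply: (@cintegrable_le _ _ mR leb1 _ (fun x => (c0 * 2 `^ gam) * g `|x|)).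
- apply: cmeasurableM; first exact: measurable_imag.
  by apply: measurable_amplitude; exact: measurable_inv_symbol.
- move=> x; rewrite cmodM cmod_imag.
  have [->|x0] := eqVneq x 0.
    rewrite normr0 mul0r; apply: mulr_ge0; last exact: powR_ge0.
    exact: mulr_ge0 c00 (powR_ge0 _ _).
  have nx0 : 0 < `|x| by rewrite normr_gt0.
  have s0 : 0 < Num.sqrt `|x| by rewrite sqrtr_gt0.
  rewrite (le_trans (ler_wpM2l (ltW nx0) (amplitude_le x)))//.
  rewrite mulrCA -[leRHS]mulrA; apply: (ler_wpM2l c00); rewrite mulrA.
  have -> : `|x| * (Num.sqrt `|x|)^-1 = Num.sqrt `|x|.
    by rewrite -{1}(sqr_sqrtr (ltW nx0)) expr2 mulfK// gt_eqF.
  have h1 : Num.sqrt `|x| <= (1 + x ^+ 2) `^ 4^-1.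
    have q0 : 0 <= (1 + x ^+ 2) `^ 4^-1 by exact: powR_ge0.
    have w4 : (((1 + x ^+ 2) `^ 4^-1) ^+ 2) ^+ 2 = 1 + x ^+ 2.
      have nz (r : R) : (r == 0) ==> (1 + x ^+ 2 != 0).
        by apply/implyP => _; rewrite gt_eqF.
      rewrite [_ ^+ 2 ^+ 2]expr2 [_ `^ _ ^+ 2]expr2 -!powRD ?nz//.
      rewrite (_ : 4^-1 + 4^-1 + _ = 1); last by field.
      by rewrite powRr1// ltW.
    rewrite -(@ler_pXn2r _ 2)// ?nnegrE ?sqrtr_ge0// sqr_sqrtr//.
    rewrite -(@ler_pXn2r _ 2)// ?nnegrE ?sqr_ge0// w4 real_normK ?num_real//.
    by rewrite lerDr.
  have p0 : 0 <= (1 + x ^+ 2) `^ e by exact: powR_ge0.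
  rewrite (le_trans (ler_wpM2r p0 h1))// -powRD; last by apply/implyP => _; rewrite gt_eqF.
  rewrite (_ : 4^-1 + e = - gam); last by rewrite /gam opprK addrC.
  have g0 : 0 < gam by lra.
  have y0 := ltW (bracket_gt0 x); have y2 := mulr_ge0 (ler0n R 2) y0.
  (* The inequality (1 + |x|)^2 <= 2 (1 + x^2) raised to the power gam, the origin of the factor
     2^gam in the majorant. *)
  have key : (1 + `|x|) `^ (2 * gam) <= 2 `^ gam * (1 + x ^+ 2) `^ gam.
    rewrite -(powRM _ (ler0n R 2) y0) powRrM (_ : (1 + `|x|) `^ 2 = (1 + `|x|) ^+ 2); last first.
      by rewrite powR_mulrn// addr_ge0.
    apply: (ge0_ler_powR (ltW g0)); rewrite ?nnegrE ?sqr_ge0//.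
    by rewrite -(real_normK (num_real x)); have := sqr_ge0 (`|x| - 1); nra.
  have P0 : 0 < (1 + x ^+ 2) `^ gam by apply: powR_gt0; exact: bracket_gt0.
  have Q0 : 0 < (1 + `|x|) `^ (2 * gam) by apply: powR_gt0; rewrite ltr_pwDl.
  rewrite /g (powRN _ gam) (powRN _ (2 * gam)); move: key P0 Q0.
  move: (2 `^ gam) ((1 + x ^+ 2) `^ gam) ((1 + `|x|) `^ (2 * gam)) => u v w key v0 w0.
  by rewrite ler_pdivlMr// mulrC ler_pdivrMr.
- exact: (integrableZl measurableT (c0 * 2 `^ gam) ig).
Qed.

End AmplitudeEstimates.

(** * The kernel A as an absolutely convergent oscillatory integral *)

Section KernelFormula.
Context {R : realType}.
Local Notation C := R[i].
Local Notation mR := (measurableTypeR R).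

Lemma ccvg_clim {T : Type} (F : set_system T) {PF : ProperFilter F} (f : T -> C)
    (l : C) : ccvg F f l -> clim F f = l.
Proof.
move=> [h1 h2]; rewrite /clim (cvg_lim _ h1)// (cvg_lim _ h2)//.
by case: l {h1 h2}.
Qed.

(** Cancelling xi against 1/xi is legitimate only off the axis xi = 0, a null set of the plane. *)
Lemma eq_cint_off_axis (f g : R * R -> C) :
  cmeasurable (f : (mR * mR)%type -> C) -> cmeasurable (g : (mR * mR)%type -> C) ->
  (forall z, z.1 != 0 -> f z = g z) -> cint leb2 setT f = cint leb2 setT g.
Proof.
move=> [mf1 mf2] [mg1 mg2] fg.
have N : leb2.-negligible ([set (0 : R)] `*` [set: R] : set (mR * mR)%type).
  exists ([set (0 : R)] `*` [set: R]); split => //.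
    by apply: measurableX => //; exact: measurable_set1.
  have h := @product_measure1E _ _ mR mR R sleb1 sleb1 _ _ (measurable_set1 (0 : R)) measurableT.
  by apply: (etrans h); rewrite [X in (X * _)%E](_ : _ = 0%E) ?mul0e//; exact: lebesgue_measure_set1.
have E (h k : R * R -> R) : measurable_fun setT (h : (mR * mR)%type -> R) ->
    measurable_fun setT (k : (mR * mR)%type -> R) ->
    (forall z, z.1 != 0 -> h z = k z) ->
    \int[leb2]_z h z = \int[leb2]_z k z.
  move=> mh mk hk; rewrite /Rintegral; congr fine; apply: ae_eq_integral => //.
  - exact/measurable_EFinP.
  - exact/measurable_EFinP.
  - apply: (negligibleS _ N) => z /= /not_implyP[_ hz]; split => //=.
    by apply: contrapT => z0; apply: hz; rewrite hk//; exact/eqP.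
rewrite /cint; congr (_ +i* _); apply: E => // z z0; by rewrite /re /im fg.
Qed.

Variables (alpha beta t : R).
Hypotheses (halpha : 0 < alpha) (hbeta : (alpha + 3) / 2 < beta) (t0 : t != 0).
Variables (Jr Ji M : R).
Hypothesis HJ : fresnel_profile Jr Ji M.

Local Notation amp := (amplitude alpha t Jr Ji).
Local Notation b := (dual_phase alpha t).
Local Notation c0 := (((2 * pi) ^- 2)%:C : C).
Local Notation m1 := (fun xi : R => c0 * inv_symbol beta xi).

Lemma A_innerE (p : R * R) (xi : R) : A_inner alpha beta t p xi =
  amp (inv_symbol beta) xi * expi (p.1 * xi + p.2 ^+ 2 * b xi).
Proof.
have [->|x0] := eqVneq xi 0.
  (* At xi = 0 the integrand vanishes identically because the inverse symbol is 0 there, so the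
     formula holds for every xi. *)
  rewrite /amplitude inv_symbol0 !mul0r; apply: ccvg_clim.
  rewrite (_ : segint _ = fun=> 0); first exact: ccvg_cst.
  apply/funext => r; rewrite /segint cint_indic -[RHS](@cint0 _ _ _ leb1).
  apply: eq_cint => eta; rewrite /A_integrand.
  by rewrite (_ : _^-1 = inv_symbol beta 0)// inv_symbol0 !mul0r mulr0.
by apply: ccvg_clim; exact: (osc_inner alpha t0 HJ (inv_symbol beta) p x0).2.
Qed.

Lemma A_converges_inner : A_converges alpha beta t.
Proof.
move=> p; split.
  move=> xi x0; rewrite A_innerE; split; last first.
    exact: (osc_inner alpha t0 HJ (inv_symbol beta) p x0).2.
  apply/ccontinuousP => eta.
  have h1 : (fun e : R => - (t / (1 + `|xi| `^ alpha) * (xi + e ^+ 2 / xi))) e @[e --> eta] -->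
      - (t / (1 + `|xi| `^ alpha) * (xi + eta ^+ 2 / xi)).
    apply: cvgN; apply: cvgM; first exact: cvg_cst.
    apply: cvgD; first exact: cvg_cst.
    by apply: cvgM; [exact: exprn_continuous|exact: cvg_cst].
  have h2 : (fun e : R => p.1 * xi + p.2 * e) e @[e --> eta] --> p.1 * xi + p.2 * eta.
    by apply: cvgD; [exact: cvg_cst|apply: cvgM; [exact: cvg_cst|exact: cvg_id]].
  exact: (ccvgM (ccvgM (ccvg_cst _) (ccvg_expi h1)) (ccvg_expi h2)).
have ia := amplitude_integrable halpha hbeta t0 Jr Ji.
have ma := cintegrable_meas ia.
have mb := measurable_dual_phase alpha t.
rewrite (_ : A_inner _ _ _ _ = fun xi => expi (p.1 * xi + p.2 ^+ 2 * b xi) *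
    amp (inv_symbol beta) xi); last by apply/funext => xi; rewrite A_innerE mulrC.
apply: (cintegrableM_bounded (M := 1) ia).
  apply: cmeasurable_expi; apply: measurable_funD; apply: measurable_funM => //;
    exact: measurable_cst.
by move=> x; rewrite cmod_expi.
Qed.

Lemma A_amplitude_integrable : cintegrable leb1 setT (amp m1).
Proof.
rewrite (_ : amp _ = fun xi => c0 * amp (inv_symbol beta) xi).
  by apply: cintegrableZ; exact: amplitude_integrable.
by apply/funext => xi; exact: (amplitudeM _ _ _ _ (fun=> c0)).
Qed.

Lemma A_dx_amplitude_integrable :
  cintegrable leb1 setT (fun xi => (0 +i* xi) * amp m1 xi).
Proof.
rewrite (_ : (fun _ => _) = fun xi => c0 * ((0 +i* xi) * amp (inv_symbol beta) xi)).
  by apply: cintegrableZ; exact: dx_amplitude_integrable.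
apply/funext => xi; rewrite (amplitudeM _ _ _ _ (fun=> c0)).
by rewrite mulrCA.
Qed.

Lemma A_kernelE : A_kernel alpha beta t = osc_kernel (amp m1) b.
Proof.
apply/funext => p; rewrite /A_kernel /osc_kernel -cintZ; last exact: (A_converges_inner p).2.
apply: eq_cint => xi; rewrite A_innerE (amplitudeM _ _ _ _ (fun=> c0)).
by rewrite mulrA.
Qed.

End KernelFormula.

(** * Fourier transforms of distributions as functions *)

Section Densities.
Context {R : realType}.
Local Notation C := R[i].
Local Notation mR := (measurableTypeR R).
Local Notation plane := (mR * mR)%type.

(** Serves two kernels: the exponential, for the transposition of the Fourier transform, and K(p -
    q), for pairing a convolution with a test function. *)
Lemma cfubini_kernel (k : plane * plane -> C) (f g : R * R -> C) (M : R) :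
  cmeasurable k -> (forall w, cmod (k w) <= M) ->
  cintegrable leb2 setT f -> cintegrable leb2 setT g ->
  cint leb2 setT (fun p => g p * cint leb2 setT (fun q => k (p, q) * f q)) =
  cint leb2 setT (fun q => f q * cint leb2 setT (fun p => k (p, q) * g p)).
Proof.
move=> mk kM fi gi.
have mf := cintegrable_meas fi; have mg := cintegrable_meas gi.
have M0 : 0 <= M by exact: le_trans (cmod_ge0 _) (kM ((0, 0), (0, 0))).
pose F (w : plane * plane) : C := g w.1 * (k w * f w.2).
have mF : cmeasurable F.
  apply: cmeasurableM; first exact: (cmeasurable_comp mg measurable_fst).
  by apply: cmeasurableM => //; exact: (cmeasurable_comp mf measurable_snd).
have FB p q : cmod (F (p, q)) <= cmod (g p) * (M * cmod (f q)).
  by rewrite /F !cmodM; apply: (ler_wpM2l (cmod_ge0 _)); apply: ler_wpM2r; [exact: cmod_ge0|exact: kM].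
have h0 q : 0 <= M * cmod (f q) by rewrite mulr_ge0// cmod_ge0.
have iMf : sleb2.-integrable setT (EFin \o (fun q => M * cmod (f q))).
  exact: (integrableZl measurableT M (cintegrable_cmod fi)).
have mk1 p : cmeasurable ((fun q => k (p, q)) : plane -> C).
  by apply: (cmeasurable_comp mk); apply/measurable_fun_pair => //; exact: measurable_cst.
have mk2 q : cmeasurable ((fun p => k (p, q)) : plane -> C).
  by apply: (cmeasurable_comp mk); apply/measurable_fun_pair => //; exact: measurable_cst.
have h := @cfubini _ _ _ _ _ sleb2 sleb2 (fun p => cmod (g p)) _
  (fun p => cmod_ge0 (g p)) h0 (cintegrable_cmod gi) iMf F mF FB.
have e1 p : cint leb2 setT (fun q => F (p, q)) =
    g p * cint leb2 setT (fun q => k (p, q) * f q).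
  exact: (cintZ (g p) (cintegrableM_bounded fi (mk1 p) (fun q => kM (p, q)))).
have e2 q : cint leb2 setT (fun p => F (p, q)) =
    f q * cint leb2 setT (fun p => k (p, q) * g p).
  rewrite -(cintZ (f q) (cintegrableM_bounded gi (mk2 q) (fun p => kM (p, q)))).
  by apply: eq_cint => p; rewrite /F /=; ring.
transitivity (cint leb2 setT (fun p => cint leb2 setT (fun q => F (p, q)))).
  by apply: eq_cint => p; rewrite e1.
transitivity (cint leb2 setT (fun q => cint leb2 setT (fun p => F (p, q)))).
  exact: h.
by apply: eq_cint => q; rewrite e2.
Qed.

Lemma fourier_transpose (f g : R * R -> C) :
  cintegrable leb2 setT f -> cintegrable leb2 setT g ->
  cint leb2 setT (fun p => f p * fourier g p) =
  cint leb2 setT (fun z => fourier f z * g z).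
Proof.
move=> fi gi.
have mk : cmeasurable (fun w : plane * plane => expi (- dot w.1 w.2) : C).
  apply: cmeasurable_expi; apply: measurable_funN.
  by apply: measurable_dot; [exact: measurable_fst|exact: measurable_snd].
have kM w : cmod (expi (- dot w.1 w.2) : C) <= (1 : R) by rewrite cmod_expi.
rewrite -(cfubini_kernel mk kM fi gi); apply: eq_cint => p; rewrite mulrC.
congr (_ * _); apply: eq_cint => q /=; congr (expi (- _) * _).
exact: dotC.
Qed.

Lemma bounded_density_integrable (g psi : R * R -> C) (M : R) :
  cmeasurable (g : plane -> C) -> (forall p, cmod (g p) <= M) -> schwartz psi ->
  cintegrable leb2 setT (fun p => g p * psi p).
Proof.
by move=> mg gM spsi; exact: (cintegrableM_bounded (schwartz_integrable spsi) mg gM).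
Qed.

Lemma tempered_bounded (g : R * R -> C) (M : R) :
  cmeasurable (g : plane -> C) -> (forall p, cmod (g p) <= M) ->
  tempered (dist_of g).
Proof.
move=> mg gM; have M0 : 0 <= M by exact: le_trans (cmod_ge0 _) (gM (0, 0)).
split.
  move=> a f h sf sh; have i1 := bounded_density_integrable mg gM sf.
  have i2 := bounded_density_integrable mg gM sh.
  rewrite /dist_of -(cintZ a i1) -cintD//; last exact: cintegrableZ.
  by apply: eq_cint => p; ring.
pose QQ (p : R * R) : R := poisson 1 p.1 * poisson 1 p.2.
have iQ : leb2.-integrable setT (EFin \o QQ) by exact: integrable_poisson1_prod.
(* Order 4 is the weight that bounds a test function by the product of Poisson kernels [QQ]; the
   factor 2 comes from integrating real and imaginary parts separately. *)
exists 4%N, (2 * (M * \int[leb2]_p QQ p)) => f sf B hB.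
have fB p : cmod (f p) <= B * QQ p.
  by apply: weight4_decay; [exact: cmod_ge0|exact: (hB [::])].
have gfB p : cmod (g p * f p) <= (M * B) * QQ p.
  rewrite cmodM -mulrA; apply: ler_pM => //; exact: cmod_ge0.
have i := integrableZl measurableT (M * B) iQ.
have mgf := cintegrable_meas (bounded_density_integrable mg gM sf).
apply: (le_trans (cmod_cint mgf gfB i)).
by rewrite (RintegralZl (M * B) measurableT iQ) le_eqVlt; apply/orP; left; apply/eqP; ring.
Qed.

Lemma inv_fourierK (psi : R * R -> C) : schwartz psi ->
  inv_fourier (fourier psi) = psi.
Proof.
move=> spsi; apply/funext => p; rewrite /inv_fourier.
rewrite (_ : cint _ _ _ = ((2 * pi) ^+ 2)%:C * psi p); last first.
  rewrite -(schwartz_inversion p spsi); apply: eq_cint => z.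
  by congr (expi _ * _); exact: dotC.
rewrite mulrA -rmorphM/= mulVf ?mul1r//.
by rewrite expf_neq0// mulf_neq0 ?pnatr_eq0// gt_eqF// pi_gt0.
Qed.

(** [G_dist] is an inverse transform defined by transposition, so the claim reduces to the inversion
    formula for the test function. *)
Lemma kp_symbol_density (alpha t : R) :
  has_density (dist_fourier (G_dist alpha t)) (kp_symbol alpha t).
Proof.
move=> psi spsi; split.
  apply: (bounded_density_integrable (M := 1)) => //.
    exact: measurable_kp_symbol.
  by move=> p; rewrite cmod_expi.
by rewrite /dist_fourier /G_dist /dist_inv_fourier inv_fourierK.
Qed.

Section bessel.
Variable beta : R.
Hypothesis beta0 : 0 <= beta.

Lemma measurable_inv_bessel_symbol :
  cmeasurable ((fun z => (bessel_symbol beta z)^-1) : plane -> C).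
Proof.
apply: cmeasurableV; apply: cmeasurableR.
have mq : measurable_fun setT (fun z : plane => 1 + z.1 ^+ 2).
  apply: measurable_funD => //; apply: measurable_funX; exact: measurable_fst.
exact: (measurableT_comp (measurable_powR (beta / 2)) mq).
Qed.

Lemma cmod_inv_bessel_symbol_le (z : R * R) : cmod (bessel_symbol beta z)^-1 <= 1.
Proof.
rewrite cmodV cmodR ger0_norm ?powR_ge0// invf_le1 ?powR_gt0 ?oneDsqr_gt0//.
rewrite -[leLHS](powRr0 (1 + z.1 ^+ 2)); apply: ler_powR; first by rewrite lerDl sqr_ge0.
by rewrite divr_ge0.
Qed.

Lemma bessel_symbol_neq0 (z : R * R) : bessel_symbol beta z != 0.
Proof. by rewrite fmorph_eq0 gt_eqF// powR_gt0// oneDsqr_gt0. Qed.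

Variables (phi : @dist R) (f : R * R -> C).
Hypothesis fi : cintegrable leb2 setT f.
Hypothesis phif : smooth_multiplier (bessel_symbol beta) phi (dist_of f).

Lemma measurable_fourier_div_bessel :
  cmeasurable ((fun z => fourier f z / bessel_symbol beta z) : plane -> C).
Proof.
by apply: cmeasurableM; [exact: fourier_measurable|exact: measurable_inv_bessel_symbol].
Qed.

Lemma fourier_div_bessel_bounded :
  exists N : R, forall z, cmod (fourier f z / bessel_symbol beta z) <= N.
Proof.
have [N fN] := fourier_bounded fi; exists N => z; rewrite cmodM.
by rewrite -[leRHS]mulr1; apply: ler_pM; rewrite ?cmod_ge0// cmod_inv_bessel_symbol_le.
Qed.

(** A test function divided by the Bessel symbol is still Schwartz. Testing the hypothesis on [phi]
    against this quotient, and transposing the Fourier transform onto the integrable [f], gives the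
    density. *)
Lemma fourier_div_bessel_density :
  has_density (dist_fourier phi) (fun z => fourier f z / bessel_symbol beta z).
Proof.
move=> psi spsi; have [N fN] := fourier_div_bessel_bounded; split.
  exact: bounded_density_integrable measurable_fourier_div_bessel fN spsi.
pose chi (z : R * R) : C := (bessel_symbol beta z)^-1 * psi z.
have schi : schwartz chi.
  have := schwartz_bessel_monomial spsi 1 (- (beta / 2)) 0.
  rewrite (_ : (fun _ => _) = chi)//; apply/funext => z; rewrite /chi.
  by rewrite /bessel_monomial expr0 mulr1 mul1r powRN fmorphV.
have psiE : psi = (fun z => bessel_symbol beta z * chi z).
  by apply/funext => z; rewrite /chi mulrA mulfV ?mul1r// bessel_symbol_neq0.
rewrite /dist_fourier {1}psiE -[LHS]/(dist_fourier phi _) -phif//.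
rewrite /dist_fourier /dist_of (fourier_transpose fi (schwartz_integrable schi)).
by apply: eq_cint => z; rewrite /chi mulrA.
Qed.

End bessel.

End Densities.

(** * Fourier transforms of A and of the solution *)

Section FundamentalSolution.
Context {R : realType}.
Local Notation C := R[i].
Local Notation mR := (measurableTypeR R).
Local Notation plane := (mR * mR)%type.
Variables (alpha beta t : R).
Hypotheses (halpha : 0 < alpha) (hbeta : (alpha + 3) / 2 < beta) (t0 : t != 0).
Variables (Jr Ji M : R).
Hypothesis HJ : fresnel_profile Jr Ji M.

Local Notation amp := (amplitude alpha t Jr Ji).
Local Notation b := (dual_phase alpha t).
Local Notation c0 := (((2 * pi) ^- 2)%:C : C).
Local Notation c2 := (((2 * pi) ^+ 2)%:C : C).
Local Notation m1 := (fun xi : R => c0 * inv_symbol beta xi).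
Local Notation m2 := (fun xi : R => (0 +i* xi) * (c0 * inv_symbol beta xi)).

Let c2c0 : c2 * c0 = 1.
Proof.
rewrite -rmorphM/= mulfV//.
by rewrite expf_neq0// mulf_neq0 ?pnatr_eq0// gt_eqF// pi_gt0.
Qed.

Let beta0 : 0 <= beta.
Proof. by move: halpha hbeta; lra. Qed.

Let dx_neq0 (x : R) : x != 0 -> (0 +i* x : C) != 0.
Proof. by move=> x0; rewrite eq_complex /= eqxx. Qed.

Let symbol_cancel (z : R * R) : z.1 != 0 ->
  dx_symbol z * bessel_symbol beta z * inv_symbol beta z.1 = 1.
Proof.
move=> z0; rewrite mulfV// mulf_neq0 ?bessel_symbol_neq0//.
exact: dx_neq0.
Qed.

Let m2E (z : R * R) : z.1 != 0 -> m2 z.1 = c0 * (bessel_symbol beta z)^-1.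
Proof.
move=> z0; rewrite /inv_symbol [(dx_symbol _ * _)^-1]invfM mulrCA; congr (_ * _).
by rewrite mulrA mulfV ?mul1r//; exact: dx_neq0.
Qed.

Let mm1 : cmeasurable (m1 : mR -> C).
Proof. by apply: cmeasurableM; [exact: cmeasurable_cst|exact: measurable_inv_symbol]. Qed.

Let mm2 : cmeasurable (m2 : mR -> C).
Proof. by apply: cmeasurableM; [exact: measurable_imag|exact: mm1]. Qed.

Let m2_le (z : R * R) : cmod (m2 z.1) <= cmod c0.
Proof.
have [->|z0] := eqVneq z.1 0; first by rewrite mul0r cmod0 cmod_ge0.
rewrite m2E// cmodM -[leRHS]mulr1; apply: (ler_wpM2l (cmod_ge0 _)).
exact: cmod_inv_bessel_symbol_le.
Qed.

Let K := osc_kernel (amp m1) b.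
Let K1 := osc_kernel (amp m2) b.
Let ia1 := A_amplitude_integrable halpha hbeta t0 Jr Ji.
Let amp2E : amp m2 = fun xi => (0 +i* xi) * amp m1 xi.
Proof. by apply/funext => xi; exact: amplitudeM. Qed.
Let ia2 : cintegrable leb1 setT (amp m2).
Proof. by rewrite amp2E; exact: A_dx_amplitude_integrable. Qed.
Let mb := measurable_dual_phase alpha t.

Let transfer (m : R -> C) (B : R) (psi : R * R -> C) (q : R * R) :
  cmeasurable (m : mR -> C) -> m 0 = 0 -> cintegrable leb1 setT (amp m) ->
  schwartz psi ->
  (forall z, cmod (m z.1 * psi z) <= B * (poisson 1 z.1 * poisson 1 z.2)) ->
  cint leb2 setT (fun p => osc_kernel (amp m) b (p - q) * fourier psi p) =
  c2 * cint leb2 setT (fun z => m z.1 * kp_symbol alpha t z * expi (- dot q z) * psi z).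
Proof. by move=> h1 h2 h3 h4 h5; exact: (osc_kernel_fourier t0 HJ q h1 h2 h3 h4 h5). Qed.

(** The test function reaches A already multiplied by the symbol of d_x (I - d_x^2)^(beta/2). The
    product [chi] is Schwartz and cancels the singular inverse symbol off the axis, leaving [psi]
    times the normalization of the inverse transform; the pairing is taken at translation 0. *)
Lemma smooth_multiplier_A_G : smooth_multiplier
  (fun z => dx_symbol z * bessel_symbol beta z)
  (dist_of (A_kernel alpha beta t)) (G_dist alpha t).
Proof.
move=> psi spsi; rewrite (kp_symbol_density alpha t spsi).2.
have ikp := (kp_symbol_density alpha t spsi).1.
pose chi z := dx_symbol z * bessel_symbol beta z * psi z.
have schi : schwartz chi.
  have := schwartz_bessel_monomial spsi (0 +i* 1) (beta / 2) 1.
  rewrite (_ : (fun _ => _) = chi)//; apply/funext => z; rewrite /chi.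
  congr (_ * _); rewrite /bessel_monomial expr1 rmorphM/= mulrCA mulrC; congr (_ * _).
  by apply: complex_eq; rewrite ?ReM ?ImM /=; ring.
have [B B0 psiB] := schwartz_decay spsi.
have m1chi z : z.1 != 0 -> m1 z.1 * chi z = c0 * psi z.
  move=> z0; rewrite /chi -(mulrA c0); congr (_ * _); rewrite mulrA.
  by rewrite [inv_symbol _ _ * _]mulrC symbol_cancel// mul1r.
rewrite /dist_fourier /dist_of (A_kernelE halpha hbeta t0 HJ) -/K.
transitivity (cint leb2 setT (fun p => K (p - 0) * fourier chi p)); last first.
  by apply: eq_cint => p; rewrite subr0.
rewrite (@transfer m1 (cmod c0 * B) chi 0 mm1 _ ia1 schi); first last.
- move=> z; have [z0|z0] := eqVneq z.1 0.
    rewrite z0 inv_symbol0 mulr0 mul0r cmod0; apply: mulr_ge0.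
      by apply: mulr_ge0 => //; exact: cmod_ge0.
    by rewrite mulr_ge0// poisson_ge0.
  rewrite m1chi// cmodM -mulrA; apply: (ler_wpM2l (cmod_ge0 _)); exact: psiB.
- by rewrite inv_symbol0 mulr0.
transitivity (c2 * cint leb2 setT (fun z => c0 * (kp_symbol alpha t z * psi z))).
  by rewrite (cintZ c0 ikp) mulrA c2c0 mul1r.
congr (_ * _); apply/esym/eq_cint_off_axis.
- apply: cmeasurableM; last exact: ccontinuous_measurable_plane (schwartz_continuous schi).
  apply: cmeasurableM.
    apply: cmeasurableM; last exact: measurable_kp_symbol.
    exact: (cmeasurable_comp mm1 measurable_fst).
  apply: cmeasurable_expi; apply: measurable_funN.
  by apply: measurable_dot => //; exact: measurable_cst.
- apply: cmeasurableM; first exact: cmeasurable_cst.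
  exact: (cintegrable_meas ikp).
move=> z z0; rewrite (_ : dot 0 z = 0) ?oppr0 ?expi0 ?mulr1; last first.
  by rewrite /dot !mul0r addr0.
by rewrite [m1 _ * _]mulrC -mulrA m1chi// mulrCA.
Qed.

Variable f : R * R -> C.
Hypothesis fi : cintegrable leb2 setT f.

(** [K1] is the x-derivative of A, and its symbol [m2] is bounded since the factor i xi cancels the
    singularity. Fubini exposes, for each [q], the pairing of a translate of [K1] with
    [fourier psi], which turns out to be the Fourier transform at [q] of [w]; transposition then
    moves the transform to [f]. *)
Lemma dx_kernel_fourier (psi : R * R -> C) : schwartz psi ->
  cint leb2 setT (fun p => convolution K1 f p * fourier psi p) =
  cint leb2 setT (fun z => (kp_symbol alpha t z *
    (fourier f z / bessel_symbol beta z)) * psi z).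
Proof.
move=> spsi; have [N KN] := osc_bounded ia2 mb.
have cK1 := osc_continuous ia2 mb.
have mK1 := ccontinuous_measurable_plane cK1.
have mk : cmeasurable (fun w : plane * plane => K1 (w.1 - w.2)).
  apply: (cmeasurable_comp mK1); apply/measurable_fun_pair.
    by apply: measurable_funB; apply: measurableT_comp.
  by apply: measurable_funB; apply: measurableT_comp.
have kN (w : plane * plane) : cmod (K1 (w.1 - w.2)) <= N by exact: KN.
have ipsi := schwartz_fourier_integrable spsi.
have [B B0 psiB] := schwartz_decay spsi.
pose w (z : R * R) : C := c2 * (m2 z.1 * kp_symbol alpha t z * psi z).
have mpsi := ccontinuous_measurable_plane (schwartz_continuous spsi).
have mw0 : cmeasurable ((fun z => m2 z.1 * kp_symbol alpha t z * psi z) : plane -> C).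
  apply: cmeasurableM => //; apply: cmeasurableM; last exact: measurable_kp_symbol.
  exact: (cmeasurable_comp mm2 measurable_fst).
have m2B z : cmod (m2 z.1 * psi z) <= cmod c0 * B * (poisson 1 z.1 * poisson 1 z.2).
  by rewrite cmodM -mulrA; apply: ler_pM; rewrite ?cmod_ge0.
have iw0 : cintegrable leb2 setT (fun z => m2 z.1 * kp_symbol alpha t z * psi z).
  apply: (cintegrable_le mw0 _ (integrableZl measurableT (cmod c0 * B) integrable_poisson1_prod)).
  move=> z; rewrite mulrAC cmodM cmod_expi mulr1; exact: m2B.
have iw : cintegrable leb2 setT w by exact: cintegrableZ.
transitivity (cint leb2 setT (fun p => fourier psi p *
    cint leb2 setT (fun q => K1 ((p, q).1 - (p, q).2) * f q))).
  by apply: eq_cint => p; rewrite mulrC.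
rewrite (cfubini_kernel mk kN fi ipsi).
transitivity (cint leb2 setT (fun q => f q * fourier w q)).
  apply: eq_cint => q; congr (_ * _); rewrite /=.
  rewrite (@transfer m2 _ psi q mm2 _ ia2 spsi m2B); last by rewrite mul0r.
  rewrite /fourier -cintZ; last first.
    have := fourier_integrand_integrable q iw0.
    rewrite (_ : (fun _ => _) = (fun z =>
      m2 z.1 * kp_symbol alpha t z * expi (- dot q z) * psi z))//.
    by apply/funext => z; rewrite dotC; ring.
  by apply: eq_cint => z; rewrite /w -/(dot z q) dotC; ring.
rewrite (fourier_transpose fi iw); apply: eq_cint_off_axis.
- by apply: cmeasurableM; [exact: fourier_measurable|exact: (cintegrable_meas iw)].
- apply: cmeasurableM => //; apply: cmeasurableM; first exact: measurable_kp_symbol.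
  exact: measurable_fourier_div_bessel.
move=> z z0; rewrite /w m2E//.
transitivity ((c2 * c0) * (kp_symbol alpha t z *
  (fourier f z / bessel_symbol beta z) * psi z)); first by ring.
by rewrite c2c0 mul1r.
Qed.

End FundamentalSolution.

Theorem theorem3p1 (R : realType) (alpha beta : R)
    (halpha : 0 < alpha) (hbeta : (alpha + 3) / 2 < beta)
    (phi : @dist R) (hphi : tempered phi)
    (f : R * R -> R[i]) (hf : cintegrable leb2 setT f)
    (hphif : smooth_multiplier (bessel_symbol beta) phi (dist_of f))
    (t : R) (ht : t != 0) :
  let At := A_kernel alpha beta t in
  let Gt := G_dist alpha t in
  let v := convolution At f in
  let u := cderive e_x v in
  [/\ A_converges alpha beta t,
      smooth_multiplier (fun z => dx_symbol z * bessel_symbol beta z)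
        (dist_of At) Gt &
      [/\ ccontinuous At, Linfty At & C1x At]] /\
  [/\ forall p : R * R, cintegrable leb2 setT (fun q => At (p - q) * f q),
      ccontinuous v &
      forall y : R, ccvg +oo (fun x => v (x, y)) 0 /\
                    ccvg -oo (fun x => v (x, y)) 0] /\
  [/\ forall p, cderivable e_x v p,
      tempered (dist_of u),
      is_S alpha t phi (dist_of u),
      dist_conv Gt phi (dist_of u) &
      forall y : R, is_improper_integral (fun x => u (x, y)) 0].
Proof.
move=> At Gt v u; have [Jr [Ji [M HJ]]] := @fresnel_constants R.
pose m1 (xi : R) : R[i] := ((2 * pi) ^- 2)%:C * inv_symbol beta xi.
pose a := amplitude alpha t Jr Ji m1.
pose K1 := osc_kernel (amplitude alpha t Jr Ji (fun xi => (0 +i* xi) * m1 xi))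
  (dual_phase alpha t).
have AE : At = osc_kernel a (dual_phase alpha t) := A_kernelE halpha hbeta ht HJ.
have K1E : K1 = osc_kernel (fun xi => (0 +i* xi) * a xi) (dual_phase alpha t).
  suff E : amplitude alpha t Jr Ji (fun xi => (0 +i* xi) * m1 xi) =
      fun xi => (0 +i* xi) * a xi by rewrite /K1 E.
  by apply/funext => xi; exact: amplitudeM.
have ia : cintegrable leb1 setT a := A_amplitude_integrable halpha hbeta ht Jr Ji.
have ia1 : cintegrable leb1 setT (fun xi => (0 +i* xi) * a xi) :=
  A_dx_amplitude_integrable halpha hbeta ht Jr Ji.
have mb := measurable_dual_phase alpha t.
have A1 : A_converges alpha beta t := A_converges_inner halpha hbeta ht HJ.
have A2 : smooth_multiplier (fun z => dx_symbol z * bessel_symbol beta z)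
    (dist_of At) Gt := smooth_multiplier_A_G halpha hbeta ht HJ.
have dK1 := fun psi => @dx_kernel_fourier _ _ _ _ halpha hbeta ht _ _ _ HJ f hf psi.
rewrite -/m1 -/K1 in dK1.
clearbody K1 At.
have cA : ccontinuous At by rewrite AE; exact: osc_continuous.
have cK1 : ccontinuous K1 by rewrite K1E; exact: osc_continuous.
have [N AN] : exists N : R, forall p, cmod (At p) <= N by rewrite AE; exact: osc_bounded.
have [N1 KN1] : exists N : R, forall p, cmod (K1 p) <= N by rewrite K1E; exact: osc_bounded.
have dA p : cis_derive (slice false At p) p.1 (K1 p) by rewrite AE K1E; exact: osc_derive.
have dv := conv_derive hf cA AN KN1 dA; rewrite -/v in dv.
have uE : u = convolution K1 f by apply/funext => p; exact: (dv p).2.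
have dvu p : cderivable e_x v p /\ cderive e_x v p = u p by split => //; exact: (dv p).1.
have cv : ccontinuous v := conv_continuous hf cA AN.
have cu : ccontinuous u by have := conv_continuous hf cK1 KN1; rewrite -uE.
have [B uB] : exists B : R, forall p, cmod (u p) <= B.
  by have := conv_bounded hf cK1 KN1; rewrite -uE.
have iv p := conv_integrable hf cA AN p.
clearbody u.
have mA := ccontinuous_measurable_plane cA.
have mu := ccontinuous_measurable_plane cu.
have v0 y : ccvg +oo (fun x => v (x, y)) 0 /\ ccvg -oo (fun x => v (x, y)) 0.
  split; apply: (conv_cvg0 hf cA AN).
  - exact: cg_pinfty.
  - by move=> x0; exact: cvg_addrr.
  - move=> z; rewrite AE; apply: (osc_cvg0 ia mb); apply/cvgryPge => A.
    have := nbhs_pinfty_ge (num_real A); apply: filterS => x Ax.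
    exact: le_trans Ax (ler_norm x).
  - exact: cg_ninfty.
  - by move=> x0; exact: cvg_addrr_Ny.
  - move=> z; rewrite AE; apply: (osc_cvg0 ia mb); apply/cvgryPge => A.
    have := nbhs_ninfty_le (num_real (- A)); apply: filterS => x Ax.
    by rewrite -normrN (le_trans _ (ler_norm _))// lerNr.
clearbody v.
have beta0 : 0 <= beta by move: halpha hbeta; lra.
(* Both [is_S] and [dist_conv] are assertions on Fourier densities; the densities of [phi] and of
   [u] obtained here serve for the two of them. *)
have gphi := fourier_div_bessel_density beta0 hf hphif.
have gu : has_density (dist_fourier (dist_of u)) (fun z => kp_symbol alpha t z *
    (fourier f z / bessel_symbol beta z)).
  move=> psi spsi; split; last first.
    by rewrite uE; exact: dK1 psi spsi.
  have [D gD] := fourier_div_bessel_bounded beta0 hf.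
  apply: (bounded_density_integrable (M := D)) => //.
    apply: cmeasurableM; first exact: measurable_kp_symbol.
    exact: measurable_fourier_div_bessel.
  by move=> z; rewrite cmodM cmod_expi mul1r.
split; first split.
- exact: A1.
- exact: A2.
- split=> //.
    split; [exact: mA.1|exact: mA.2|exists N; exact: aeW].
  by split=> // p; exact: (@cis_derive_partial _ false _ _ _ (dA p)).1.
split; first by split.
split.
- by move=> p; exact: (dvu p).1.
- exact: tempered_bounded mu uB.
- by exists (fun z => fourier f z / bessel_symbol beta z).
- exists (kp_symbol alpha t), (fun z => fourier f z / bessel_symbol beta z).
  by split=> //; exact: kp_symbol_density.
(* The value 0 is read as the difference of the limits of the primitive [v] at the two ends of the
   horizontal line. *)
move=> y; rewrite -[0]subr0; apply: (@derivative_is_improper_integral _ (fun x => v (x, y))).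
- by move=> x; rewrite -(dvu (x, y)).2; exact: (cderivableP (b := false) (dvu (x, y)).1).
- exact: (ccontinuous_slice false (0, y) cu).
- exact: (v0 y).1.
- exact: (v0 y).2.
Qed.
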